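(* Let $m\ge0$ and let $\Sigma$ be a spacelike surface near the future null-infinity of Schwarzschild spacetime of mass $m$, given as the graph $\{\bar v=-P(\mathbf y,s)\}$, with mean curvature $H>0$ (not necessarily constant) with respect to the future directed unit normal. Assume $P$ and $H$ are $C^4$ up to $s=0$, let $H_0=H|_{s=0}$, and let $L=-(2P_s+s^2(1-2ms)P_s^2+|\widetilde\nabla P|^2)$. Then: (a) At $s=0$, $L=0$ or $L=H_0^{-2}$. (b) Assume $L=H_0^{-2}>0$ at $s=0$. Then: (i) At $s=0$, $P_s=-\frac12(H_0^{-2}+|\widetilde\nabla P|^2)$. (ii) $H=H_0+\mathcal O(s^2)$ if and only if $L_s=-H_0^{-2}\left(\widetilde\Delta P+H_0^{-1}\langle\widetilde\nabla H_0,\widetilde\nabla P\rangle\right)$ at $s=0$, which is equivalent to $$P_{ss}=\tfrac12H_0^{-2}\widetilde\Delta P+\tfrac12\langle\widetilde\nabla|\widetilde\nabla P|^2,\widetilde\nabla P\rangle-\tfrac12H_0^{-3}\langle\widetilde\nabla H_0,\widetilde\nabla P\rangle\quad\text{at } s=0.$$ (iii) Suppose $H=H_0+\mathcal O(s^2)$. Then $H=H_0+\mathcal O(s^3)$ if and only if $$L_{ss}=-\tfrac92H_0^{2}L_s^2-4(L_s\widetilde\Delta P+L\widetilde\Delta P_s)+2\langle\widetilde\nabla L_s,\widetilde\nabla P\rangle+2\langle\widetilde\nabla(H_0^{-2}),\widetilde\nabla P_s\rangle+4H_0^{-2}P_s$$ at $s=0$, which is equivalent to $$P_{sss}=\tfrac94H_0^{2}L_s^2+2(L_s\widetilde\Delta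 P+H_0^{-2}\widetilde\Delta P_s)-\langle\widetilde\nabla L_s,\widetilde\nabla P\rangle-\langle\widetilde\nabla(H_0^{-2}),\widetilde\nabla P_s\rangle-2H_0^{-2}P_s-\langle\widetilde\nabla P_{ss},\widetilde\nabla P\rangle-\langle\widetilde\nabla P_s,\widetilde\nabla P_s\rangle-P_s^2$$ at $s=0$, where $L_s,P_s,P_{ss}$ are given by (b)(i) and (b)(ii), and so can be expressed in terms of $H$ and the boundary value of $P$ at $s=0$ and their derivatives as functions on $\mathbb S^2$. (c) Assume $L=H_0^{-2}$ at $s=0$ and $H=H_0+\mathcal O(s^3)$. Then the boundary value of $P$ at $s=0$ satisfies the following compatibility condition at $s=0$: $$\begin{aligned}0=&-2H_0^{-3}H_{sss}+\tfrac92H_0^{-1}\langle\widetilde\nabla H_0,\widetilde\nabla P\rangle L_{ss}+\tfrac52L_{ss}\widetilde\Delta P+\tfrac34H_0^4L_s^3-4L_s\widetilde\Delta P_s-2H_0^{-2}\widetilde\Delta P_{ss}\\&+6L_sP_s+\langle\widetilde\nabla L_{ss},\widetilde\nabla P\rangle+2\langle\widetilde\nabla L_s,\widetilde\nabla P_s\rangle+\langle\widetilde\nabla(H_0^{-2}),\widetilde\nabla P_{ss}\rangle,\end{aligned}$$ where $P_s,L_s,P_{ss},L_{ss}$ are given by (b)(i)--(iii), and so can be expressed in terms of $H$ and the boundary value of $P$ at $s=0$ and their derivatives as functions on $\mathbb S^2$. (d) Assume $P$ and $H>0$ are smooth up to $s=0$ and $L=H_0^{-2}$ at $s=0$. Then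 at $s=0$, $\partial_s^kP$ can be expressed in terms of $P$, $P_{ssss}$ and $H,\partial_sH,\dots,\partial_s^{k-1}H$ at $s=0$ and their derivatives with respect to $\mathbf y$.
   Context: $\mathbb S^2\subset\mathbb R^3$ is the unit sphere with standard metric $\sigma$; $\widetilde\nabla,\widetilde\Delta$ are the covariant derivative and Laplacian of $(\mathbb S^2,\sigma)$ (acting in $\mathbf y$ at fixed $s$), and $\langle\cdot,\cdot\rangle$, $|\cdot|$ are taken with respect to $\sigma$. For $m\ge0$ put $h(r)=1-\frac{2m}{r}$. The Schwarzschild metric on $r>2m$ is $g_{\mathrm{Sch}}=-h\,dt^2+h^{-1}dr^2+r^2\sigma$ (Minkowski if $m=0$), with $\partial_t$ future directed. Let $r_*=r+2m\log|\frac r{2m}-1|$ ($r_*=r$ if $m=0$), $\bar v=t-r_*$ and $s=r^{-1}$. In the coordinates $(\mathbf y,s,\bar v)$, $g_{\mathrm{Sch}}=s^{-2}\bar g$ with $\bar g=-s^2(1-2ms)d\bar v^2+2\,d\bar v\,ds+\sigma$; the future null-infinity is $\{s=0\}$. $P$ is always assumed smooth for $0<s\le s_0$, for some $s_0>0$. With $F=\bar v+P$, $L=-\bar g(\bar\nabla F,\bar\nabla F)$, the gradient being taken with respect to $\bar g$. The mean curvature is one third of the trace of the second fundamental form with respect to the future directed unit normal $\mathbf n$, $H=\frac13\mathrm{div}\,\mathbf n$; it is viewed as a function of $(\mathbf y,s)$. $\phi=\mathcal O(s^k)$ means that $s^{-k}\phi$ extends smoothly to $s=0$ (for $\phi$ of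 finite differentiability, understood as $\partial_s^j\phi=0$ at $s=0$ for $0\le j\le k-1$). Subscripts $s$ denote $\partial_s$. *)

(* Defs.v *)
From HB Require Import structures.
From mathcomp Require Import all_boot all_order all_algebra.
From mathcomp Require Import all_classical all_reals all_analysis.

Set Implicit Arguments.
Unset Strict Implicit.
Unset Printing Implicit Defensive.

Import Order.TTheory GRing.Theory Num.Theory.
Import numFieldNormedType.Exports.

Local Open Scope classical_set_scope.
Local Open Scope ring_scope.

Section Regularity.
Context {R : realType} {V : normedModType R}.

(* For finite-dimensional V and open U this is the usual class C^k(U): f is C^1
   iff it is differentiable with continuous directional derivatives. *)
Fixpoint Ck (k : nat) (U : set V) (f : V -> R) : Prop :=
  match k with
  | 0 => forall x, U x -> {for x, continuous f}
  | k'.+1 => (forall x, U x -> differentiable f x) /\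
             (forall v, Ck k' U ('D_v f))
  end.

Definition Cinfty (U : set V) (f : V -> R) : Prop := forall k, Ck k U f.

(* Regularity on a set A that need not be open: f agrees on A with a function
   of the given class on an open neighbourhood of A. *)
Definition regular_on (reg : set V -> (V -> R) -> Prop) (A : set V)
    (f : V -> R) : Prop :=
  exists (U : set V) (fe : V -> R),
    [/\ open U, A `<=` U, reg U fe & {in A, f =1 fe}].

End Regularity.

Section PseudoRiemannian.
Context {R : realType} {n : nat}.
Implicit Types (g : 'rV[R]_n.+1 -> 'M[R]_n.+1) (F : 'rV[R]_n.+1 -> R).
Implicit Types (X : 'rV[R]_n.+1 -> 'rV[R]_n.+1) (p u v : 'rV[R]_n.+1).

Definition partial (a : 'I_n.+1) F p : R := 'D_(delta_mx 0 a) F p.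

Definition metric g p u v : R := (u *m g p *m v^T) 0 0.

Definition christoffel g p (a b c : 'I_n.+1) : R :=
  2^-1 * \sum_(d < n.+1) invmx (g p) a d *
    (partial b (fun q => g q d c) p + partial c (fun q => g q d b) p
     - partial d (fun q => g q b c) p).

Definition covderiv g X p (b a : 'I_n.+1) : R :=
  partial b (fun q => X q 0 a) p
  + \sum_(c < n.+1) christoffel g p a b c * X p 0 c.

Definition divergence g X p : R := \sum_(a < n.+1) covderiv g X p a a.

Definition gradient g F p : 'rV[R]_n.+1 :=
  \row_a \sum_(b < n.+1) invmx (g p) a b * partial b F p.

(* When grad F is timelike, this is the unit normal field of the level sets of
   F that satisfies g(n, T) = - dF(T) / |grad F|; hence it is future directed
   when dF(T) > 0 for a future directed timelike T. *)
Definition unit_normal g F p : 'rV[R]_n.+1 :=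
  - (Num.sqrt (- metric g p (gradient g F p) (gradient g F p)))^-1
    *: gradient g F p.

End PseudoRiemannian.

Section Sphere.
Context {R : realType}.
Implicit Types (f : 'rV[R]_3 -> R) (x y u v : 'rV[R]_3).

Definition dot u v : R := \sum_(i < 3) u 0 i * v 0 i.

(* The library norm on row vectors is the sup norm. *)
Definition enorm x : R := Num.sqrt (dot x x).

Definition S2 : set 'rV[R]_3 := [set y | enorm y = 1].

Definition sph x : 'rV[R]_3 := (enorm x)^-1 *: x.

(* The functions below are meant on the sphere.  A function on S^2 is extended
   to R^3 \ {0} as f o sph, constantly along rays.  The Euclidean gradient of
   this extension at y in S^2 is tangent to S^2 and represents df_y, so it is
   the gradient for the induced metric. *)
Definition sgrad f y : 'rV[R]_3 :=
  \row_i 'D_(delta_mx 0 i) (fun x => f (sph x)) y.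

(* For a tangent field X, the Levi-Civita connection is the tangential part of
   the Euclidean derivative; since X o sph is constant along rays, the trace of
   the full Euclidean derivative equals the tangential trace. *)
Definition sdiv (X : 'rV[R]_3 -> 'rV[R]_3) y : R :=
  \sum_(i < 3) 'D_(delta_mx 0 i) (fun x => X (sph x) 0 i) y.

Definition slap f y : R := sdiv (sgrad f) y.

End Sphere.

Section BoundaryDerivatives.
Context {R : realType}.
Implicit Types f : 'rV[R]_3 -> R -> R.

(* Right derivative in s: it is the s-derivative where f is differentiable, and
   at s = 0 it only involves the values of f for s >= 0. *)
Definition ds f : 'rV[R]_3 -> R -> R :=
  fun y s => lim (h^-1 * (f y (s + h) - f y s) @[h --> 0^'+]).

Definition bdy (j : nat) f : 'rV[R]_3 -> R := fun y => iter j ds f y 0.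

(* O(s^k), in the sense used for functions of finite differentiability. *)
Definition bigO_s (k : nat) f : Prop :=
  forall j, (j < k)%N -> forall y, S2 y -> bdy j f y = 0.

End BoundaryDerivatives.

Section Schwarzschild.
Context {R : realType}.
Implicit Types (m s : R) (P H : 'rV[R]_3 -> R -> R) (p : 'rV[R]_(1 + 3)).

(* The exterior region is described in the global coordinates (t, x), where
   x = r y lies in R^3, r = |x| and y is in S^2. *)
Definition tcoord p : R := lsubmx p 0 0.
Definition xcoord p : 'rV[R]_3 := rsubmx p.
Definition radius p : R := enorm (xcoord p).
Definition angle p : 'rV[R]_3 := sph (xcoord p).

Definition hfun m (r : R) : R := 1 - 2 * m / r.

(* - h dt^2 + h^-1 dr^2 + r^2 sigma, with dr = <y, dx> and
   r^2 sigma = |dx|^2 - dr^2. *)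
Definition gSch m p : 'M[R]_(1 + 3) :=
  let h := hfun m (radius p) in
  let dr2 := (angle p)^T *m angle p in
  block_mx (- h)%:M 0 0 (h^-1 *: dr2 + (1%:M - dr2)).

(* For m = 0 the second term vanishes, whatever the value of r / 0. *)
Definition tortoise m (r : R) : R :=
  r + 2 * m * ln `|r / (2 * m) - 1|.

(* F = vbar + P, with vbar = t - r_* and s = 1 / r. *)
Definition Ffun m P p : R :=
  tcoord p - tortoise m (radius p) + P (angle p) (radius p)^-1.

Definition graph_pt m P (y : 'rV[R]_3) s : 'rV[R]_(1 + 3) :=
  row_mx (tortoise m s^-1 - P y s)%:M (s^-1 *: y).

Definition mean_curvature m P (y : 'rV[R]_3) s : R :=
  3^-1 * divergence (gSch m) (unit_normal (gSch m) (Ffun m P))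
           (graph_pt m P y s).

Definition spacelike_at m P (y : 'rV[R]_3) s : Prop :=
  let p := graph_pt m P y s in
  forall v : 'rV[R]_(1 + 3), v != 0 -> 'D_v (Ffun m P) p = 0 ->
    0 < metric (gSch m) p v v.

Definition Lgraph m P (y : 'rV[R]_3) s : R :=
  - (2 * ds P y s + s ^+ 2 * (1 - 2 * m * s) * (ds P y s) ^+ 2
     + dot (sgrad (P^~ s) y) (sgrad (P^~ s) y)).

(* {vbar = - P} is a spacelike surface defined for 0 < s <= s0, inside r > 2m,
   with mean curvature H for s > 0; H is positive also at s = 0, so that H_0^-1
   makes sense; P and H have regularity reg up to s = 0. *)
Record surface (reg : set ('rV[R]_3 * R) -> ('rV[R]_3 * R -> R) -> Prop)
    m (s0 : R) P H : Prop := Surface {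
  surf_s0_gt0 : 0 < s0;
  surf_exterior : 2 * m * s0 < 1;
  surf_P_smooth : regular_on Cinfty
    [set q : 'rV[R]_3 * R | S2 q.1 /\ 0 < q.2 <= s0] (fun q => P q.1 q.2);
  surf_spacelike : forall y s, S2 y -> 0 < s < s0 -> spacelike_at m P y s;
  surf_H : forall y s, S2 y -> 0 < s < s0 -> H y s = mean_curvature m P y s;
  surf_H_gt0 : forall y s, S2 y -> 0 <= s < s0 -> 0 < H y s;
  surf_P_reg : regular_on reg
    [set q : 'rV[R]_3 * R | S2 q.1 /\ 0 <= q.2 <= s0] (fun q => P q.1 q.2);
  surf_H_reg : regular_on reg
    [set q : 'rV[R]_3 * R | S2 q.1 /\ 0 <= q.2 <= s0] (fun q => H q.1 q.2)
}.

End Schwarzschild.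

Section DifferentialExpressions.
Context {R : realType}.

(* Formal differential expressions in the functions d_s^j P and d_s^j H at
   s = 0 and H_0^-1 on S^2.  dtan i e is the i-th Cartesian component of the
   gradient of e on S^2; these components give all derivatives in y. *)
Inductive dexpr : Type :=
| dconst of R
| dP of nat
| dH of nat
| dH0inv
| dadd of dexpr & dexpr
| dmul of dexpr & dexpr
| dtan of 'I_3 & dexpr.

Fixpoint deval (P H : 'rV[R]_3 -> R -> R) (e : dexpr) : 'rV[R]_3 -> R :=
  match e with
  | dconst c => fun=> c
  | dP j => bdy j P
  | dH j => bdy j H
  | dH0inv => fun y => (bdy 0 H y)^-1
  | dadd e1 e2 => fun y => deval P H e1 y + deval P H e2 y
  | dmul e1 e2 => fun y => deval P H e1 y * deval P H e2 y
  | dtan i e1 => fun y => sgrad (deval P H e1) y 0 i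
  end.

Fixpoint only_uses (okP okH : pred nat) (e : dexpr) : bool :=
  match e with
  | dconst _ => true
  | dP j => okP j
  | dH j => okH j
  | dH0inv => okH 0
  | dadd e1 e2 | dmul e1 e2 => only_uses okP okH e1 && only_uses okP okH e2
  | dtan _ e1 => only_uses okP okH e1
  end.

(* q(P, H) is given on S^2 by one expression, the same for all P and H that
   satisfy hyp, in d_s^j P for okP j and d_s^j H for okH j. *)
Definition expressible (okP okH : pred nat)
    (hyp : R -> ('rV[R]_3 -> R -> R) -> ('rV[R]_3 -> R -> R) -> Prop)
    (q : ('rV[R]_3 -> R -> R) -> ('rV[R]_3 -> R -> R) -> 'rV[R]_3 -> R) :
    Prop :=
  exists e : dexpr, only_uses okP okH e /\
    forall s0 P H, hyp s0 P H ->
      forall y, S2 y -> q P H y = deval P H e y.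

End DifferentialExpressions.

(* Main.v *)
Require Import Defs.
From HB Require Import structures.
From mathcomp Require Import all_boot all_order all_algebra.
From mathcomp Require Import all_classical all_reals all_analysis.
From mathcomp Require Import ring lra zify.

Set Implicit Arguments.
Unset Strict Implicit.
Unset Printing Implicit Defensive.

Import Order.TTheory GRing.Theory Num.Theory.
Import numFieldNormedType.Exports.

Local Open Scope classical_set_scope.
Local Open Scope ring_scope.

(** Let F = vbar + P, so that the surface is a level set of F and H is a third of
    the divergence of the normal n = - grad F / |grad F|.  In the coordinates
    (t, x) the Schwarzschild metric has determinant - 1, hence the divergence of
    n is the Euclidean one ([trace_Schwarzschild]).  The spatial components of n
    are functions of y = x / |x| and s = 1 / |x|, and g (grad F, grad F) is
    - s^2 L.  With a = s^2 (1 - 2 m s) this gives for s > 0, where L > 0 because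
    the surface is spacelike ([Lgraph_gt0]), the identity [mean_curvatureE]

      3 H L^(3/2) = 3 L (1 + a P_s) + s B,
      B = - L (a P_s)_s + (1 + a P_s) L_s / 2 - L Lap P + <grad L, grad P> / 2,

    with Lap and grad taken on the sphere.  Squaring it loses nothing as L > 0
    for s > 0, and makes it polynomial in P, H and their derivatives; so it can
    be compared order by order in s ([curvature_series]).

    At order 0 it says that the only possible values of L_0 H_0^2 are 0 and 1; as
    the sphere is connected, this function is constant ([boundary_dichotomy]).
    On the branch L_0 = H_0^-2, the coefficient l_k of s^k in L enters the
    equation of order k >= 1 with the factor 27 H_0^-2 on the left-hand side and
    (18 + 3 k) H_0^-2 on the right-hand side, where the term 3 k comes from
    s L_s.  Orders 1 and 2 therefore determine L_s and L_ss at
    s = 0 up to multiples of H_s and H_ss, whose vanishing is thus characterized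
    ([Lgraph_bdy1], [Lgraph_bdy2]); at order 3 the factors agree, l_3 disappears
    and a condition on the other data remains ([compatibility_condition]); at
    every order k > 3 the coefficient l_k is determined again.  Since
    L = - (2 P_s + a P_s^2 + |grad P|^2), knowing l_k amounts to knowing the
    derivative of order k + 1 of P, in terms of those of lower order.

    Two points need care.  The functions P and H live on the product of the
    sphere with an interval and are regular up to its end point s = 0: they are
    handled through the class [Ccollar], stable under the right derivative in s
    and under the Cartesian components [tder] of the gradient on the sphere,
    which commute by the symmetry of second derivatives ([derive_swap]).  And if
    P is only of class C^4, then B is only C^2; it still contributes to the
    equation of order 3 because it is multiplied by s.  This is why expansions
    with remainder o(s^n) ([jet]) are compared instead of derivatives.

    For the statements on dependence, the expressible functionals are closed
    under the operations that occur in these formulas.  At an arbitrary order it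
    suffices to know that the equation is affine in l_k, with the above factor
    and with expressible coefficients ([known_up_to], [Ex_next_bdy]). *)

(** * Functions of class C^k on open sets *)

Section CkAlgebra.
Context {R : realType} {V : normedModType R}.
Implicit Types (U : set V) (f g : V -> R).

Lemma is_derive_line f (c u : V) (t : R) :
  differentiable f (t *: u + c) ->
  is_derive t 1 (fun r => f (r *: u + c)) ('D_u f (t *: u + c)).
Proof.
move=> /(@diff_derivable _ _ _ _ _ u).
have E : (fun h : R => h^-1 *: ((fun r => f (r *: u + c)) (h *: 1 + t)
             - f (t *: u + c)))
  = (fun h => h^-1 *: (f (h *: u + (t *: u + c)) - f (t *: u + c))).
  by apply/funext => h; rewrite scalerDl addrA [_%:A]mulr1.
by move=> d; split; [move: d|]; rewrite /derivable /derive E.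
Qed.

Lemma near_eq_differentiable f g (x : V) :
  (\forall z \near x, f z = g z) -> differentiable f x -> differentiable g x.
Proof.
move=> fg df.
have -> : g = f \+ (g \- f) by apply/funext => z /=; rewrite addrC subrK.
apply: differentiableD => //.
have zo : (g \- f) \o shift x = cst ((g \- f) x) + (\0 : V -> R) +o_ 0 id.
  have fg0 : \forall h \near 0, f (h + x) = g (h + x).
    move: fg; rewrite (near_shift 0 x) => fg; apply: filterS fg => h.
    by rewrite /= subr0.
  apply/eqaddoP => _/posnumP[e]; near=> h.
  rewrite /= !fctE /= (nbhs_singleton fg) subrr add0r subr0.
  by rewrite (near fg0 h) // subrr normr0 mulr_ge0.
have c0 : continuous (\0 : {linear V -> R}) by move=> z; exact: cst_continuous.
apply/diff_locallyP; rewrite (diff_unique c0 zo); split => //.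
Unshelve. all: by end_near. Qed.

Lemma Ck_subset k U U' f : U' `<=` U -> Ck k U f -> Ck k U' f.
Proof.
elim: k f => [|k IH] f sU /=; first by move=> h x /sU /h.
by case=> h1 h2; split => [x /sU /h1|v] //; exact: IH.
Qed.

Lemma CkW k U f : Ck k.+1 U f -> Ck k U f.
Proof.
elim: k f => [|k IH] f.
  by case=> h1 _ x /h1 /differentiable_continuous.
by case=> h1 h2; split => // v; apply: IH; exact: h2.
Qed.

Lemma Ck_le k l U f : (k <= l)%N -> Ck l U f -> Ck k U f.
Proof.
move=> /subnK <-; elim: (l - k)%N => // n IH.
by rewrite addSn => /CkW.
Qed.

Lemma Ck_continuous k U f x : Ck k U f -> U x -> {for x, continuous f}.
Proof. by move=> /(Ck_le (leq0n k)) h /h. Qed.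

Lemma Ck_eq k U f g : open U -> {in U, f =1 g} -> Ck k U f -> Ck k U g.
Proof.
move=> oU; elim: k f g => [|k IH] f g fg.
  move=> h x Ux; have fgx : \forall z \near x, f z = g z.
    by near=> z; apply: fg; rewrite inE; near: z; exact: open_nbhs_nbhs.
  rewrite /prop_for/continuous_at -(nbhs_singleton fgx).
  apply: cvg_trans (h x Ux); apply: near_eq_cvg; exact: fgx.
have fgx x : U x -> \forall z \near x, f z = g z.
  move=> Ux.
  by near=> z; apply: fg; rewrite inE; near: z; exact: open_nbhs_nbhs.
case=> h1 h2; split => [x Ux|v].
  exact: near_eq_differentiable (fgx x Ux) (h1 x Ux).
apply: IH (h2 v) => x; rewrite inE => Ux.
by apply: near_eq_derive; exact: fgx.
Unshelve. all: by end_near. Qed.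

Lemma Ck_cst k U (c : R) : Ck k U (fun=> c).
Proof.
elim: k c => [|k IH] c /=; first by move=> x _; exact: cst_continuous.
split => [x _|v]; first exact: differentiable_cst.
by rewrite (_ : 'D_v (fun=> c) = fun=> 0) //; apply/funext => x; rewrite derive_cst.
Qed.

Lemma CkD k U f g : open U -> Ck k U f -> Ck k U g ->
  Ck k U (fun x => f x + g x).
Proof.
move=> oU; elim: k f g => [|k IH] f g /=.
  by move=> hf hg x Ux; apply: continuousD; [exact: hf|exact: hg].
move=> [f1 f2] [g1 g2]; split => [x Ux|v].
  by apply: differentiableD; [exact: f1|exact: g1].
apply: Ck_eq (IH _ _ (f2 v) (g2 v)) => // x; rewrite inE => Ux.
by rewrite deriveD//; apply: diff_derivable; [exact: f1|exact: g1].
Qed.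

Lemma CkM k U f g : open U -> Ck k U f -> Ck k U g ->
  Ck k U (fun x => f x * g x).
Proof.
move=> oU; elim: k f g => [|k IH] f g.
  by move=> hf hg x Ux; apply: continuousM; [exact: hf|exact: hg].
move=> hf hg; have [f1 f2] := hf; have [g1 g2] := hg; split => [x Ux|v].
  by apply: differentiableM; [exact: f1|exact: g1].
have h := CkD oU (IH _ _ (CkW hf) (g2 v)) (IH _ _ (CkW hg) (f2 v)).
apply: Ck_eq h => // x; rewrite inE => Ux.
by rewrite deriveM//; apply: diff_derivable; [exact: f1|exact: g1].
Qed.

Lemma Ck_sum k U n (F : 'I_n -> V -> R) : open U ->
  (forall i, Ck k U (F i)) -> Ck k U (fun x => \sum_i F i x).
Proof.
move=> oU; elim: n F => [|n IH] F h.
  by apply: Ck_eq (Ck_cst k U 0) => // x _; rewrite big_ord0.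
apply: Ck_eq (CkD oU (h ord0) (IH (fun i => F (lift ord0 i)) (fun i => h _))) => //.
by move=> x _; rewrite big_ord_recl.
Qed.

(** A continuous linear form has constant directional derivatives. *)
Lemma Ck_linear k U (f : {linear V -> R}) : continuous f -> Ck k U f.
Proof.
move=> cf; case: k => [|k] /=; first by move=> x _; exact: cf.
split => [x _|v]; first exact: linear_differentiable.
rewrite (_ : 'D_v f = fun=> f v); first exact: Ck_cst.
apply/funext => x; rewrite deriveE ?diff_lin//.
exact: linear_differentiable.
Qed.

Definition second_difference f x u v (h : R) : R :=
  f (h *: u + (h *: v + x)) - f (h *: u + x) - f (h *: v + x) + f x.

(** The mean value theorem, applied along u and then along v, turns the second
    difference into h^2 times D_v D_u f at a point close to x. *)
Lemma second_difference_cvg U f x u v : open U -> U x -> Ck 2 U f ->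
  forall e : R, 0 < e -> \forall h \near 0^'+,
    `|second_difference f x u v h - h ^+ 2 * 'D_v ('D_u f) x| <= e * h ^+ 2.
Proof.
move=> oU Ux [f1 f2] e e0; have [f3 f4] := f2 u.
have near1 : \forall z \near x, U z.
  exact: open_nbhs_nbhs.
have near2 : \forall z \near x, `|'D_v ('D_u f) x - 'D_v ('D_u f) z| < e.
  by have /cvgrPdist_lt := f4 v x Ux; apply.
have := filterI near1 near2.
rewrite nbhs_ballP => -[r /= r0 rP].
have B0 : 0 < `|u| + `|v| + 1 by rewrite ltr_wpDl ?addr_ge0.
near=> h.
have h0 : 0 < h by [].
have hr : h * (`|u| + `|v| + 1) < r.
  rewrite -ltr_pdivlMr//; near: h; apply: nbhs_right_lt.
  by rewrite divr_gt0.
have seg s t : 0 <= s <= h -> 0 <= t <= h ->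
    U (s *: u + (t *: v + x)) /\
    `|'D_v ('D_u f) x - 'D_v ('D_u f) (s *: u + (t *: v + x))| < e.
  move=> /andP[s0 sh] /andP[t0 th]; apply: rP; rewrite -ball_normE /=.
  rewrite (_ : x - _ = - (s *: u + t *: v)); last first.
    by rewrite addrA opprD addrCA subrr addr0.
  rewrite normrN (le_lt_trans _ hr)// (le_trans (ler_normD _ _))//.
  rewrite !normrZ !ger0_norm// !mulrDr mulr1 -addrA lerD// ?ler_wpM2r//.
  by rewrite ler_wpDr ?ler_wpM2r// ltW.
have hh : 0 <= h <= h by apply/andP; split=> //; exact: ltW.
have h00 : (0 : R) <= 0 <= h by apply/andP; split=> //; exact: ltW.
pose phi (s : R) := f (s *: u + (h *: v + x)) - f (s *: u + x).
have dphi s : 0 <= s <= h -> is_derive s 1 phi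
   ('D_u f (s *: u + (h *: v + x)) - 'D_u f (s *: u + x)).
  move=> sh; apply: is_deriveB; apply: is_derive_line; apply: f1.
    by have [] := seg _ _ sh hh.
  by have [] := seg _ _ sh h00; rewrite scale0r add0r.
have dphi' s : s \in `]0, h[ -> is_derive s 1 phi
   ('D_u f (s *: u + (h *: v + x)) - 'D_u f (s *: u + x)).
  by rewrite in_itv /= => /andP[/ltW s0 /ltW s1]; apply: dphi; rewrite s0.
have cphi : {within `[0, h], continuous phi}.
  apply: derivable_within_continuous => s; rewrite in_itv /= => sh.
  by have [] := dphi s sh.
have [s sh Es] := MVT h0 dphi' cphi.
have {}sh : 0 <= s <= h.
  by move: sh; rewrite in_itv /= => /andP[/ltW -> /ltW ->].
pose psi (t : R) := 'D_u f (t *: v + (s *: u + x)).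
have swap t : t *: v + (s *: u + x) = s *: u + (t *: v + x) by rewrite addrCA.
have dpsi t : 0 <= t <= h -> is_derive t 1 psi
   ('D_v ('D_u f) (t *: v + (s *: u + x))).
  move=> th; apply: is_derive_line; apply: f3.
  by rewrite swap; have [] := seg _ _ sh th.
have dpsi' t : t \in `]0, h[ -> is_derive t 1 psi
   ('D_v ('D_u f) (t *: v + (s *: u + x))).
  by rewrite in_itv /= => /andP[/ltW t0 /ltW t1]; apply: dpsi; rewrite t0.
have cpsi : {within `[0, h], continuous psi}.
  apply: derivable_within_continuous => t; rewrite in_itv /= => th.
  by have [] := dpsi t th.
have [t th Et] := MVT h0 dpsi' cpsi.
have {}th : 0 <= t <= h.
  by move: th; rewrite in_itv /= => /andP[/ltW -> /ltW ->].
have -> : second_difference f x u v h = 'D_v ('D_u f) (s *: u + (t *: v + x)) * h ^+ 2.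
  have -> : second_difference f x u v h = phi h - phi 0.
    by rewrite /second_difference /phi !scale0r !add0r; ring.
  have Epsi : 'D_u f (s *: u + (h *: v + x)) - 'D_u f (s *: u + x) = psi h - psi 0.
    by rewrite /psi scale0r add0r (swap h).
  rewrite Es Epsi Et (swap t).
  by rewrite subr0 -mulrA expr2.
set D' := 'D_v _ _; set D := 'D_v _ _.
have -> : D' * h ^+ 2 - h ^+ 2 * D = (D' - D) * h ^+ 2 by ring.
rewrite normrM (ger0_norm (sqr_ge0 h)) ler_wpM2r ?sqr_ge0//.
by rewrite distrC ltW//; have [] := seg _ _ sh th.
Unshelve. all: by end_near. Qed.

(** The second difference is symmetric in u and v, so that both iterated
    derivatives are the limit of its quotient by h^2. *)
Lemma derive_swap U f x u v : open U -> U x -> Ck 2 U f ->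
  'D_v ('D_u f) x = 'D_u ('D_v f) x.
Proof.
move=> oU Ux C2; suff key (e : R) : 0 < e -> `|'D_v ('D_u f) x - 'D_u ('D_v f) x| <= e.
  apply/eqP; rewrite -subr_eq0 -normr_eq0 eq_le normr_ge0 andbT.
  by apply/ler_addgt0Pr => e e0; rewrite add0r; exact: key.
move=> e0.
have e2 : 0 < e / 2 by rewrite divr_gt0.
have A := second_difference_cvg u v oU Ux C2 e2.
have B := second_difference_cvg v u oU Ux C2 e2.
have [h [h0 [hA hB]]] := filter_ex (filterI (nbhs_right_gt (0 : R)) (filterI A B)).
have E : second_difference f x v u h = second_difference f x u v h.
  by rewrite /second_difference addrCA; ring.
rewrite E in hB; rewrite [e]splitr.
move: {E} (second_difference _ _ _ _ _) ('D_v _ _) ('D_u _ _) (e / 2) hA hB.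
move=> S a b k hA hB; rewrite -(ler_pM2r (exprn_gt0 2 h0)) mulrDl.
rewrite -[X in _ * X <= _](ger0_norm (sqr_ge0 h)) -normrM.
have -> : (a - b) * h ^+ 2 = (S - h ^+ 2 * b) - (S - h ^+ 2 * a) by ring.
exact: le_trans (ler_normB _ _) (lerD hB hA).
Qed.

End CkAlgebra.

(** * Calculus on the sphere *)

Section LinearDerivative.
Context {R : numFieldType} {V W : normedModType R}.

(** The difference quotients of a linear map are constant. *)
Lemma is_derive_linear (f : {linear V -> W}) x v : is_derive x v f (f v).
Proof.
have c : h^-1 *: (f (h *: v + x) - f x) @[h --> (0 : R)^'] --> f v.
  apply: cvg_near_cst; near=> h.
  have -> : f (h *: v + x) = h *: f v + f x by rewrite linearD linearZ.
  rewrite  addrK scalerA mulVf ?scale1r//.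
  by near: h; exact: nbhs_dnbhs_neq.
split; first by apply/cvg_ex; exists (f v).
exact/cvg_lim.
Unshelve. all: by end_near. Qed.

End LinearDerivative.

Section Calculus.
Context {R : realType} {V : normedModType R}.

Lemma near_neq0 (x : V) : x != 0 -> \forall z \near x, z != 0.
Proof.
move=> x0; apply/nbhs_ballP; exists `|x| => /=; first by rewrite normr_gt0.
move=> z; rewrite -ball_normE /=; apply: contraTneq => ->.
by rewrite subr0 ltxx.
Qed.

(** A directional derivative is a derivative along a line, where the chain rule of
    one variable applies. *)
Lemma is_derive_compR (g : V -> R) (f : R -> R) x v (dg df : R) :
  is_derive x v g dg -> is_derive (g x) 1 f df ->
  is_derive x v (fun z => f (g z)) (df * dg).
Proof.
move=> hg hf.
have line (k : V -> R) (dk : R) : is_derive x v k dk <->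
    is_derive (0 : R) 1 (fun h : R => k (h *: v + x)) dk.
  have E : (fun h : R => h^-1 *: ((fun h : R => k (h *: v + x)) (h *: 1 + 0)
      - (fun h : R => k (h *: v + x)) 0))
    = (fun h => h^-1 *: (k (h *: v + x) - k x)).
    by apply/funext => h; rewrite addr0 scale0r add0r [_%:A]mulr1.
  by split=> [[d1 d2]|[d1 d2]]; split; move: d1 d2; rewrite /derivable /derive E.
apply/line; apply: (@is_derive1_comp _ f (fun h : R => g (h *: v + x))).
  by rewrite scale0r add0r.
exact/line.
Qed.

Lemma is_derive_invR (r : R) : r != 0 ->
  is_derive r 1 (fun t : R => t^-1) (- r ^- 2).
Proof.
move=> r0; apply: is_derive_eq (is_deriveV (f := id) r0 (is_derive_id r 1)) _.
by rewrite /GRing.scale /= mulr1.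
Qed.

End Calculus.

Section EuclideanSphere.
Context {R : realType}.
Implicit Types x y u v : 'rV[R]_3.

Lemma dotC u v : dot u v = dot v u.
Proof. by apply: eq_bigr => i _; rewrite mulrC. Qed.

Lemma dotDr u v w : dot u (v + w) = dot u v + dot u w.
Proof. by rewrite -big_split; apply: eq_bigr => i _; rewrite mxE mulrDr. Qed.

Lemma dotZr u c v : dot u (c *: v) = c * dot u v.
Proof. by rewrite mulr_sumr; apply: eq_bigr => i _; rewrite mxE; ring. Qed.

Lemma dotZl u c v : dot (c *: u) v = c * dot u v.
Proof. by rewrite dotC dotZr dotC. Qed.

Lemma dot_delta u i : dot u (delta_mx 0 i) = u 0 i.
Proof.
rewrite /dot (bigD1 i)//= big1 ?addr0; last first.
  by move=> j ji; rewrite mxE (negbTE ji) andbF mulr0.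
by rewrite mxE !eqxx mulr1.
Qed.

Lemma dotxx_ge0 x : 0 <= dot x x.
Proof. by apply: sumr_ge0 => i _; rewrite -expr2 sqr_ge0. Qed.

Lemma dotxx_eq0 x : (dot x x == 0) = (x == 0).
Proof.
have ge0 (i : 'I_3) : true -> 0 <= x 0 i * x 0 i by rewrite -expr2 sqr_ge0.
rewrite /dot psumr_eq0//.
apply/allP/eqP => [h|-> i _]; last first.
  by rewrite mxE mulr0 eqxx.
apply/rowP => i; rewrite mxE; apply/eqP; rewrite -sqrf_eq0 expr2.
by apply: h; rewrite mem_index_enum.
Qed.

Lemma enorm_gt0 x : (0 < enorm x) = (x != 0).
Proof. by rewrite sqrtr_gt0 lt_def dotxx_eq0 dotxx_ge0 andbT. Qed.

Lemma sqr_enorm x : enorm x ^+ 2 = dot x x.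
Proof. by rewrite sqr_sqrtr ?dotxx_ge0. Qed.

Lemma enormZ c x : enorm (c *: x) = `|c| * enorm x.
Proof.
by rewrite /enorm dotZl dotZr mulrA -expr2 sqrtrM ?sqr_ge0// sqrtr_sqr.
Qed.

Lemma S2_dot y : S2 y -> dot y y = 1.
Proof. by move=> hy; rewrite -sqr_enorm hy expr1n. Qed.

Lemma S2_neq0 y : S2 y -> y != 0.
Proof. by move=> hy; rewrite -enorm_gt0 hy. Qed.

Lemma S2_sph x : x != 0 -> S2 (sph x).
Proof.
rewrite -enorm_gt0 => x0; rewrite /S2 /= /sph enormZ.
by rewrite ger0_norm ?invr_ge0 ?ltW// mulVf// gt_eqF.
Qed.

Lemma sph_S2 y : S2 y -> sph y = y.
Proof. by rewrite /sph => ->; rewrite invr1 scale1r. Qed.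

Lemma sphZ c y : 0 < c -> S2 y -> sph (c *: y) = y.
Proof.
move=> c0 hy; rewrite /sph enormZ hy mulr1 gtr0_norm// scalerA mulVf ?scale1r//.
by rewrite gt_eqF.
Qed.

Lemma is_derive_coord x v i : is_derive x v (fun z : 'rV[R]_3 => z 0 i) (v 0 i).
Proof.
have lin : linear (fun z : 'rV[R]_3 => z 0 i : R) by move=> c z w; rewrite !mxE.
pose fM := GRing.isLinear.Build _ _ _ _ _ lin.
pose f : {linear 'rV[R]_3 -> R} := HB.pack (fun z : 'rV[R]_3 => z 0 i : R) fM.
exact: (is_derive_linear f).
Qed.

Lemma differentiable_dotxx x : differentiable (fun z : 'rV[R]_3 => dot z z) x.
Proof.
rewrite (_ : (fun _ => _) = \sum_(i < 3) (fun z : 'rV[R]_3 => z 0 i * z 0 i)).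
  apply: differentiable_sum => i.
  by apply: differentiableM; exact: differentiable_coord.
by apply/funext => z; rewrite fct_sumE.
Qed.

Lemma is_derive_dotxx x v :
  is_derive x v (fun z : 'rV[R]_3 => dot z z) (2 * dot x v).
Proof.
rewrite (_ : (fun _ => _) = \sum_(i < 3) (fun z : 'rV[R]_3 => z 0 i * z 0 i)).
  rewrite /dot mulr_sumr; apply: is_derive_sum => i.
  apply: is_derive_eq (is_deriveM (is_derive_coord x v i) (is_derive_coord x v i)) _.
  by rewrite /GRing.scale /=; ring.
by apply/funext => z; rewrite fct_sumE.
Qed.

Lemma differentiable_enorm x : x != 0 -> differentiable (@enorm R) x.
Proof.
rewrite -enorm_gt0 sqrtr_gt0 => x0.
have -> : @enorm R = Num.sqrt \o (fun z => dot z z) by [].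
apply: differentiable_comp; first exact: differentiable_dotxx.
by apply/derivable1_diffP; have [] := is_derive1_sqrt x0.
Qed.

Lemma is_derive_enorm x v : x != 0 -> is_derive x v (@enorm R) (dot (sph x) v).
Proof.
move=> x0; have := x0; rewrite -enorm_gt0 => e0.
have d0 : 0 < dot x x by move: e0; rewrite sqrtr_gt0.
apply: is_derive_eq (is_derive_compR (is_derive_dotxx x v) (is_derive1_sqrt d0)) _.
by rewrite /sph dotZl -/(enorm x); field; rewrite gt_eqF.
Qed.

Lemma is_derive_enormV x v : x != 0 ->
  is_derive x v (fun z => (@enorm R z)^-1) (- (enorm x) ^- 2 * dot (sph x) v).
Proof.
move=> x0; have := x0; rewrite -enorm_gt0 => e0.
apply: is_derive_compR (is_derive_enorm v x0) _.
by apply: is_derive_invR; rewrite gt_eqF.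
Qed.

(** Writing sph as a combination of fixed vectors reduces its differentiability
    to that of real-valued functions. *)
Lemma sph_sum x :
  sph x = \sum_(i < 3) ((enorm x)^-1 * x 0 i) *: delta_mx 0 i.
Proof.
rewrite /sph {2}(row_sum_delta x) scaler_sumr.
by apply: eq_bigr => i _; rewrite scalerA.
Qed.

Lemma differentiable_sph x : x != 0 -> differentiable (@sph R) x.
Proof.
move=> x0; have := x0; rewrite -enorm_gt0 => e0.
rewrite (_ : @sph R = \sum_(i < 3)
    (fun z => ((enorm z)^-1 * z 0 i) *: (delta_mx 0 i : 'rV[R]_3))).
  apply: differentiable_sum => i; apply: differentiableZl.
  apply: differentiableM; last exact: differentiable_coord.
  by apply: differentiableV; [exact: differentiable_enorm|rewrite gt_eqF].
by apply/funext => z; rewrite fct_sumE sph_sum.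
Qed.

Lemma is_derive_sph_coord x v i : x != 0 ->
  is_derive x v (fun z => @sph R z 0 i)
    ((enorm x)^-1 * (v 0 i - dot (sph x) v * sph x 0 i)).
Proof.
move=> x0; have := x0; rewrite -enorm_gt0 => e0.
rewrite (_ : (fun _ => _) = (fun z => (enorm z)^-1) * (fun z => z 0 i)).
  apply: is_derive_eq (is_deriveM (is_derive_enormV v x0) (is_derive_coord x v i)) _.
  rewrite /GRing.scale /= /sph mxE dotZl; field.
  by rewrite gt_eqF.
by apply/funext => z; rewrite mxE.
Qed.

Lemma derive_sph x v : x != 0 ->
  'D_v (@sph R) x = (enorm x)^-1 *: (v - dot (sph x) v *: sph x).
Proof.
move=> x0; rewrite derive_mx; last exact: diff_derivable (differentiable_sph x0).
apply/rowP => i; rewrite !mxE; have [_ ->] := is_derive_sph_coord v i x0.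
by rewrite !mxE.
Qed.

End EuclideanSphere.

Section ProductCalculus.
Context {R : realType}.
Local Notation V3 := 'rV[R]_3.
Implicit Types (fe : V3 * R -> R) (q : V3 * R) (x y v : V3).

Lemma derive_pairE fe q v c : differentiable fe q ->
  'D_(v, c) fe q
  = \sum_(i < 3) v 0 i * 'D_(delta_mx 0 i, 0) fe q + c * 'D_(0, 1) fe q.
Proof.
move=> df.
have -> : (v, c) = \sum_(i < 3) v 0 i *: ((delta_mx 0 i, 0) : V3 * R)
    + c *: ((0, 1) : V3 * R).
  rewrite [in LHS](row_sum_delta v); apply/pair_equal_spec; split => /=.
    rewrite scaler0 addr0 (big_morph fst (id1 := 0) (op1 := +%R)) //.
  rewrite (big_morph snd (id1 := 0) (op1 := +%R)) //= big1.
    by rewrite add0r [_%:A]mulr1.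
  by move=> i _; rewrite scaler0.
rewrite deriveE// linearD linear_sum linearZ /= -deriveE//.
congr (_ + _); apply: eq_bigr => i _.
by rewrite linearZ /= -deriveE.
Qed.

Lemma differentiable_sph_pair fe (g : V3 -> R) x : x != 0 ->
  differentiable g x -> differentiable fe (sph x, g x) ->
  differentiable (fun z => fe (sph z, g z)) x.
Proof.
move=> x0 dg df.
apply: (@differentiable_comp _ _ _ _ (fun z => (sph z, g z)) fe) => //.
by apply: differentiable_pair => //; exact: differentiable_sph.
Qed.

Lemma derive_sph_pair fe (g : V3 -> R) x v : x != 0 ->
  differentiable g x -> differentiable fe (sph x, g x) ->
  'D_v (fun z => fe (sph z, g z)) x
  = 'D_((enorm x)^-1 *: (v - dot (sph x) v *: sph x), 'D_v g x) fe (sph x, g x).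
Proof.
move=> x0 dg df; have ds := differentiable_sph x0.
rewrite deriveE; last exact: differentiable_sph_pair.
rewrite (_ : (fun _ => _) = fe \o (fun z => (sph z, g z))) //.
rewrite diff_comp//; last exact: differentiable_pair.
rewrite /= diff_pair//= deriveE// -derive_sph// [in RHS]deriveE//.
by rewrite (deriveE _ dg).
Qed.

End ProductCalculus.

(** * Functions on the collar of the boundary *)

Section Collar.
Context {R : realType}.
Local Notation V3 := 'rV[R]_3.
Implicit Types (fe : V3 * R -> R) (q : V3 * R) (x y v : V3) (f g : V3 -> R -> R).

(** The collar is open at s = s0 and closed at s = 0, so that right derivatives
    in s make sense at each of its points. *)
Definition collar (s0 : R) : set (V3 * R) := [set q | S2 q.1 /\ 0 <= q.2 < s0].

Definition Ccollar (k : nat) (s0 : R) f : Prop :=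
  regular_on (Ck k) (collar s0) (fun q => f q.1 q.2).

Definition tder (i : 'I_3) f : V3 -> R -> R := fun y s => sgrad (f^~ s) y 0 i.

(** For y in the sphere, this is the tangential part of the i-th basis vector. *)
Definition tproj (i : 'I_3) y : V3 := delta_mx 0 i - y 0 i *: y.

Variable s0 : R.
Local Notation C k := (Ccollar k s0).
Local Notation A := (collar s0).

Lemma ds_ext fe f y s : differentiable fe (y, s) ->
  0 <= s < s0 -> (forall t, 0 <= t < s0 -> f y t = fe (y, t)) ->
  ds f y s = 'D_(0, 1) fe (y, s).
Proof.
move=> df /andP[s1 s2] fE; apply: cvg_lim => //.
have : derivable fe (y, s) (0, 1) by exact: diff_derivable.
move/cvg_dnbhs_at_right; apply: cvg_trans; apply: near_eq_cvg.
near=> h => /=.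
have h0 : 0 < h by [].
have hs : s + h < s0 by rewrite -ltrBrDl; near: h; apply: nbhs_right_lt; rewrite subr_gt0.
rewrite !fE; last 2 first.
- by rewrite s1.
- by rewrite hs addr_ge0// ltW.
congr (_ * (fe _ - _)); apply/pair_equal_spec; split=> /=.
  by rewrite scaler0 add0r.
by rewrite [_%:A]mulr1 addrC.
Unshelve. all: by end_near. Qed.

Lemma sgrad_ext fe f y s i : differentiable fe (y, s) -> S2 y ->
  (forall z, S2 z -> f z s = fe (z, s)) ->
  sgrad (f^~ s) y 0 i = 'D_(tproj i y, 0) fe (y, s).
Proof.
move=> df Sy fE; rewrite mxE.
have y0 : y != 0 by exact: S2_neq0.
have -> : 'D_(delta_mx 0 i) (fun x => f (sph x) s) y =
          'D_(delta_mx 0 i) (fun x => fe (sph x, s)) y.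
  have nz : \forall z \near y, z != 0 by exact: near_neq0.
  apply: near_eq_derive; apply: filterS nz => z z0; apply: fE; exact: S2_sph.
rewrite (@derive_sph_pair _ fe (fun=> s))//; last by rewrite sph_S2.
have D0 : 'D_(delta_mx 0 i : V3) (fun=> s : R) y = 0 by exact: derive_cst.
by rewrite D0 (sph_S2 Sy) Sy invr1 scale1r dot_delta.
Qed.

Lemma CcollarW k f : C k.+1 f -> C k f.
Proof. by case=> U [fe [h1 h2 /CkW h3 h4]]; exists U, fe. Qed.

Lemma Ccollar_le k l f : (k <= l)%N -> C l f -> C k f.
Proof. by move=> kl [U [fe [h1 h2 /(Ck_le kl) h3 h4]]]; exists U, fe. Qed.

Lemma Ccollar_eq k f g : (forall y s, S2 y -> 0 <= s < s0 -> f y s = g y s) ->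
  C k f -> C k g.
Proof.
move=> fg [U [fe [oU AU cU fE]]]; exists U, fe; split => // -[y s].
rewrite inE => -[/= Sy ss]; rewrite -fg//.
by rewrite -(fE (y, s))// inE.
Qed.

Lemma Ccollar_cst k c : C k (fun _ _ => c).
Proof.
by exists setT, (fun=> c); split=> //; [exact: openT|exact: Ck_cst].
Qed.

Lemma Ccollar_s k : C k (fun _ s => s).
Proof.
exists setT, snd; split=> //; first exact: openT.
have lin : linear (fun q : V3 * R => q.2 : R) by [].
pose fM := GRing.isLinear.Build _ _ _ _ _ lin.
pose p2 : {linear (V3 * R)%type -> R} := HB.pack (fun q : V3 * R => q.2 : R) fM.
by apply: (@Ck_linear _ _ _ _ p2) => q; exact: cvg_snd.
Qed.

Lemma Ck_coord k (U : set (V3 * R)) i : Ck k U (fun q : V3 * R => q.1 0 i).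
Proof.
have lin : linear (fun q : V3 * R => q.1 0 i : R) by move=> c z w; rewrite !mxE.
pose fM := GRing.isLinear.Build _ _ _ _ _ lin.
pose f : {linear (V3 * R)%type -> R} := HB.pack (fun q : V3 * R => q.1 0 i : R) fM.
apply: (@Ck_linear _ _ _ _ f) => q.
apply: (@continuous_comp _ _ _ fst (fun x : V3 => x 0 i)); first exact: cvg_fst.
exact: coord_continuous.
Qed.

Lemma CcollarD k f g : C k f -> C k g -> C k (fun y s => f y s + g y s).
Proof.
move=> [U [fe [oU AU cU fE]]] [U' [ge [oU' AU' cU' gE]]].
have oI := openI oU oU'.
exists (U `&` U'), (fun q => fe q + ge q); split => //.
- by move=> q Aq; split; [exact: AU|exact: AU'].
- by apply: CkD => //; [apply: Ck_subset cU|apply: Ck_subset cU'] => q [].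
- by move=> q Aq; rewrite fE// gE.
Qed.

Lemma CcollarM k f g : C k f -> C k g -> C k (fun y s => f y s * g y s).
Proof.
move=> [U [fe [oU AU cU fE]]] [U' [ge [oU' AU' cU' gE]]].
have oI := openI oU oU'.
exists (U `&` U'), (fun q => fe q * ge q); split => //.
- by move=> q Aq; split; [exact: AU|exact: AU'].
- by apply: CkM => //; [apply: Ck_subset cU|apply: Ck_subset cU'] => q [].
- by move=> q Aq; rewrite fE// gE.
Qed.

Lemma Ccollar_sum k n (F : 'I_n -> V3 -> R -> R) : (forall i, C k (F i)) ->
  C k (fun y s => \sum_i F i y s).
Proof.
elim: n F => [|n IH] F h.
  by apply: Ccollar_eq (Ccollar_cst k 0) => y s _ _; rewrite big_ord0.
apply: Ccollar_eq (CcollarD (h ord0) (IH (fun i => F (lift ord0 i)) (fun i => h _))).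
by move=> y s _ _; rewrite big_ord_recl.
Qed.

(** Both derivatives, although they only involve the values on the collar, are
    directional derivatives of any extension. *)
Lemma Ccollar1P f : C 1 f -> exists fe : V3 * R -> R,
  forall y s, S2 y -> 0 <= s < s0 ->
    [/\ differentiable fe (y, s), f y s = fe (y, s),
        ds f y s = 'D_(0, 1) fe (y, s) &
        forall i, tder i f y s = 'D_(tproj i y, 0) fe (y, s)].
Proof.
case=> U [fe [oU AU [dU _] fE]]; exists fe => y s Sy ss.
have fE' z t : S2 z -> 0 <= t < s0 -> f z t = fe (z, t).
  by move=> Sz tt; rewrite -(fE (z, t))// inE.
have df : differentiable fe (y, s) by apply/dU/AU.
split=> //; first exact: fE'.
  by apply: ds_ext => // t tt; exact: fE'.
by move=> i; apply: sgrad_ext => // z Sz; exact: fE'.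
Qed.

Lemma Ccollar_ds k f : C k.+1 f -> C k (ds f).
Proof.
move=> [U [fe [oU AU [dU cU] fE]]].
exists U, ('D_(0, 1) fe); split => //; first exact: cU.
move=> -[y s]; rewrite inE => -[/= Sy ss].
apply: ds_ext => //; first exact/dU/AU.
by move=> t tt; rewrite -(fE (y, t))// inE.
Qed.

(** On the sphere, tder i is the derivative of an extension along tproj i y; this
    formula is polynomial in y and makes sense for all y. *)
Lemma Ccollar_tder k i f : C k.+1 f -> C k (tder i f).
Proof.
move=> [U [fe [oU AU [dU cU] fE]]].
exists U, (fun q => 'D_(delta_mx 0 i, 0) fe q + (-1) *
   (q.1 0 i * \sum_(j < 3) q.1 0 j * 'D_(delta_mx 0 j, 0) fe q)); split => //.
  apply: CkD => //; first exact: cU.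
  apply: CkM => //; first exact: Ck_cst.
  apply: CkM => //; first exact: Ck_coord.
  apply: Ck_sum => // j; apply: CkM => //; first exact: Ck_coord.
  exact: cU.
move=> -[y s]; rewrite inE => -[/= Sy ss].
have df : differentiable fe (y, s) by exact/dU/AU.
rewrite /tder (@sgrad_ext fe)//; last first.
  by move=> z Sz; rewrite -(fE (z, s))// inE.
rewrite derive_pairE// mul0r addr0 [X in _ + -1 * (X * _)]/= mulr_sumr mulr_sumr.
have DE : 'D_(delta_mx 0 i, 0) fe (y, s)
    = \sum_(j < 3) (delta_mx 0 i : V3) 0 j * 'D_(delta_mx 0 j, 0) fe (y, s).
  rewrite (bigD1 i)//= big1 ?addr0 ?mxE ?eqxx ?mul1r// => j ji.
  by rewrite mxE (negbTE ji) andbF mul0r.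
rewrite [X in _ = X + _]DE -big_split; apply: eq_bigr => j _ /=; rewrite !mxE.
by move: ('D_(_, _) fe _) => D; ring.
Qed.

(** The direction tproj i y does not depend on s, so that both sides are second
    derivatives of an extension in two fixed directions. *)
Lemma ds_tder f y s i : C 2 f -> S2 y -> 0 <= s < s0 ->
  ds (tder i f) y s = tder i (ds f) y s.
Proof.
move=> [U [fe [oU AU C2 fE]]] Sy ss; have [dU cU] := C2.
have Uy t : 0 <= t < s0 -> U (y, t) by move=> tt; exact: AU.
have dsE z t : S2 z -> 0 <= t < s0 -> ds f z t = 'D_(0, 1) fe (z, t).
  move=> Sz tt; apply: ds_ext => //; first exact/dU/AU.
  by move=> r rr; rewrite -(fE (z, r))// inE.
have tE t : 0 <= t < s0 -> tder i f y t = 'D_(tproj i y, 0) fe (y, t).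
  move=> tt; apply: sgrad_ext => //; first exact/dU/AU.
  by move=> z Sz; rewrite -(fE (z, t))// inE.
have [d1 _] := cU (tproj i y, 0); have [d2 _] := cU (0, 1).
have E1 : ds (tder i f) y s = 'D_(0, 1) ('D_(tproj i y, 0) fe) (y, s).
  by apply: ds_ext tE => //; exact/d1/Uy.
have E2 : tder i (ds f) y s = 'D_(tproj i y, 0) ('D_(0, 1) fe) (y, s).
  by apply: sgrad_ext => //; [exact/d2/Uy|move=> z Sz; exact: dsE].
by rewrite E1 E2; exact: derive_swap oU (Uy _ ss) C2.
Qed.

End Collar.

(** * Expansions at s = 0 *)

Section Jets.
Context {R : realType}.
Implicit Types (phi psi : R -> R) (c d : nat -> R) (p q : {poly R}).

Definition cauchy_mul c d : nat -> R := fun k => \sum_(i < k.+1) c i * d (k - i)%N.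

Definition shift1 c : nat -> R := fun k => if k is k'.+1 then c k' else 0.

(** phi s = c_0 + c_1 s + ... + c_n s^n + o(s^n) as s tends to 0 from the right. *)
Definition jet (n : nat) phi c : Prop :=
  exists2 p : {poly R}, (phi s - p.[s]) / s ^+ n @[s --> 0^'+] --> (0 : R)
    & forall i, (i <= n)%N -> p`_i = c i.

Lemma horner_cvg0 p : p.[s] @[s --> (0 : R)^'+] --> p`_0.
Proof.
rewrite -horner_coef0; apply: cvg_at_right_filter.
exact: continuous_horner.
Qed.

Lemma jet_near n phi psi c : (\forall s \near 0^'+, phi s = psi s) ->
  jet n phi c -> jet n psi c.
Proof.
move=> e [p cp pc]; exists p => //; apply: cvg_trans cp; apply: near_eq_cvg.
by apply: filterS e => s ->.
Qed.

Lemma jet_coef n phi c d : (forall i, (i <= n)%N -> c i = d i) ->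
  jet n phi c -> jet n phi d.
Proof. by move=> cd [p cp pc]; exists p => // i ni; rewrite pc// cd. Qed.

Lemma jet_cvg n phi c : jet n phi c -> phi s @[s --> (0 : R)^'+] --> c 0%N.
Proof.
move=> [p cp pc]; rewrite -(pc 0%N)//.
have cn : (s ^+ n) @[s --> (0 : R)^'+] --> (0 : R) ^+ n.
  by apply: cvg_at_right_filter; exact: exprn_continuous.
have H : (phi s - p.[s]) / s ^+ n * s ^+ n + p.[s] @[s --> 0^'+]
    --> (0 : R) * 0 ^+ n + p`_0.
  by apply: cvgD (horner_cvg0 (p := p)); exact: cvgM.
rewrite mul0r add0r in H; apply: cvg_trans H; apply: near_eq_cvg; near=> s => /=.
have s0 : s != 0 by rewrite gt_eqF.
by rewrite divfK ?subrK// expf_neq0.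
Unshelve. all: by end_near. Qed.

Lemma jetD n phi psi c d : jet n phi c -> jet n psi d ->
  jet n (fun s => phi s + psi s) (fun k => c k + d k).
Proof.
move=> [p cp pc] [q cq qd]; exists (p + q); last first.
  by move=> i ni; rewrite coefD pc// qd.
have H : (phi s - p.[s]) / s ^+ n + (psi s - q.[s]) / s ^+ n @[s --> 0^'+]
    --> (0 : R) + 0 by exact: cvgD.
rewrite addr0 in H; apply: cvg_trans H; apply: near_eq_cvg.
by near=> s => /=; rewrite -mulrDl hornerD opprD addrACA.
Unshelve. all: by end_near. Qed.

Lemma jetM n phi psi c d : jet n phi c -> jet n psi d ->
  jet n (fun s => phi s * psi s) (cauchy_mul c d).
Proof.
move=> Jp Jq; have := jet_cvg Jq; case: Jp Jq => [p cp pc] [q cq qd] cpsi.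
exists (p * q); last first.
  move=> k kn; rewrite coefM; apply: eq_bigr => i _.
  have ik : (i <= k)%N by rewrite -ltnS.
  by rewrite pc ?(leq_trans ik)// qd// (leq_trans (leq_subr _ _)).
have H : (phi s - p.[s]) / s ^+ n * psi s + p.[s] * ((psi s - q.[s]) / s ^+ n)
    @[s --> 0^'+] --> (0 : R) * d 0%N + p`_0 * 0.
  apply: cvgD; first exact: cvgM.
  by apply: cvgM cq; exact: horner_cvg0.
rewrite mul0r mulr0 addr0 in H; apply: cvg_trans H; apply: near_eq_cvg.
near=> s => /=; rewrite hornerM.
by move: (s ^+ n)^-1 => e; ring.
Unshelve. all: by end_near. Qed.

Lemma jet_cst n a : jet n (fun=> a) (fun k => if k is 0%N then a else 0).
Proof.
exists a%:P; last by move=> [|i] _; rewrite coefC.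
apply: cvg_near_cst; apply: nearW => s.
by rewrite hornerC subrr mul0r.
Qed.

(** Multiplication by s gains one order. *)
Lemma jetS n phi c : jet n phi c -> jet n.+1 (fun s => s * phi s) (shift1 c).
Proof.
move=> [p cp pc]; exists ('X * p); last first.
  by move=> [|i] ni; rewrite coefXM//= pc.
apply: cvg_trans cp; apply: near_eq_cvg; near=> s => /=.
have s0 : s != 0 by rewrite gt_eqF.
rewrite hornerM hornerX exprS; field.
by rewrite s0 expf_neq0.
Unshelve. all: by end_near. Qed.

Lemma jetZ n (a : R) phi c : jet n phi c -> jet n (fun s => a * phi s) (fun k => a * c k).
Proof.
move=> [p cp pc]; exists (a%:P * p); last by move=> i ni; rewrite coefCM pc.
have H : a * ((phi s - p.[s]) / s ^+ n) @[s --> 0^'+] --> a * 0.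
  by apply: cvgM cp; exact: cvg_cst.
rewrite mulr0 in H; apply: cvg_trans H; apply: near_eq_cvg; near=> s => /=.
by rewrite hornerM hornerC; move: (_^-1) => e; ring.
Unshelve. all: by end_near. Qed.

Lemma jetN n phi c : jet n phi c -> jet n (fun s => - phi s) (fun k => - c k).
Proof.
move=> /(jetZ (-1)) J; apply: jet_near (jet_coef _ J).
  by apply: nearW => s; rewrite mulN1r.
by move=> i _; rewrite mulN1r.
Qed.

Lemma jet_poly n (p : {poly R}) : jet n (horner p) (fun i => p`_i).
Proof.
exists p => //; apply: cvg_near_cst; apply: nearW => s.
by rewrite subrr mul0r.
Qed.

Lemma jet_sum n m (F : 'I_m -> R -> R) (c : 'I_m -> nat -> R) :
  (forall i, jet n (F i) (c i)) ->
  jet n (fun s => \sum_i F i s) (fun k => \sum_i c i k).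
Proof.
elim: m F c => [|m IH] F c h.
  apply: jet_near (jet_coef _ (jet_cst n 0)).
    by apply: nearW => s; rewrite big_ord0.
  by move=> [|k] _; rewrite big_ord0.
have := jetD (h ord0) (IH _ _ (fun i => h (lift ord0 i))).
move=> H; apply: jet_near (jet_coef _ H).
  by apply: nearW => s; rewrite big_ord_recl.
by move=> k _; rewrite big_ord_recl.
Qed.

(** The constant coefficient is the limit at 0; once it is subtracted, a division
    by s reduces the order by one. *)
Lemma jet_unique n phi c d : jet n phi c -> jet n phi d ->
  forall k, (k <= n)%N -> c k = d k.
Proof.
suff jet0 : forall m (p : {poly R}), p.[s] / s ^+ m @[s --> 0^'+] --> (0 : R) ->
    forall k, (k <= m)%N -> p`_k = 0.
  move=> [p cp pc] [q cq qd] k kn; rewrite -pc// -qd//; apply/eqP.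
  rewrite -subr_eq0 -coefB; apply/eqP; apply: (jet0 n) => //.
  have H : (phi s - q.[s]) / s ^+ n - (phi s - p.[s]) / s ^+ n @[s --> 0^'+]
    --> (0 : R) - 0 by exact: cvgB.
  rewrite subr0 in H; apply: cvg_trans H; apply: near_eq_cvg.
  near=> s => /=; rewrite hornerD hornerN.
  by move: (s ^+ n)^-1 => e; ring.
have head0 m (p : {poly R}) : p.[s] / s ^+ m @[s --> 0^'+] --> (0 : R) -> p`_0 = 0.
  move=> cp; have J : jet m (horner p) (fun=> 0).
    exists 0; last by move=> i _; rewrite coef0.
    by under eq_fun do rewrite horner0 subr0.
  exact: cvg_unique (@horner_cvg0 p) (jet_cvg J).
elim=> [|m IH] p.
  by move=> /head0 p0 k; rewrite leqn0 => /eqP ->.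
elim/poly_ind: p => [|p a _] cp k km; first by rewrite coef0.
have a0 : a = 0 by have := head0 _ _ cp; rewrite coefD coefMX coefC add0r.
case: k km => [|k] km; rewrite coefD coefMX coefC a0 /= addr0 //.
apply: IH => //; apply: cvg_trans cp; apply: near_eq_cvg; near=> s => /=.
have s0 : s != 0 by rewrite gt_eqF.
rewrite a0 addr0 hornerM hornerX exprS; field.
by rewrite s0 expf_neq0.
Unshelve. all: by end_near. Qed.

End Jets.

(** * Boundary derivatives *)

Section CollarCongruence.
Context {R : realType}.
Local Notation V3 := 'rV[R]_3.
Variable s0 : R.
Implicit Types (x y v : V3) (f g : V3 -> R -> R).
Local Notation C k := (Ccollar k s0).

Lemma sgrad_congr (u w : V3 -> R) y i : S2 y -> (forall z, S2 z -> u z = w z) ->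
  sgrad u y 0 i = sgrad w y 0 i.
Proof.
move=> Sy uw; rewrite !mxE; apply: near_eq_derive.
have nz : \forall z \near y, z != 0 by apply: near_neq0; exact: S2_neq0.
by apply: filterS nz => z z0; apply: uw; exact: S2_sph.
Qed.

Lemma tder_congr f g y s i : S2 y -> (forall z, S2 z -> f z s = g z s) ->
  tder i f y s = tder i g y s.
Proof. by move=> Sy fg; exact: sgrad_congr. Qed.

Lemma ds_congr f g y s : 0 <= s < s0 -> (forall t, 0 <= t < s0 -> f y t = g y t) ->
  ds f y s = ds g y s.
Proof.
move=> /andP[s1 s2] fg; rewrite /ds; congr (lim _).
have E : \forall h \near (0 : R)^'+,
    h^-1 * (f y (s + h) - f y s) = h^-1 * (g y (s + h) - g y s).
  near=> h; have h0 : 0 < h by [].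
  have hs : s + h < s0.
    by rewrite -ltrBrDl; near: h; apply: nbhs_right_lt; rewrite subr_gt0.
  by rewrite !fg// ?s1// hs addr_ge0// ltW.
rewrite eqEsubset; split; apply: near_eq_cvg => //.
by apply: filterS E => h ->.
Unshelve. all: by end_near. Qed.

Lemma bdyS j f : bdy j (ds f) = bdy j.+1 f.
Proof. by apply/funext => y; rewrite /bdy iterSr. Qed.

Lemma Ccollar_iter_ds k j f : C (j + k) f -> C k (iter j ds f).
Proof.
elim: j k => [|j IH] k //.
by rewrite addSn -addnS => /IH; exact: Ccollar_ds.
Qed.

Lemma iter_ds_tder j i f : C j.+1 f -> forall y s, S2 y -> 0 <= s < s0 ->
  iter j ds (tder i f) y s = tder i (iter j ds f) y s.
Proof.
elim: j => // j IH Cf y s Sy ss /=.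
rewrite (@ds_congr _ (tder i (iter j ds f)))//.
  by apply: (ds_tder _ _ Sy ss); apply: Ccollar_iter_ds; rewrite addn2.
by move=> t tt; apply: IH => //; exact: CcollarW.
Qed.

Lemma bdy_tder j i f y : 0 < s0 -> C j.+1 f -> S2 y ->
  bdy j (tder i f) y = sgrad (bdy j f) y 0 i.
Proof. by move=> s00 Cf Sy; rewrite /bdy iter_ds_tder// lexx. Qed.

Lemma bdy_tder2 j i k f y : 0 < s0 -> C j.+2 f -> S2 y ->
  bdy j (tder i (tder k f)) y = sgrad (fun z => sgrad (bdy j f) z 0 k) y 0 i.
Proof.
move=> s00 Cf Sy; rewrite bdy_tder//; last exact: Ccollar_tder.
by apply: sgrad_congr => // z Sz; rewrite bdy_tder//; exact: CcollarW.
Qed.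

(** Taylor expansion.  By the mean value theorem, the remainder of order n + 1 of
    f at s is s times the remainder of order n of ds f at a smaller point. *)
Lemma jet_collar n f y : 0 < s0 -> C n f -> S2 y ->
  jet n (f y) (fun j => bdy j f y / j`!%:R).
Proof.
move=> s00 Cf Sy.
pose T m (g : V3 -> R -> R) := \poly_(j < m.+1) (bdy j g y / j`!%:R).
exists (T n f); last by move=> i ni; rewrite coef_poly ltnS ni.
elim: n f Cf => [|n IH] f Cf.
  have [U [fe [oU AU cU fE]]] := Cf.
  have A0 : collar s0 (y, 0) by split; rewrite //= lexx.
  have fe0 : f y 0 = fe (y, 0) by rewrite -(fE (y, 0))// inE.
  have cf : {for 0, continuous (fun s : R => fe (y, s))}.
    apply: (@continuous_comp _ _ _ (fun s : R => (y, s)) fe).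
      by apply: differentiable_continuous; apply: differentiable_pair.
    exact/cU/AU.
  have H : fe (y, s) - fe (y, 0) @[s --> 0^'+] --> fe (y, 0) - fe (y, 0).
    by apply: cvgB (cvg_at_right_filter cf) _; exact: cvg_cst.
  rewrite subrr in H; apply: cvg_trans H; apply: near_eq_cvg; near=> s.
  have ss : 0 <= s < s0.
    apply/andP; split; first by apply: ltW.
    by near: s; exact: nbhs_right_lt.
  rewrite /T -(fE (y, s)) ?inE//= -fe0 expr0 divr1 horner_poly big_ord1.
  by rewrite expr0 mulr1 divr1.
have {IH} := IH _ (Ccollar_ds Cf); rewrite -/(T n (ds f)) => IH.
have dT : (T n.+1 f)^`() = T n (ds f).
  apply/polyP => i; rewrite coef_deriv !coef_poly.
  have -> : (i.+1 < n.+2)%N = (i < n.+1)%N by [].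
  case: ifP => [ni|_]; last by rewrite mul0rn.
  rewrite bdyS -[_ *+ i.+1]mulr_natr factS natrM.
  have : (i.+1%:R : R) != 0 by rewrite pnatr_eq0.
  have : (i`!%:R : R) != 0 by rewrite pnatr_eq0 -lt0n fact_gt0.
  move: (i.+1%:R : R) (i`!%:R : R) => b a a0 b0.
  by field; rewrite a0.
have [U [fe [oU AU [dU _] fE]]] := Cf.
have fE' t : 0 <= t < s0 -> f y t = fe (y, t).
  by move=> tt; rewrite -(fE (y, t))// inE.
have dfe t : 0 <= t < s0 -> is_derive t 1 (fun r : R => fe (y, r)) (ds f y t).
  move=> tt; have df : differentiable fe (y, t) by apply/dU/AU.
  rewrite (ds_ext df tt fE').
  have E (r : R) : (y, r) = r *: ((0, 1) : V3 * R) + (y, 0).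
    by apply/pair_equal_spec; rewrite /= scaler0 add0r [_%:A]mulr1 addr0.
  rewrite E (_ : (fun r => fe (y, r)) = fun r => fe (r *: ((0, 1) : V3 * R) + (y, 0))).
    by apply: is_derive_line; rewrite -E.
  by apply/funext => r; rewrite E.
have T0 : (T n.+1 f).[0] = f y 0.
  by rewrite horner_coef0 coef_poly /= divr1.
apply/cvgrPdist_le => e e0.
have /cvgrPdist_le /(_ e e0) [d /= d0 hd] := IH.
near=> s.
have sgt : 0 < s by [].
have slt : s < s0 by near: s; exact: nbhs_right_lt.
have sd : s < d by near: s; exact: nbhs_right_lt.
pose G (r : R) := fe (y, r) - (T n.+1 f).[r].
have dG r : 0 <= r <= s -> is_derive r 1 G (ds f y r - (T n (ds f)).[r]).
  move=> /andP[r0 rs]; apply: is_deriveB; last by rewrite -dT; exact: is_derive_poly.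
  by apply: dfe; rewrite r0 (le_lt_trans rs).
have dG' r : r \in `]0, s[ -> is_derive r 1 G (ds f y r - (T n (ds f)).[r]).
  by rewrite in_itv /= => /andP[/ltW r0 /ltW r1]; apply: dG; rewrite r0.
have cG : {within `[0, s], continuous G}.
  apply: derivable_within_continuous => r; rewrite in_itv /= => rs.
  by have [] := dG r rs.
have [r] := MVT sgt dG' cG; rewrite in_itv /= => /andP[r0 rs].
rewrite /G T0 -!fE' ?lexx ?(ltW sgt)// subrr !subr0 => ->.
have simp (X : R) : X * s / s ^+ n.+1 = X / s ^+ n.
  by rewrite exprS; field; rewrite expf_neq0 ?gt_eqF.
rewrite sub0r normrN simp.
have := hd r; rewrite /ball /= sub0r normrN gtr0_norm// => /(_ (lt_trans rs sd) r0).
rewrite sub0r normrN !normrM; apply: le_trans; rewrite ler_wpM2l//.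
rewrite !normfV !normrX !gtr0_norm// lef_pV2 ?posrE ?exprn_gt0//.
by rewrite lerXn2r ?nnegrE ?ltW.
Unshelve. all: by end_near. Qed.

End CollarCongruence.

Section CollarDerivations.
Context {R : realType}.
Local Notation V3 := 'rV[R]_3.
Variable s0 : R.
Implicit Types (x y v : V3) (f g : V3 -> R -> R).
Local Notation C k := (Ccollar k s0).

Lemma Ccollar_coord k i : C k (fun y _ => y 0 i).
Proof.
exists setT, (fun q : V3 * R => q.1 0 i); split=> //; first exact: openT.
exact: Ck_coord.
Qed.

Lemma CcollarZ k c f : C k f -> C k (fun y s => c * f y s).
Proof. by move=> Cf; apply: CcollarM Cf; exact: Ccollar_cst. Qed.

Lemma CcollarN k f : C k f -> C k (fun y s => - f y s).
Proof.
by move=> Cf; apply: Ccollar_eq (CcollarZ (-1) Cf) => y s _ _; rewrite mulN1r.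
Qed.

Lemma CcollarB k f g : C k f -> C k g -> C k (fun y s => f y s - g y s).
Proof. by move=> Cf Cg; exact: CcollarD Cf (CcollarN Cg). Qed.

Lemma CcollarX k n f : C k f -> C k (fun y s => f y s ^+ n).
Proof.
move=> Cf; elim: n => [|n IH]; first exact: Ccollar_cst.
by apply: Ccollar_eq (CcollarM Cf IH) => y s _ _; rewrite exprS.
Qed.

Section AtPoint.
Variables (y : V3) (s : R).
Hypotheses (Sy : S2 y) (ss : 0 <= s < s0).

Lemma dsD f g : C 1 f -> C 1 g ->
  ds (fun y s => f y s + g y s) y s = ds f y s + ds g y s.
Proof.
move=> /Ccollar1P[fe hf] /Ccollar1P[ge hg].
have [df _ -> _] := hf y s Sy ss; have [dg _ -> _] := hg y s Sy ss.
rewrite -deriveD; [|exact: diff_derivable..].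
apply: ds_ext ss _; first exact: differentiableD.
by move=> t tt; have [_ -> _ _] := hf y t Sy tt; have [_ -> _ _] := hg y t Sy tt.
Qed.

Lemma dsM f g : C 1 f -> C 1 g ->
  ds (fun y s => f y s * g y s) y s = f y s * ds g y s + g y s * ds f y s.
Proof.
move=> /Ccollar1P[fe hf] /Ccollar1P[ge hg].
have [df -> -> _] := hf y s Sy ss; have [dg -> -> _] := hg y s Sy ss.
rewrite -[RHS](@deriveM _ _ fe ge); [|exact: diff_derivable..].
apply: ds_ext ss _; first exact: differentiableM.
by move=> t tt; have [_ -> _ _] := hf y t Sy tt; have [_ -> _ _] := hg y t Sy tt.
Qed.

Lemma ds_cst c : ds (fun _ _ => c) y s = 0.
Proof.
rewrite (ds_ext (fe := fun=> c) _ ss) ?derive_cst//.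
Qed.

Lemma ds_coord i : ds (fun y _ => y 0 i) y s = 0.
Proof. exact: (ds_cst (y 0 i)). Qed.

Lemma ds_id : ds (fun _ s => s) y s = 1.
Proof.
have lin : linear (fun q : V3 * R => q.2 : R) by [].
pose fM := GRing.isLinear.Build _ _ _ _ _ lin.
pose p2 : {linear (V3 * R)%type -> R} := HB.pack (fun q : V3 * R => q.2 : R) fM.
have [_ D2] := is_derive_linear p2 (y, s) (0, 1).
rewrite (ds_ext (fe := snd) _ ss) //.
apply: (@linear_differentiable _ _ _ p2) => q; exact: cvg_snd.
Qed.

Lemma tderD i f g : C 1 f -> C 1 g ->
  tder i (fun y s => f y s + g y s) y s = tder i f y s + tder i g y s.
Proof.
move=> /Ccollar1P[fe hf] /Ccollar1P[ge hg].
have [df _ _ ->] := hf y s Sy ss; have [dg _ _ ->] := hg y s Sy ss.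
rewrite -deriveD; [|exact: diff_derivable..].
apply: sgrad_ext Sy _; first exact: differentiableD.
by move=> z Sz; have [_ -> _ _] := hf z s Sz ss; have [_ -> _ _] := hg z s Sz ss.
Qed.

Lemma tderM i f g : C 1 f -> C 1 g ->
  tder i (fun y s => f y s * g y s) y s = f y s * tder i g y s + g y s * tder i f y s.
Proof.
move=> /Ccollar1P[fe hf] /Ccollar1P[ge hg].
have [df -> _ ->] := hf y s Sy ss; have [dg -> _ ->] := hg y s Sy ss.
rewrite -[RHS](@deriveM _ _ fe ge); [|exact: diff_derivable..].
apply: sgrad_ext Sy _; first exact: differentiableM.
by move=> z Sz; have [_ -> _ _] := hf z s Sz ss; have [_ -> _ _] := hg z s Sz ss.
Qed.

Lemma tder_cst i (u : R -> R) : tder i (fun _ s => u s) y s = 0.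
Proof. by rewrite /tder mxE; exact: derive_cst. Qed.

Lemma tder_coord i j : tder j (fun y _ => y 0 i) y s = (i == j)%:R - y 0 i * y 0 j.
Proof.
have [_ H] := is_derive_sph_coord (delta_mx 0 j) i (S2_neq0 Sy).
rewrite /tder mxE; etransitivity; first exact: H.
rewrite Sy invr1 mul1r dot_delta sph_S2// !mxE.
by rewrite mulrC.
Qed.

Lemma sum_tproj i (D : 'I_3 -> R) :
  \sum_(j < 3) tproj i y 0 j * D j = D i - y 0 i * \sum_(j < 3) y 0 j * D j.
Proof.
rewrite mulr_sumr (bigD1 i)//= [X in _ - X](bigD1 i)//= opprD addrA; congr (_ + _).
  by rewrite !mxE !eqxx /=; ring.
rewrite -sumrN; apply: eq_bigr => j ji.
by rewrite !mxE (negbTE ji) andbF /=; ring.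
Qed.

(** The combination of the tproj i y with coefficients y_i is zero: the gradient
    is tangent to the sphere. *)
Lemma sum_coord_tder f : C 1 f -> \sum_(i < 3) y 0 i * tder i f y s = 0.
Proof.
move=> /Ccollar1P[fe hf]; have [df _ _ hT] := hf y s Sy ss.
transitivity ('D_((\sum_(i < 3) y 0 i *: tproj i y), 0) fe (y, s)).
  rewrite deriveE//.
  have -> : (\sum_(i < 3) y 0 i *: tproj i y, 0) =
      \sum_(i < 3) y 0 i *: ((tproj i y, 0) : V3 * R).
    rewrite [RHS]surjective_pairing; congr (_, _).
      by rewrite (big_morph fst (id1 := 0) (op1 := +%R)).
    rewrite (big_morph snd (id1 := 0) (op1 := +%R))//= big1// => i _.
    by rewrite scaler0.
  rewrite linear_sum; apply: eq_bigr => i _.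
  by rewrite linearZ hT deriveE.
have -> : \sum_(i < 3) y 0 i *: tproj i y = 0.
  rewrite /tproj; under eq_bigr do rewrite scalerBr scalerA.
  rewrite sumrB -row_sum_delta -scaler_suml.
  by rewrite -/(dot y y) S2_dot// scale1r subrr.
exact: derive0.
Qed.

End AtPoint.

Definition pull f (x : V3) : R := f (sph x) (enorm x)^-1.

Lemma collect_directions v y (D : 'I_3 -> R) (D1 s r : R) :
  \sum_(i < 3) (s *: (v - dot y v *: y)) 0 i * D i + - r * dot y v * D1
  = \sum_(i < 3) v 0 i * (s * (D i - y 0 i * \sum_(j < 3) y 0 j * D j)
                         - r * y 0 i * D1).
Proof. by rewrite /dot !big_ord_recl !big_ord0 !mxE; ring. Qed.

Lemma is_derive_pull f x v : C 1 f -> x != 0 -> (enorm x)^-1 < s0 ->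
  is_derive x v (pull f)
   (\sum_(i < 3) v 0 i * ((enorm x)^-1 * tder i f (sph x) (enorm x)^-1
       - (enorm x) ^- 2 * sph x 0 i * ds f (sph x) (enorm x)^-1)).
Proof.
move=> /Ccollar1P[fe hf] x0 xs; have := x0; rewrite -enorm_gt0 => e0.
have ss : 0 <= (enorm x)^-1 < s0 by rewrite xs invr_ge0 ltW.
have Sx := S2_sph x0.
have [df _ dsE hT] := hf _ _ Sx ss.
have dinv : differentiable (fun z => (enorm z)^-1) x.
  by apply: differentiableV; [exact: differentiable_enorm|rewrite gt_eqF].
have pullE : \forall z \near x, fe (sph z, (enorm z)^-1) = pull f z.
  have nz := near_neq0 x0.
  have ns : \forall z \near x, (enorm z)^-1 < s0.
    by apply: (@cvgr_lt _ _ _ _ _ _ (differentiable_continuous dinv)).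
  apply: filterS2 nz ns => z z0 zs; rewrite /pull.
  have [|_ -> _ _//] := hf (sph z) (enorm z)^-1 (S2_sph z0).
  by rewrite zs invr_ge0 sqrtr_ge0.
apply: near_eq_is_derive pullE _; split.
  by apply/diff_derivable/differentiable_sph_pair.
rewrite derive_sph_pair//.
have [_ ->] := is_derive_enormV v x0.
rewrite derive_pairE// dsE.
under [RHS]eq_bigr => i _ do
  rewrite hT derive_pairE// mul0r addr0
    (sum_tproj (sph x) i (fun j => 'D_(delta_mx 0 j, 0) fe (sph x, (enorm x)^-1))).
exact: (collect_directions v (sph x) (fun j =>
  'D_(delta_mx 0 j, 0) fe (sph x, (enorm x)^-1))).
Qed.

End CollarDerivations.

(** * The Schwarzschild metric in Cartesian coordinates *)

Section SchwarzschildMatrix.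
Context {R : realType}.
Local Notation V3 := 'rV[R]_3.
Implicit Types (h : R) (y : V3).

(** The matrix y^T y is the orthogonal projection on the radial direction y. *)
Definition schw h y : 'M[R]_(1 + 3) :=
  block_mx (- h)%:M 0 0 (h^-1 *: (y^T *m y) + (1%:M - y^T *m y)).

Definition schwV h y : 'M[R]_(1 + 3) :=
  block_mx (- h^-1)%:M 0 0 (h *: (y^T *m y) + (1%:M - y^T *m y)).

Lemma mul_row_tr (u v : V3) : u *m v^T = (dot u v)%:M.
Proof.
apply/matrixP => i j; rewrite !mxE !ord1 eqxx mulr1n.
by apply: eq_bigr => k _; rewrite !mxE.
Qed.

Lemma proj_idem y : S2 y -> y^T *m y *m (y^T *m y) = y^T *m y.
Proof.
by move=> Sy; rewrite mulmxA -(mulmxA _ y) mul_row_tr S2_dot// mulmx1.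
Qed.

Lemma schw_mulV h y : h != 0 -> S2 y -> schw h y *m schwV h y = 1%:M.
Proof.
move=> h0 Sy; rewrite mulmx_block !mulmx0 !mul0mx !addr0 !add0r.
rewrite -scalar_mxM mulrNN divff//.
set N := y^T *m y; have NN : N *m N = N by exact: proj_idem.
have -> : (h^-1 *: N + (1%:M - N)) *m (h *: N + (1%:M - N)) = 1%:M.
  rewrite !(mulmxDl, mulmxDr, mulmxN, mulNmx, mul1mx, mulmx1).
  rewrite -!scalemxAl -!scalemxAr NN; apply/matrixP => i j.
  by rewrite !mxE; field.
by rewrite -scalar_mx_block.
Qed.

Lemma invmx_schw h y : h != 0 -> S2 y -> invmx (schw h y) = schwV h y.
Proof.
move=> h0 Sy; have E := schw_mulV h0 Sy; have [U _] := mulmx1_unit E.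
by rewrite -[LHS]mulmx1 -E mulKmx.
Qed.

Lemma mul_radial_tangential (c : R) y (w : V3) :
  w *m (c *: (y^T *m y) + (1%:M - y^T *m y)) = w + ((c - 1) * dot w y) *: y.
Proof.
rewrite mulmxDr mulmxBr mulmx1 -scalemxAr mulmxA mul_row_tr mul_scalar_mx.
by apply/rowP => i; rewrite !mxE; ring.
Qed.

Lemma schwV_mul_row h y (t : R) (w : V3) :
  row_mx t%:M w *m schwV h y =
  row_mx (- h^-1 * t)%:M (w + ((h - 1) * dot w y) *: y).
Proof.
rewrite mul_row_block !mulmx0 addr0 add0r -scalar_mxM mulrC; congr row_mx.
exact: mul_radial_tangential.
Qed.

Lemma schw_form h y (t : R) (w : V3) :
  (row_mx t%:M w *m schw h y *m (row_mx t%:M w)^T) 0 0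
  = - h * t ^+ 2 + dot w w + (h^-1 - 1) * dot w y ^+ 2.
Proof.
rewrite mul_row_block !mulmx0 addr0 add0r tr_row_mx mul_row_col tr_scalar_mx.
rewrite -!scalar_mxM mul_radial_tangential mulmxDl -scalemxAl !mul_row_tr.
by rewrite !mxE /= !mulr1n (dotC y w); ring.
Qed.

Lemma schwV_sym h y a b : schwV h y a b = schwV h y b a.
Proof.
have -> : schwV h y b a = (schwV h y)^T a b by rewrite [RHS]mxE.
rewrite tr_block_mx !trmx0 tr_scalar_mx linearD linearB /= linearZ /= trmx1.
by rewrite !trmx_mul trmxK /schwV.
Qed.

End SchwarzschildMatrix.

Section GraphGeometry.
Context {R : realType}.
Local Notation V3 := 'rV[R]_3.
Local Notation V4 := 'rV[R]_(1 + 3).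
Local Notation radius := Defs.radius.
Implicit Types (p v : V4).

Lemma dot_split_y (y t : V3) (a b : R) : S2 y -> dot t y = 0 ->
  dot (a *: t - b *: y) y = - b.
Proof.
move=> Sy ty; rewrite dotC dotDr -scaleNr !dotZr (dotC y t) ty S2_dot//.
by rewrite mulr0 add0r mulr1.
Qed.

Lemma dot_split (y t : V3) (a b c : R) : S2 y -> dot t y = 0 ->
  dot (a *: t - b *: y) (a *: t - c *: y) = a ^+ 2 * dot t t + b * c.
Proof.
move=> Sy ty; rewrite dotDr -[- (c *: y)]scaleNr !dotZr dot_split_y//.
rewrite (dotC _ t) dotDr -scaleNr !dotZr ty; ring.
Qed.

(** The difference quotients of a function of x at p and of the same function at
    xcoord p are equal. *)
Lemma is_derive_xcoord (G : V3 -> R) p v d :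
  is_derive (xcoord p) (xcoord v) G d -> is_derive p v (fun q => G (xcoord q)) d.
Proof.
have E : (fun h : R => h^-1 *: ((fun q => G (xcoord q)) (h *: v + p)
             - G (xcoord p)))
  = (fun h => h^-1 *: (G (h *: xcoord v + xcoord p) - G (xcoord p))).
  by apply/funext => h; rewrite /xcoord linearP.
by move=> [d1 d2]; split; move: d1 d2; rewrite /derivable /derive E.
Qed.

Lemma is_derive_tcoord p v : is_derive p v (@tcoord R) (tcoord v).
Proof.
have lin : linear (@tcoord R) by move=> c z w; rewrite /tcoord linearP !mxE.
pose fM := GRing.isLinear.Build _ _ _ _ _ lin.
pose f : {linear V4 -> R} := HB.pack (@tcoord R) fM.
exact: (is_derive_linear f).
Qed.

Lemma tcoord_lshift j : @tcoord R (delta_mx 0 (lshift 3 j)) = 1.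
Proof. by rewrite /tcoord !mxE ord1 !eqxx. Qed.

Lemma tcoord_rshift i : @tcoord R (delta_mx 0 (rshift 1 i)) = 0.
Proof. by rewrite /tcoord !mxE eq_lrshift andbF. Qed.

Lemma xcoord_lshift j : @xcoord R (delta_mx 0 (lshift 3 j)) = 0.
Proof. by apply/rowP => k; rewrite !mxE eq_rlshift andbF. Qed.

Lemma xcoord_rshift i : @xcoord R (delta_mx 0 (rshift 1 i)) = delta_mx 0 i.
Proof. by apply/rowP => k; rewrite !mxE eq_rshift. Qed.

Lemma row_mx_delta (t : R) (w : V3) (b : 'I_(1 + 3)) :
  t * tcoord (delta_mx 0 b) + dot w (xcoord (delta_mx 0 b)) = row_mx t%:M w 0 b.
Proof.
rewrite -[b]fintype.splitK; case: (fintype.split b) => j /=.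
  rewrite row_mxEl tcoord_lshift xcoord_lshift mulr1 mxE ord1 eqxx mulr1n.
  by rewrite -[X in dot _ X](scale0r w) dotZr mul0r addr0.
by rewrite row_mxEr tcoord_rshift xcoord_rshift mulr0 add0r dot_delta.
Qed.

Lemma near_xcoord (A : V3 -> Prop) p : (\forall x \near xcoord p, A x) ->
  \forall q \near p, A (xcoord q).
Proof.
move=> h; have c : {for p, continuous (@xcoord R)}.
  exact: differentiable_continuous (differentiable_rsubmx _).
exact: c.
Qed.

Variables (m s0 : R) (P : V3 -> R -> R).
Hypotheses (hm : 0 <= m) (ms0 : 2 * m * s0 < 1).
Hypothesis CP : Ccollar 2 s0 P.

Definition in_collar p := xcoord p != 0 /\ (radius p)^-1 < s0.

Lemma near_in_collar p : in_collar p -> \forall q \near p, in_collar q.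
Proof.
move=> [x0 ps]; apply: (near_xcoord (A := fun x => x != 0 /\ (enorm x)^-1 < s0)).
have dinv : differentiable (fun z : V3 => (enorm z)^-1) (xcoord p).
  apply: differentiableV; first exact: differentiable_enorm.
  by rewrite gt_eqF// enorm_gt0.
have ns : \forall z \near xcoord p, (enorm z)^-1 < s0.
  by apply: (@cvgr_lt _ _ _ _ _ _ (differentiable_continuous dinv)).
by apply: filterS2 (near_neq0 x0) ns.
Qed.

Lemma is_derive_tortoise r : 0 < r -> 2 * m < r ->
  is_derive r 1 (tortoise m) (hfun m r)^-1.
Proof.
move=> r0 mr; have := hm; rewrite le_eqVlt => /orP[/eqP m0|m0].
  have -> : tortoise m = id.
    by apply/funext => z; rewrite /tortoise -m0 mulr0 mul0r addr0.
  by rewrite /hfun -m0 mulr0 mul0r subr0 invr1; exact: is_derive_id.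
have m2 : 0 < 2 * m by rewrite mulr_gt0.
have pos : 0 < r / (2 * m) - 1 by rewrite subr_gt0 ltr_pdivlMr// mul1r.
have dl : is_derive r 1 (fun z : R => z / (2 * m) - 1) (2 * m)^-1.
  rewrite (_ : (fun z => _) = (id * cst (2 * m)^-1 - cst 1 : R -> R))//.
  apply: is_derive_eq.
  by rewrite /GRing.scale /= mulr0 mulr1 add0r subr0.
have dln : is_derive r 1 (fun z : R => ln (z / (2 * m) - 1))
    ((r / (2 * m) - 1)^-1 * (2 * m)^-1).
  by apply: (is_derive_compR dl); exact: is_derive1_ln.
pose F : R -> R := id + (2 * m) *: (fun z : R => ln (z / (2 * m) - 1)).
have nF : \forall z \near r, F z = tortoise m z.
  have : \forall z \near r, 2 * m < z by exact: lt_nbhsr.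
  apply: filterS => z zm; rewrite /tortoise gtr0_norm//.
  by rewrite subr_gt0 ltr_pdivlMr// mul1r.
suff dF : is_derive r 1 F (hfun m r)^-1 by exact: near_eq_is_derive nF dF.
apply: is_derive_eq (is_deriveD (is_derive_id r 1) (is_deriveZ (2 * m) dln)) _.
rewrite /GRing.scale /= /hfun.
have rm : r - 2 * m != 0 by rewrite subr_eq0 gt_eqF.
have r1 : r != 0 by rewrite gt_eqF.
have m1 : m != 0 by rewrite gt_eqF.
by field; rewrite r1 rm m1.
Qed.

Section AtPoint.
Variable p : V4.
Hypothesis Op : in_collar p.

Let y := angle p.
Let s := (radius p)^-1.
Let h := hfun m (radius p).
Let T : V3 := sgrad (P^~ s) y.
Let Ps := ds P y s.

Lemma radius_gt0 : 0 < radius p.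
Proof. by rewrite enorm_gt0; case: Op. Qed.

Lemma S2_angle : S2 y.
Proof. by apply: S2_sph; case: Op. Qed.

Lemma s_in : 0 <= s < s0.
Proof. by case: Op => _ ->; rewrite andbT invr_ge0 ltW ?radius_gt0. Qed.

Lemma hfunE : h = 1 - 2 * m * s. Proof. by []. Qed.

Lemma hfun_gt0 : 0 < h.
Proof.
rewrite hfunE subr_gt0; apply: le_lt_trans ms0; rewrite ler_wpM2l ?mulr_ge0//.
by apply: ltW; have /andP[] := s_in.
Qed.

Lemma dot_T_y : dot T y = 0.
Proof.
rewrite dotC; apply: (sum_coord_tder S2_angle s_in).
exact: Ccollar_le CP.
Qed.

(** The spatial part of dF; its time component is 1. *)
Definition covector : V3 := s *: T - (h^-1 + s ^+ 2 * Ps) *: y.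

Lemma dot_covector_y : dot covector y = - (h^-1 + s ^+ 2 * Ps).
Proof. exact: dot_split_y S2_angle dot_T_y. Qed.

Lemma is_derive_Ffun v : is_derive p v (Ffun m P)
  (tcoord v + dot covector (xcoord v)).
Proof.
have [x0 ps] := Op.
have r0 := radius_gt0.
have mr : 2 * m < radius p.
  have := hfun_gt0; rewrite hfunE subr_gt0 /s.
  by rewrite ltr_pdivrMr// mul1r.
have d1 := is_derive_tcoord p v.
have d2 : is_derive p v (fun q => tortoise m (radius q)) (h^-1 * dot y (xcoord v)).
  apply: (is_derive_xcoord (G := fun x => tortoise m (enorm x))).
  by apply: (is_derive_compR (is_derive_enorm (xcoord v) x0)); exact: is_derive_tortoise.
have d3 : is_derive p v (fun q => P (angle q) (radius q)^-1) _ :=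
  is_derive_xcoord (is_derive_pull (xcoord v) (CcollarW CP) x0 ps).
apply: is_derive_eq (is_deriveD (is_deriveB d1 d2) d3) _.
rewrite -addrA; congr (_ + _).
rewrite -!/(radius p) -!/(angle p) -/y -/s -/Ps.
have -> : (radius p) ^- 2 = s ^+ 2 by rewrite /s exprVn.
rewrite /dot /covector mulr_sumr -sumrN -big_split; apply: eq_bigr => i _ /=.
rewrite /tder -/T; move: T y Ps (h^-1) (xcoord v) => t z a b x.
by rewrite !mxE; ring.
Qed.

(** The spatial part of grad F; its time component is - 1 / h. *)
Definition conormal : V3 := s *: T - (1 + s ^+ 2 * h * Ps) *: y.

Lemma gradient_Ffun :
  gradient (gSch m) (Ffun m P) p = row_mx (- h^-1)%:M conormal.
Proof.
have h0 : h != 0 by rewrite gt_eqF// hfun_gt0.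
have -> : gradient (gSch m) (Ffun m P) p = row_mx 1%:M covector *m schwV h y.
  apply/rowP => a; rewrite mxE /= [RHS]mxE; apply: eq_bigr => b _.
  rewrite [gSch m p](_ : _ = schw h y)// invmx_schw//; last exact: S2_angle.
  rewrite schwV_sym mulrC; congr (_ * _).
  rewrite /partial; have [_ ->] := is_derive_Ffun (delta_mx 0 b).
  by rewrite -row_mx_delta mul1r.
rewrite schwV_mul_row mulr1 dot_covector_y; apply: f_equal.
rewrite /conormal /covector; move: T y Ps => t z c.
by apply/rowP => i; rewrite !mxE; field.
Qed.

Lemma metric_gradient :
  metric (gSch m) p (gradient (gSch m) (Ffun m P) p) (gradient (gSch m) (Ffun m P) p)
  = - (s ^+ 2 * Lgraph m P y s).
Proof.
have h0 : h != 0 by rewrite gt_eqF// hfun_gt0.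
rewrite gradient_Ffun /metric [gSch m p](_ : _ = schw h y)// schw_form.
have -> : dot conormal y = - (1 + s ^+ 2 * h * Ps).
  exact: dot_split_y S2_angle dot_T_y.
have -> : dot conormal conormal = s ^+ 2 * dot T T + (1 + s ^+ 2 * h * Ps) ^+ 2.
  by rewrite (dot_split _ _ _ S2_angle dot_T_y) expr2.
rewrite /Lgraph -/y -/s -/Ps -/T -hfunE.
by move: (dot T T) Ps => a b; field.
Qed.

(** If q = g (grad F, grad F) were nonnegative, then grad F - q d_t would be a
    nonzero vector tangent to the surface, of nonpositive length - q^2 h - q. *)
Lemma Lgraph_gt0 :
  (forall v : V4, v != 0 -> 'D_v (Ffun m P) p = 0 -> 0 < metric (gSch m) p v v) ->
  0 < Lgraph m P y s.
Proof.
move=> sp; rewrite ltNge; apply/negP => L0.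
have h0 : h != 0 by rewrite gt_eqF// hfun_gt0.
have s2 : 0 < s ^+ 2 by rewrite exprn_gt0// invr_gt0 radius_gt0.
pose q := - (s ^+ 2 * Lgraph m P y s).
have q0 : 0 <= q by rewrite oppr_ge0 pmulr_rle0.
have Eq : q = - h^-1 + dot conormal conormal + (h^-1 - 1) * dot conormal y ^+ 2.
  rewrite /q -metric_gradient gradient_Ffun /metric [gSch m p](_ : _ = schw h y)//.
  by rewrite schw_form; field.
have Dt : dot covector conormal = q + h^-1.
  rewrite Eq /covector /conormal !(dot_split _ _ _ S2_angle dot_T_y).
  rewrite (dot_split_y _ _ S2_angle dot_T_y).
  by move: (dot T T) Ps => a b; field.
pose v : V4 := row_mx (- h^-1 - q)%:M conormal.
have Dv : 'D_v (Ffun m P) p = 0.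
  have [_ ->] := is_derive_Ffun v.
  rewrite /tcoord /xcoord row_mxKl row_mxKr mxE eqxx mulr1n Dt; ring.
have Mv : metric (gSch m) p v v = - (q ^+ 2 * h) - q.
  rewrite /metric [gSch m p](_ : _ = schw h y)// schw_form.
  have -> : dot conormal conormal = q + h^-1 - (h^-1 - 1) * dot conormal y ^+ 2.
    by rewrite Eq; ring.
  by field.
have v0 : v != 0.
  apply/eqP => v0; have := congr1 (@tcoord R) v0.
  rewrite /v /tcoord row_mxKl !mxE eqxx mulr1n => E.
  have : 0 < h^-1 by rewrite invr_gt0 hfun_gt0.
  by rewrite (_ : h^-1 = - q) ?oppr_gt0 ?ltNge ?q0//; lra.
have := sp v v0 Dv; rewrite Mv ltNge; apply/negP; rewrite negbK.
have := hfun_gt0 => hp.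
by rewrite subr_le0 (le_trans _ q0)// oppr_le0 mulr_ge0 ?sqr_ge0// ltW.
Qed.

End AtPoint.

End GraphGeometry.

(** * The mean curvature of a graph *)

Section DivergenceByTrace.
Context {R : realType} {n : nat}.
Implicit Types (g : 'rV[R]_n.+1 -> 'M[R]_n.+1) (X : 'rV[R]_n.+1 -> 'rV[R]_n.+1).

(** This is the logarithmic derivative of the square root of |det g|: by symmetry
    of the inverse matrix, two of the three terms of the symbols cancel. *)
Lemma christoffel_trace g p c : (forall a d, invmx (g p) a d = invmx (g p) d a) ->
  \sum_(a < n.+1) christoffel g p a a c
  = 2^-1 * \sum_(a < n.+1) \sum_(d < n.+1)
      invmx (g p) a d * partial c (fun q => g q d a) p.
Proof.
move=> sym; rewrite /christoffel -mulr_sumr; congr (_ * _).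
pose A a d := invmx (g p) a d * partial a (fun q => g q d c) p.
transitivity (\sum_(a < n.+1) \sum_(d < n.+1)
    (invmx (g p) a d * partial c (fun q => g q d a) p + (A a d - A d a))).
  apply: eq_bigr => a _; apply: eq_bigr => d _.
  rewrite /A (sym d a).
  move: (partial a _ p) (partial c _ p) (partial d _ p) (invmx _ _ _) => x y z w.
  by ring.
have -> : \sum_(a < n.+1) \sum_(d < n.+1)
    (invmx (g p) a d * partial c (fun q => g q d a) p + (A a d - A d a))
  = \sum_(a < n.+1) \sum_(d < n.+1) invmx (g p) a d * partial c (fun q => g q d a) p
    + (\sum_(a < n.+1) \sum_(d < n.+1) A a d - \sum_(a < n.+1) \sum_(d < n.+1) A d a).
  rewrite -sumrB -big_split; apply: eq_bigr => a _ /=.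
  by rewrite -sumrB -big_split.
by rewrite [X in _ - X]exchange_big subrr addr0.
Qed.

Lemma divergence_unimodular g X p :
  (forall c, \sum_(a < n.+1) christoffel g p a a c = 0) ->
  divergence g X p = \sum_(a < n.+1) partial a (fun q => X q 0 a) p.
Proof.
move=> tr0; rewrite /divergence big_split /= exchange_big /= [X in _ + X]big1 ?addr0//.
by move=> c _; rewrite -mulr_suml tr0 mul0r.
Qed.

End DivergenceByTrace.

Lemma sum_time_space {R : realType} (F : 'I_(1 + 3) -> R) :
  \sum_(a < 4) F a = F (lshift 3 ord0) + \sum_(i < 3) F (rshift 1 i).
Proof. by rewrite (@big_split_ord _ _ _ 1 3) big_ord1. Qed.

Section SchwarzschildDivergence.
Context {R : realType}.
Local Notation V3 := 'rV[R]_3.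
Local Notation V4 := 'rV[R]_(1 + 3).
Local Notation radius := Defs.radius.
Variables (m s0 : R).
Hypotheses (hm : 0 <= m) (ms0 : 2 * m * s0 < 1).
Implicit Types (p v : V4) (y : V3).

(** The logarithmic derivative of det g, when y moves with velocity y' on the
    sphere and h with velocity h'. *)
Lemma trace_identity y (y' : V3) (h h' : R) : h != 0 ->
  dot y y = 1 -> dot y y' = 0 ->
  - h^-1 * - h' + \sum_(i < 3) \sum_(j < 3)
     (h * (y 0 i * y 0 j) + ((i == j)%:R - y 0 i * y 0 j)) *
     ((h^-1 - 1) * (y 0 j * y' 0 i + y 0 i * y' 0 j)
       + y 0 j * y 0 i * (- h ^- 2 * h')) = 0.
Proof.
move=> h0 y1 y0.
have -> : \sum_(i < 3) \sum_(j < 3)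
     (h * (y 0 i * y 0 j) + ((i == j)%:R - y 0 i * y 0 j)) *
     ((h^-1 - 1) * (y 0 j * y' 0 i + y 0 i * y' 0 j)
       + y 0 j * y 0 i * (- h ^- 2 * h')) =
   (h - 1) * ((h^-1 - 1) * (dot y y * dot y y' *+ 2) + dot y y ^+ 2 * (- h ^- 2 * h'))
   + (h^-1 - 1) * (dot y y' *+ 2) + dot y y * (- h ^- 2 * h').
  rewrite /dot !big_ord_recl !big_ord0 /=.
  by move: (- h ^- 2 * h') (h^-1) => a b; ring.
by rewrite y1 y0; field.
Qed.

Section AtPoint.
Variable p : V4.
Hypothesis Op : in_collar s0 p.

Let y := angle p.
Let s := (radius p)^-1.
Let h := hfun m (radius p).

Lemma is_derive_angle v i : is_derive p v (fun q => angle q 0 i)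
  (s * (xcoord v 0 i - dot y (xcoord v) * y 0 i)).
Proof.
have [x0 _] := Op.
exact: (is_derive_xcoord (is_derive_sph_coord (xcoord v) i x0)).
Qed.

Lemma is_derive_hfun v : exists h', is_derive p v (fun q => hfun m (radius q)) h'.
Proof.
have [x0 _] := Op.
have d := is_derive_xcoord (is_derive_enormV (xcoord v) x0).
rewrite (_ : (fun q => _) = (cst 1 - (2 * m) *: (fun q => (enorm (xcoord q))^-1)
  : V4 -> R))//.
by eexists; apply: is_deriveB; apply: is_deriveZ; exact: d.
Qed.

(** The radial eigenvalue 1 / h compensates the time component - h. *)
Lemma trace_Schwarzschild (c : 'I_(1 + 3)) :
  \sum_(a < 4) christoffel (gSch m) p a a c = 0.
Proof.
have h0 : h != 0 by rewrite gt_eqF// (hfun_gt0 hm ms0 Op).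
have Sy : S2 y := S2_angle Op.
have gV : invmx (gSch m p) = schwV h y.
  by rewrite [gSch m p](_ : _ = schw h y)// invmx_schw.
rewrite christoffel_trace; last by move=> a d; rewrite gV; exact: schwV_sym.
rewrite gV; apply/eqP; rewrite mulf_eq0; apply/orP; right; apply/eqP.
pose v : V4 := delta_mx 0 c.
have [h' dh] := is_derive_hfun v.
pose y' : V3 := s *: (xcoord v - dot y (xcoord v) *: y).
have yy' : dot y y' = 0.
  rewrite /y' dotZr dotDr -scaleNr dotZr (S2_dot Sy); ring.
have dy i : is_derive p v (fun q => angle q 0 i) (y' 0 i).
  by apply: is_derive_eq (is_derive_angle v i) _; rewrite !mxE.
rewrite -[RHS](trace_identity h' h0 (S2_dot Sy) yy').
rewrite !sum_time_space.
have eur i j : schwV h y (lshift 3 j) (rshift 1 i) = 0 by rewrite block_mxEur mxE.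
have edl i j : schwV h y (rshift 1 i) (lshift 3 j) = 0 by rewrite block_mxEdl mxE.
have eul j : schwV h y (lshift 3 j) (lshift 3 j) = - h^-1.
  by rewrite block_mxEul mxE eqxx mulr1n.
have entry (k : R) (z : V3) i j :
    (k *: (z^T *m z) + (1%:M - z^T *m z)) i j
    = k * (z 0 i * z 0 j) + ((i == j)%:R - z 0 i * z 0 j).
  by rewrite !mxE big_ord1 !mxE.
have edr i j : schwV h y (rshift 1 i) (rshift 1 j)
    = h * (y 0 i * y 0 j) + ((i == j)%:R - y 0 i * y 0 j).
  by rewrite block_mxEdr entry.
have gul : (fun q : V4 => gSch m q (lshift 3 ord0) (lshift 3 ord0))
    = - (fun q => hfun m (radius q)).
  by apply/funext => q; rewrite block_mxEul mxE eqxx mulr1n.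
have gdr i j : (fun q : V4 => gSch m q (rshift 1 j) (rshift 1 i))
    = ((fun q => (hfun m (radius q))^-1) - cst 1)
      * ((fun q => angle q 0 j) * (fun q => angle q 0 i)) + cst (i == j)%:R.
  apply/funext => q; rewrite block_mxEdr entry !fctE eq_sym.
  by move: (_^-1) (angle q 0 i) (angle q 0 j) => k u w; ring.
have D1 : partial c (fun q : V4 => gSch m q (lshift 3 ord0) (lshift 3 ord0)) p = - h'.
  by rewrite gul; have [_ E] := is_deriveN dh; exact: E.
have D2 i j : partial c (fun q : V4 => gSch m q (rshift 1 j) (rshift 1 i)) p
    = (h^-1 - 1) * (y 0 j * y' 0 i + y 0 i * y' 0 j) + y 0 j * y 0 i * (- h ^- 2 * h').
  rewrite gdr.
  have dV := is_derive_compR dh (is_derive_invR h0).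
  have d1 := is_deriveB dV (is_derive_cst (1 : R) p v).
  have d2 := is_deriveM (dy j) (dy i).
  have [_ E] := is_deriveD (is_deriveM d1 d2) (is_derive_cst ((i == j)%:R : R) p v).
  etransitivity; first exact: E.
  by rewrite subr0 addr0; exact: erefl.
have -> : \sum_(i < 3) schwV h y (lshift 3 ord0) (rshift 1 i)
    * partial c (fun q : V4 => gSch m q (rshift 1 i) (lshift 3 ord0)) p = 0.
  by apply: big1 => i _; rewrite eur mul0r.
rewrite addr0; congr (_ + _); first by rewrite eul D1.
apply: eq_bigr => i _; rewrite sum_time_space edl mul0r add0r.
by apply: eq_bigr => j _; rewrite edr D2.
Qed.

End AtPoint.
End SchwarzschildDivergence.

Section NormalComponents.
Context {R : realType}.
Local Notation V3 := 'rV[R]_3.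
Local Notation V4 := 'rV[R]_(1 + 3).
Local Notation radius := Defs.radius.
Variables (m s0 : R) (P : V3 -> R -> R).
Hypothesis CP : Ccollar 2 s0 P.
Implicit Types (p v : V4) (y x : V3).
Local Notation C k := (Ccollar k s0).

Lemma Ccollar_Lgraph k (Q : V3 -> R -> R) : C k.+1 Q -> C k (Lgraph m Q).
Proof.
move=> CQ; have Cs := Ccollar_ds CQ; apply: CcollarN; apply: CcollarD.
  apply: CcollarD; first exact: CcollarZ.
  apply: CcollarM; last exact: CcollarX.
  apply: CcollarM; first by apply: CcollarX; exact: Ccollar_s.
  apply: CcollarB; first exact: Ccollar_cst.
  by apply: CcollarZ; exact: Ccollar_s.
by apply: Ccollar_sum => i; apply: CcollarM; exact: Ccollar_tder.
Qed.

(** The component of the inverse conformal metric on (ds, ds). *)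
Definition gss : V3 -> R -> R := fun _ s => s ^+ 2 * (1 - 2 * m * s).
(** The component on d_s of the conformal gradient of F. *)
Definition grad_s : V3 -> R -> R := fun y s => 1 + gss y s * ds P y s.
(** The value of - g (grad F, grad F). *)
Definition normsq : V3 -> R -> R := fun y s => s ^+ 2 * Lgraph m P y s.
(** The i-th Cartesian component of - grad F. *)
Definition flux (i : 'I_3) : V3 -> R -> R :=
  fun y s => grad_s y s * y 0 i - s * tder i P y s.

Lemma Ccollar_gss k : C k gss.
Proof.
apply: CcollarM; first by apply: CcollarX; exact: Ccollar_s.
apply: CcollarB; first exact: Ccollar_cst.
by apply: CcollarZ; exact: Ccollar_s.
Qed.

Lemma Ccollar_grad_s : C 1 grad_s.
Proof.
apply: CcollarD; first exact: Ccollar_cst.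
by apply: CcollarM; [exact: Ccollar_gss|exact: Ccollar_ds].
Qed.

Lemma Ccollar_normsq : C 1 normsq.
Proof.
by apply: CcollarM; [apply: CcollarX; exact: Ccollar_s|exact: Ccollar_Lgraph].
Qed.

Lemma Ccollar_flux i : C 1 (flux i).
Proof.
apply: CcollarB; first by apply: CcollarM; [exact: Ccollar_grad_s|exact: Ccollar_coord].
by apply: CcollarM; [exact: Ccollar_s|exact: Ccollar_tder].
Qed.

Section AtPoint.
Variables (y : V3) (s : R).
Hypotheses (Sy : S2 y) (ss : 0 <= s < s0).

Lemma ds_sqr : ds (fun _ s => s ^+ 2) y s = 2 * s.
Proof.
rewrite [LHS](@dsM _ _ _ _ Sy ss (fun _ s => s) (fun _ s => s)); try exact: Ccollar_s.
by rewrite !(ds_id y ss); ring.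
Qed.

Lemma ds_aff (c : R) : ds (fun _ s => 1 - c * s) y s = - c.
Proof.
rewrite (_ : (fun _ s => _) = fun (_ : V3) s => 1 + (- c) * s); last first.
  by apply/funext => z; apply/funext => t; rewrite mulNr.
rewrite (dsD Sy ss); [|exact: Ccollar_cst|by apply: CcollarZ; exact: Ccollar_s].
rewrite (dsM Sy ss (Ccollar_cst _ _ _) (Ccollar_s _ _)) (ds_id y ss).
by rewrite !(ds_cst y ss); ring.
Qed.

Lemma ds_gss : ds gss y s = 2 * s - 6 * m * s ^+ 2.
Proof.
rewrite (dsM Sy ss); last 2 first.
- by apply: CcollarX; exact: Ccollar_s.
- by apply: CcollarB; [exact: Ccollar_cst|apply: CcollarZ; exact: Ccollar_s].
by rewrite ds_sqr ds_aff; ring.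
Qed.

Lemma ds_grad_s : ds grad_s y s
  = (2 * s - 6 * m * s ^+ 2) * ds P y s + gss y s * ds (ds P) y s.
Proof.
have Cs := Ccollar_ds CP.
rewrite (dsD Sy ss (Ccollar_cst _ _ _) (CcollarM (Ccollar_gss _) Cs)).
by rewrite (dsM Sy ss (Ccollar_gss _) Cs) ds_gss (ds_cst y ss); ring.
Qed.

Lemma ds_normsq : ds normsq y s = 2 * s * Lgraph m P y s + s ^+ 2 * ds (Lgraph m P) y s.
Proof.
rewrite (dsM Sy ss (CcollarX _ (Ccollar_s _ _)) (Ccollar_Lgraph CP)) ds_sqr.
by ring.
Qed.

Lemma ds_flux i : ds (flux i) y s
  = ds grad_s y s * y 0 i - tder i P y s - s * tder i (ds P) y s.
Proof.
have CT := Ccollar_tder i CP; have Cc := Ccollar_coord s0 1 i.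
rewrite (dsD Sy ss (CcollarM Ccollar_grad_s Cc) (CcollarN (CcollarM (Ccollar_s _ _) CT))).
rewrite (dsM Sy ss Ccollar_grad_s Cc) (ds_coord y ss).
have -> : ds (fun y s => - (s * tder i P y s)) y s =
   ds (fun y s => (-1) * (s * tder i P y s)) y s.
  by congr (ds _ y s); apply/funext => z; apply/funext => t; rewrite mulN1r.
rewrite (dsM Sy ss (Ccollar_cst _ _ _) (CcollarM (Ccollar_s _ _) CT)).
rewrite (dsM Sy ss (Ccollar_s _ _) CT) (ds_id y ss) (ds_cst y ss).
by rewrite (ds_tder _ CP Sy ss); ring.
Qed.

Lemma tder_normsq i : tder i normsq y s = s ^+ 2 * tder i (Lgraph m P) y s.
Proof.
rewrite (tderM Sy ss _ (CcollarX _ (Ccollar_s _ _)) (Ccollar_Lgraph CP)).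
by rewrite (tder_cst _ _ i (fun s => s ^+ 2)); ring.
Qed.

Lemma tder_grad_s i : tder i grad_s y s = gss y s * tder i (ds P) y s.
Proof.
have Cs := Ccollar_ds CP.
rewrite (tderD Sy ss _ (Ccollar_cst _ _ _) (CcollarM (Ccollar_gss _) Cs)).
rewrite (tderM Sy ss _ (Ccollar_gss _) Cs) (tder_cst _ _ i (fun s => s ^+ 2 * (1 - 2 * m * s))).
by rewrite (tder_cst _ _ i (fun=> 1)); ring.
Qed.

Lemma tder_flux i : tder i (flux i) y s
  = gss y s * tder i (ds P) y s * y 0 i + grad_s y s * (1 - y 0 i * y 0 i)
    - s * tder i (tder i P) y s.
Proof.
have CT := Ccollar_tder i CP; have Cc := Ccollar_coord s0 1 i.
rewrite (tderD Sy ss _ (CcollarM Ccollar_grad_s Cc) (CcollarN (CcollarM (Ccollar_s _ _) CT))).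
rewrite (tderM Sy ss _ Ccollar_grad_s Cc) (tder_coord _ Sy) tder_grad_s eqxx.
have -> : tder i (fun y s => - (s * tder i P y s)) y s =
   tder i (fun y s => (-1) * (s * tder i P y s)) y s.
  by congr (tder i _ y s); apply/funext => z; apply/funext => t; rewrite mulN1r.
rewrite (tderM Sy ss _ (Ccollar_cst _ _ _) (CcollarM (Ccollar_s _ _) CT)).
rewrite (tderM Sy ss _ (Ccollar_s _ _) CT) (tder_cst _ _ i id) (tder_cst _ _ i (fun=> -1)).
by rewrite /=; ring.
Qed.

End AtPoint.

End NormalComponents.

Section NormalDivergence.
Context {R : realType}.
Local Notation V3 := 'rV[R]_3.
Local Notation V4 := 'rV[R]_(1 + 3).
Local Notation radius := Defs.radius.
Variables (m s0 : R) (P : V3 -> R -> R).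
Hypotheses (hm : 0 <= m) (ms0 : 2 * m * s0 < 1).
Hypothesis CP : Ccollar 2 s0 P.
Implicit Types (p : V4) (y x v : V3).
Local Notation C k := (Ccollar k s0).
Local Notation W := (normsq m P).
Local Notation Y := (flux m P).

Lemma unit_normal_time p : in_collar s0 p ->
  unit_normal (gSch m) (Ffun m P) p 0 (@lshift 1 3 ord0)
  = (Num.sqrt (pull W (xcoord p)))^-1 * (hfun m (enorm (xcoord p)))^-1.
Proof.
move=> Op; rewrite /unit_normal (metric_gradient hm ms0 CP Op) opprK.
rewrite (gradient_Ffun hm ms0 CP Op) mxE.
rewrite (row_mxEl (n1 := 1) (n2 := 3)) mxE eqxx mulr1n mulrNN.
by [].
Qed.

Lemma unit_normal_space p i : in_collar s0 p ->
  unit_normal (gSch m) (Ffun m P) p 0 (rshift 1 i)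
  = (Num.sqrt (pull W (xcoord p)))^-1 * pull (Y i) (xcoord p).
Proof.
move=> Op; rewrite /unit_normal (metric_gradient hm ms0 CP Op) opprK.
rewrite (gradient_Ffun hm ms0 CP Op) mxE.
rewrite (row_mxEr (n1 := 1) (n2 := 3)).
rewrite mulNr -mulrN; congr (_ * _).
rewrite /conormal /pull /flux /grad_s /gss /tder /Defs.radius /angle.
rewrite /hfun; move: (sph _) (sgrad _ _) (ds P _ _) => z t d.
by rewrite !mxE; ring.
Qed.

Lemma is_derive_invsqrt (f : V3 -> R) x v (df : R) : 0 < f x ->
  is_derive x v f df ->
  is_derive x v (fun z => (Num.sqrt (f z))^-1)
    (- (Num.sqrt (f x))^-1 * (2 * f x)^-1 * df).
Proof.
move=> f0 d; have q0 : 0 < Num.sqrt (f x) by rewrite sqrtr_gt0.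
have d1 := is_derive_compR d (is_derive1_sqrt f0).
have d2 := is_derive_compR d1 (is_derive_invR (lt0r_neq0 q0)).
apply: is_derive_eq d2 _.
have E : f x = Num.sqrt (f x) ^+ 2 by rewrite sqr_sqrtr// ltW.
have -> : (2 * f x)^-1 = (2 * Num.sqrt (f x) ^+ 2)^-1 by rewrite -E.
move: q0; move: {E} (Num.sqrt _) => q q0; field.
by rewrite gt_eqF.
Qed.

Section AtPoint.
Variables (y : V3) (s : R).
Hypotheses (Sy : S2 y) (sgt0 : 0 < s) (slt : s < s0).
Local Notation L := (Lgraph m P).
Hypothesis L0 : 0 < L y s.
Let x := s^-1 *: y.
Let p := graph_pt m P y s.

Lemma xcoord_graph : xcoord p = x.
Proof. by rewrite /p /graph_pt /xcoord row_mxKr. Qed.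

Lemma enorm_graph : enorm x = s^-1.
Proof. by rewrite enormZ Sy mulr1 gtr0_norm ?invr_gt0. Qed.

Lemma sph_graph : sph x = y.
Proof. by rewrite sphZ// invr_gt0. Qed.

Lemma graph_neq0 : x != 0.
Proof. by rewrite -enorm_gt0 enorm_graph invr_gt0. Qed.

Lemma in_collar_graph : in_collar s0 p.
Proof.
by rewrite /in_collar /Defs.radius xcoord_graph enorm_graph invrK; split=> //; exact: graph_neq0.
Qed.

Lemma pull_graph f : pull f x = f y s.
Proof. by rewrite /pull sph_graph enorm_graph invrK. Qed.

Lemma is_derive_pull_graph f i : C 1 f -> is_derive x (delta_mx 0 i) (pull f)
  (s * tder i f y s - s ^+ 2 * y 0 i * ds f y s).
Proof.
move=> Cf; have xs : (enorm x)^-1 < s0 by rewrite enorm_graph invrK.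
apply: is_derive_eq (is_derive_pull (delta_mx 0 i) Cf graph_neq0 xs) _.
rewrite sph_graph enorm_graph invrK exprVn invrK.
rewrite (bigD1 i)//= big1 ?addr0 ?mxE ?eqxx ?mul1r// => j ji.
by rewrite mxE (negbTE ji) andbF mul0r.
Qed.

(** The surface, hence its normal, is moved to a level set of F by time
    translations: n does not depend on t. *)
Lemma partial_time :
  partial (@lshift 1 3 ord0) (fun q => unit_normal (gSch m) (Ffun m P) q 0 (@lshift 1 3 ord0)) p = 0.
Proof.
pose K (z : V3) := (Num.sqrt (pull W z))^-1 * (hfun m (enorm z))^-1.
have E : \forall q \near p, unit_normal (gSch m) (Ffun m P) q 0 (@lshift 1 3 ord0) = K (xcoord q).
  by apply: filterS (near_in_collar in_collar_graph) => q; exact: unit_normal_time.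
rewrite /partial (near_eq_derive _ E).
have d : is_derive (xcoord p) (xcoord (delta_mx 0 (@lshift 1 3 ord0))) K 0.
  by rewrite xcoord_lshift; exact: is_derive0.
by have [_ ->] := is_derive_xcoord d.
Qed.

Lemma partial_space i :
  partial (rshift 1 i) (fun q => unit_normal (gSch m) (Ffun m P) q 0 (rshift 1 i)) p
  = (Num.sqrt (W y s))^-1 * (s * tder i (Y i) y s - s ^+ 2 * y 0 i * ds (Y i) y s
     - (2 * W y s)^-1 * (Y i y s * (s * tder i W y s - s ^+ 2 * y 0 i * ds W y s))).
Proof.
pose K (z : V3) := (Num.sqrt (pull W z))^-1 * pull (Y i) z.
have E : \forall q \near p, unit_normal (gSch m) (Ffun m P) q 0 (rshift 1 i) = K (xcoord q).
  by apply: filterS (near_in_collar in_collar_graph) => q; exact: unit_normal_space.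
rewrite /partial (near_eq_derive _ E).
have W0 : 0 < pull W x by rewrite pull_graph mulr_gt0// exprn_gt0.
have dW := is_derive_pull_graph i (Ccollar_normsq m CP).
have dY := is_derive_pull_graph i (Ccollar_flux m CP i).
set d := (X in _ = X).
have dK : is_derive x (delta_mx 0 i) K d.
  apply: is_derive_eq (is_deriveM (is_derive_invsqrt W0 dW) dY) _.
  rewrite !pull_graph /d /GRing.scale /=.
  move: (tder i (Y i) y s) (ds (Y i) y s) (tder i W y s) (ds W y s) (Y i y s).
  by move: (Num.sqrt _)^-1 (2 * _)^-1 => a b c e f g k; ring.
have [_ H] : is_derive p (delta_mx 0 (rshift 1 i)) (fun q => K (xcoord q)) d.
  by apply: is_derive_xcoord; rewrite xcoord_graph xcoord_rshift; exact: dK.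
exact: H.
Qed.

End AtPoint.
End NormalDivergence.

Section CurvatureIdentity.
Context {R : realType}.
Local Notation V3 := 'rV[R]_3.
Local Notation V4 := 'rV[R]_(1 + 3).
Variables (m s0 : R) (P : V3 -> R -> R).
Hypotheses (hm : 0 <= m) (ms0 : 2 * m * s0 < 1).
Hypothesis CP : Ccollar 2 s0 P.
Implicit Types (y : V3).
Local Notation L := (Lgraph m P).
Local Notation G := (grad_s m P).

(** In the application z is the point y of the sphere and t, u, l are gradients:
    the sums against z vanish, except that of z itself, which is 1. *)
Lemma collect_divergence (z t u l q : 'I_3 -> R) (s a g dg w dw : R) :
  \sum_(i < 3) (s * (a * u i * z i + g * (1 - z i * z i) - s * q i)
    - s ^+ 2 * z i * (dg * z i - t i - s * u i)
    - w * ((g * z i - s * t i) * (s * (s ^+ 2 * l i) - s ^+ 2 * z i * dw)))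
  = s * (a * (\sum_(i < 3) z i * u i) + g * (3 - \sum_(i < 3) z i * z i)
       - s * \sum_(i < 3) q i)
    - s ^+ 2 * (dg * (\sum_(i < 3) z i * z i) - \sum_(i < 3) z i * t i
       - s * \sum_(i < 3) z i * u i)
    - w * (g * s ^+ 3 * (\sum_(i < 3) z i * l i)
       - g * s ^+ 2 * dw * (\sum_(i < 3) z i * z i)
       - s ^+ 4 * (\sum_(i < 3) l i * t i)
       + s ^+ 3 * dw * (\sum_(i < 3) z i * t i)).
Proof. by rewrite !big_ord_recl !big_ord0; ring. Qed.

(** The part of 3 H L^(3/2) that carries a factor s. *)
Definition curv_tail : V3 -> R -> R := fun y s =>
  - (L y s * ((2 * s - 6 * m * s ^+ 2) * ds P y s + gss m y s * ds (ds P) y s))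
  + 2^-1 * (G y s * ds L y s) - L y s * \sum_(i < 3) tder i (tder i P) y s
  + 2^-1 * \sum_(i < 3) tder i L y s * tder i P y s.

Lemma mean_curvatureE y s : S2 y -> 0 < s -> s < s0 -> 0 < L y s ->
  3 * mean_curvature m P y s * (L y s * Num.sqrt (L y s))
  = 3 * (L y s * G y s) + s * curv_tail y s.
Proof.
move=> Sy sgt0 slt L0; have ss : 0 <= s < s0 by rewrite slt ltW.
have C1P := CcollarW CP.
rewrite /mean_curvature divergence_unimodular; last first.
  move=> c; apply: (trace_Schwarzschild hm ms0).
  exact: in_collar_graph.
rewrite sum_time_space (partial_time hm ms0 CP Sy sgt0 slt) add0r.
under eq_bigr => i _ do rewrite (partial_space hm ms0 CP Sy sgt0 slt L0)
   (tder_flux m CP Sy ss) (ds_flux m CP Sy ss) (tder_normsq m CP Sy ss)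
   (ds_normsq m CP Sy ss).
rewrite -mulr_sumr.
rewrite (collect_divergence (fun i => y 0 i) (fun i => tder i P y s)
  (fun i => tder i (ds P) y s) (fun i => tder i L y s)
  (fun i => tder i (tder i P) y s)).
have -> : \sum_(i < 3) y 0 i * tder i (ds P) y s = 0.
  by apply: (sum_coord_tder Sy ss); exact: Ccollar_ds.
have -> : \sum_(i < 3) y 0 i * tder i P y s = 0 by exact: (sum_coord_tder Sy ss).
have -> : \sum_(i < 3) y 0 i * tder i L y s = 0.
  by apply: (sum_coord_tder Sy ss); exact: Ccollar_Lgraph.
have -> : \sum_(i < 3) y 0 i * y 0 i = 1 by exact: S2_dot.
rewrite (ds_grad_s m CP Sy ss) /curv_tail.
have -> : Num.sqrt (normsq m P y s) = s * Num.sqrt (L y s).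
  by rewrite /normsq sqrtrM ?sqr_ge0// sqrtr_sqr gtr0_norm.
have E : L y s = Num.sqrt (L y s) ^+ 2 by rewrite sqr_sqrtr// ltW.
have r0 : Num.sqrt (L y s) != 0 by rewrite gt_eqF// sqrtr_gt0.
rewrite /normsq.
move: (\sum_(i < 3) tder i (tder i P) y s) (\sum_(i < 3) tder i L y s * tder i P y s).
move: (ds L y s) (ds P y s) (ds (ds P) y s) (gss m y s) (G y s).
move: E r0; move: (L y s) (Num.sqrt _) => l r -> r0 a b c d e f g.
have sn0 : s != 0 by rewrite gt_eqF.
by field; rewrite r0 sn0.
Qed.

End CurvatureIdentity.

(** * The curvature equation order by order *)

Section CurvatureSeries.
Context {R : realType}.
Local Notation V3 := 'rV[R]_3.
Implicit Types (y : V3) (f P H : V3 -> R -> R).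

Definition ser f y : nat -> R := fun j => bdy j f y / j`!%:R.

Variables (m s0 : R).
Hypothesis s00 : 0 < s0.
Local Notation C k := (Ccollar k s0).
Local Notation L := (Lgraph m).

(** The sequences below are the coefficients of gss, of its derivative in s, of
    the constant 1, of L, of grad_s, of its derivative in s, of curv_tail and of
    the right-hand side of the curvature equation. *)
Definition gss_ser : nat -> R := fun k => ('X^2 - (2 * m) *: 'X^3 : {poly R})`_k.
Definition dgss_ser : nat -> R := fun k => (2 *: 'X - (6 * m) *: 'X^2 : {poly R})`_k.

Lemma jet_gss n y : jet n (gss m y) gss_ser.
Proof.
apply: jet_near (jet_poly n _); apply: nearW => s.
by rewrite /gss !hornerE /=; ring.
Qed.

Lemma jet_dgss n : jet n (fun s => 2 * s - 6 * m * s ^+ 2) dgss_ser.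
Proof.
apply: jet_near (jet_poly n _); apply: nearW => s.
by rewrite !hornerE /=; ring.
Qed.

Lemma jet_ser n f y : C n f -> S2 y -> jet n (f y) (ser f y).
Proof. by move=> Cf Sy; exact: jet_collar s00 Cf Sy. Qed.

Definition one_ser : nat -> R := fun k => if k is 0%N then 1 else 0.

Definition L_ser P y k := - (2 * ser (ds P) y k
  + cauchy_mul gss_ser (cauchy_mul (ser (ds P) y) (ser (ds P) y)) k
  + \sum_(i < 3) cauchy_mul (ser (tder i P) y) (ser (tder i P) y) k).

Lemma ser_Lgraph n P y k : C n.+1 P -> S2 y -> (k <= n)%N ->
  ser (L P) y k = L_ser P y k.
Proof.
move=> CP Sy; apply: (jet_unique (phi := L P y)).
  by apply: jet_ser => //; exact: Ccollar_Lgraph.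
have Jd : jet n (ds P y) (ser (ds P) y) by apply: jet_ser => //; exact: Ccollar_ds.
have Jt i : jet n (tder i P y) (ser (tder i P) y).
  by apply: jet_ser => //; exact: Ccollar_tder.
apply: jetN; apply: jetD; last by apply: jet_sum => i; exact: jetM (Jt i) (Jt i).
apply: jetD; first exact: jetZ.
exact: jetM (jet_gss _ _) (jetM Jd Jd).
Qed.

Definition grad_s_ser P y k := one_ser k + cauchy_mul gss_ser (ser (ds P) y) k.

Definition dgrad_s_ser P y k := cauchy_mul dgss_ser (ser (ds P) y) k
  + cauchy_mul gss_ser (ser (ds (ds P)) y) k.

Definition tail_ser P y k :=
  - cauchy_mul (ser (L P) y) (dgrad_s_ser P y) k
  + 2^-1 * cauchy_mul (grad_s_ser P y) (ser (ds (L P)) y) k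
  - cauchy_mul (ser (L P) y) (fun j => \sum_(i < 3) ser (tder i (tder i P)) y j) k
  + 2^-1 * \sum_(i < 3) cauchy_mul (ser (tder i (L P)) y) (ser (tder i P) y) k.

Definition curv_ser P y k :=
  3 * cauchy_mul (ser (L P) y) (grad_s_ser P y) k + shift1 (tail_ser P y) k.

Lemma jet_grad_s n P y : C n.+1 P -> S2 y -> jet n (grad_s m P y) (grad_s_ser P y).
Proof.
move=> CP Sy; apply: jetD; first exact: jet_cst.
by apply: jetM; [exact: jet_gss|apply: jet_ser => //; exact: Ccollar_ds].
Qed.

Lemma jet_curv_tail n P y : C n.+2 P -> S2 y -> jet n (curv_tail m P y) (tail_ser P y).
Proof.
move=> CP Sy; have C1 := CcollarW CP; have CL := Ccollar_Lgraph m CP.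
have JL : jet n (L P y) (ser (L P) y) by apply: jet_ser => //; exact: CcollarW.
apply: jetD; last first.
  apply: jetZ; apply: jet_sum => i.
  by apply: jetM; apply: jet_ser => //; exact: Ccollar_tder.
apply: jetD; last first.
  apply: jetN; apply: jetM => //; apply: jet_sum => i.
  by apply: jet_ser => //; do 2 apply: Ccollar_tder.
apply: jetD; last first.
  apply: jetZ; apply: jetM; first exact: jet_grad_s.
  by apply: jet_ser => //; exact: Ccollar_ds.
apply: jetN; apply: jetM => //; apply: jetD; apply: jetM.
- exact: jet_dgss.
- by apply: jet_ser => //; exact: Ccollar_ds.
- exact: jet_gss.
- by apply: jet_ser => //; do 2 apply: Ccollar_ds.
Qed.

(** The equation holds for s > 0, where P determines H; positivity of L is what
    the spacelike condition contributes. *)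
Definition prescribed P H := forall y s, S2 y -> 0 < s -> s < s0 ->
  0 < L P y s /\ 3 * H y s * (L P y s * Num.sqrt (L P y s))
                 = 3 * (L P y s * grad_s m P y s) + s * curv_tail m P y s.

Lemma curvature_series n P H y k : C n.+2 P -> C n.+1 H -> prescribed P H ->
  S2 y -> (k <= n.+1)%N ->
  9 * cauchy_mul (cauchy_mul (ser H y) (ser H y))
       (cauchy_mul (ser (L P) y) (cauchy_mul (ser (L P) y) (ser (L P) y))) k
  = cauchy_mul (curv_ser P y) (curv_ser P y) k.
Proof.
move=> CP CH PH Sy.
have JL : jet n.+1 (L P y) (ser (L P) y) by apply: jet_ser => //; exact: Ccollar_Lgraph.
have JH : jet n.+1 (H y) (ser H y) by exact: jet_ser.
have J1 := jetZ 9 (jetM (jetM JH JH) (jetM JL (jetM JL JL))).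
have Jr : jet n.+1 (fun s => 3 * (L P y s * grad_s m P y s) + s * curv_tail m P y s) (curv_ser P y).
  apply: jetD; first by apply: jetZ; apply: jetM => //; exact: jet_grad_s.
  by apply: jetS; exact: jet_curv_tail.
have J2 := jetM Jr Jr.
suff E : \forall s \near 0^'+, 9 * (H y s * H y s * (L P y s * (L P y s * L P y s)))
    = (3 * (L P y s * grad_s m P y s) + s * curv_tail m P y s)
      * (3 * (L P y s * grad_s m P y s) + s * curv_tail m P y s).
  exact: (jet_unique (jet_near E J1) J2).
near=> s.
have sgt0 : 0 < s by [].
have slt : s < s0 by near: s; exact: nbhs_right_lt.
have [L0 <-] := PH y s Sy sgt0 slt.
have E : L P y s = Num.sqrt (L P y s) ^+ 2 by rewrite sqr_sqrtr// ltW.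
by move: E; move: (L P y s) (Num.sqrt _) (H y s) => l r h ->; ring.
Unshelve. all: by end_near. Qed.

End CurvatureSeries.

Section LowOrders.
Context {R : realType}.
Local Notation V3 := 'rV[R]_3.
Implicit Types (y : V3) (f P H : V3 -> R -> R) (c d : nat -> R).

Lemma cauchy0 c d : cauchy_mul c d 0 = c 0%N * d 0%N.
Proof. by rewrite /cauchy_mul big_ord1. Qed.

Lemma cauchy1 c d : cauchy_mul c d 1 = c 0%N * d 1%N + c 1%N * d 0%N.
Proof. by rewrite /cauchy_mul !big_ord_recl big_ord0 /= addr0. Qed.

Lemma cauchy2 c d : cauchy_mul c d 2 = c 0%N * d 2%N + c 1%N * d 1%N + c 2%N * d 0%N.
Proof. by rewrite /cauchy_mul !big_ord_recl big_ord0 /= addr0 !addrA. Qed.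

Lemma cauchy3 c d : cauchy_mul c d 3
  = c 0%N * d 3%N + c 1%N * d 2%N + c 2%N * d 1%N + c 3%N * d 0%N.
Proof. by rewrite /cauchy_mul !big_ord_recl big_ord0 /= addr0 !addrA. Qed.

Definition cauchyE := (cauchy0, cauchy1, cauchy2, cauchy3).

Lemma ser0 f y : ser f y 0 = bdy 0 f y. Proof. by rewrite /ser divr1. Qed.
Lemma ser1 f y : ser f y 1 = bdy 1 f y. Proof. by rewrite /ser divr1. Qed.
Lemma ser2 f y : ser f y 2 = bdy 2 f y / 2. Proof. by []. Qed.
Lemma ser3 f y : ser f y 3 = bdy 3 f y / 6. Proof. by []. Qed.

Lemma factE : ((0`! = 1%N) * (1`! = 1%N) * (2`! = 2%N) * (3`! = 6%N))%type.
Proof. by []. Qed.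

Definition serE := (ser0, ser1, ser2, ser3).

Variables (m s0 : R).
Hypothesis s00 : 0 < s0.
Local Notation C k := (Ccollar k s0).
Local Notation L := (Lgraph m).

Lemma gss_serE : ((gss_ser m 0 = 0) * (gss_ser m 1 = 0) * (gss_ser m 2 = 1)
  * (gss_ser m 3 = - (2 * m)))%type.
Proof. by rewrite /gss_ser !coefE /=; do !split; ring. Qed.

Lemma dgss_serE : ((dgss_ser m 0 = 0) * (dgss_ser m 1 = 2) * (dgss_ser m 2 = - (6 * m)))%type.
Proof. by rewrite /dgss_ser !coefE /=; do !split; ring. Qed.

Section AtPoint.
Variables (P H : V3 -> R -> R) (y : V3).
Hypotheses (CP : C 4 P) (CH : C 4 H) (PH : prescribed m s0 P H) (Sy : S2 y).

Local Notation p j := (bdy j P y).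
Local Notation l j := (bdy j (L P) y).
Local Notation h j := (bdy j H y).
Local Notation D j := (slap (bdy j P) y).
Local Notation dPP j k := (dot (sgrad (bdy j P) y) (sgrad (bdy k P) y)).
Local Notation dLP j k := (dot (sgrad (bdy j (L P)) y) (sgrad (bdy k P) y)).

Lemma ser_tder f i j : C j.+1 f -> ser (tder i f) y j = sgrad (bdy j f) y 0 i / j`!%:R.
Proof. by move=> Cf; rewrite /ser (bdy_tder _ s00). Qed.

Lemma sum_ser_tder f g j k : C j.+1 f -> C k.+1 g ->
  \sum_(i < 3) ser (tder i f) y j * ser (tder i g) y k
  = dot (sgrad (bdy j f) y) (sgrad (bdy k g) y) / (j`!%:R * k`!%:R).
Proof.
move=> Cf Cg; rewrite /dot mulr_suml; apply: eq_bigr => i _.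
by rewrite !ser_tder// invfM mulrACA.
Qed.

Lemma sum_ser_tder2 f j : C j.+2 f ->
  \sum_(i < 3) ser (tder i (tder i f)) y j = slap (bdy j f) y / j`!%:R.
Proof.
move=> Cf; rewrite /slap /sdiv mulr_suml; apply: eq_bigr => i _.
by rewrite /ser (bdy_tder2 _ _ s00)// mxE.
Qed.

Let CL : C 3 (L P). Proof. exact: Ccollar_Lgraph. Qed.
Let C1P : C 1 P. Proof. exact: Ccollar_le CP. Qed.
Let C2P : C 2 P. Proof. exact: Ccollar_le CP. Qed.
Let C3P : C 3 P. Proof. exact: Ccollar_le CP. Qed.
Let C1L : C 1 (L P). Proof. exact: Ccollar_le CL. Qed.
Let C2L : C 2 (L P). Proof. exact: Ccollar_le CL. Qed.

Lemma L_order0 : l 0 = - (2 * p 1 + dPP 0 0).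
Proof.
have := ser_Lgraph m s00 CP Sy (isT : (0 <= 3)%N).
rewrite /L_ser !cauchyE !serE !gss_serE !bdyS => ->.
under eq_bigr do rewrite cauchy0.
by rewrite (sum_ser_tder C1P C1P) factE; field.
Qed.

Lemma L_order1 : l 1 = - (2 * p 2 + 2 * dPP 0 1).
Proof.
have := ser_Lgraph m s00 CP Sy (isT : (1 <= 3)%N).
rewrite /L_ser !cauchyE !serE !gss_serE !bdyS => ->.
under eq_bigr do rewrite cauchy1.
rewrite big_split /= (sum_ser_tder C1P C2P) (sum_ser_tder C2P C1P).
rewrite (dotC (sgrad (bdy 1 P) y)) !factE.
by move: (dPP 0 1) => a; field.
Qed.

Lemma L_order2 : l 2 = - (2 * p 3 + 2 * p 1 ^+ 2 + 2 * dPP 0 2 + 2 * dPP 1 1).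
Proof.
have := ser_Lgraph m s00 CP Sy (isT : (2 <= 3)%N).
rewrite /L_ser !cauchyE !serE !gss_serE !bdyS.
under eq_bigr do rewrite cauchy2.
rewrite !big_split /= (sum_ser_tder C1P C3P) (sum_ser_tder C3P C1P).
rewrite (sum_ser_tder C2P C2P) (dotC (sgrad (bdy 2 P) y)) !factE.
move: (dPP 0 2) (dPP 1 1) (l 2) (p 3) (p 2) (p 1) => a b c d e f E.
have -> : c = 2 * (c / 2) by field.
by rewrite E; field.
Qed.

Lemma grad_s_serE : ((grad_s_ser m P y 0 = 1) * (grad_s_ser m P y 1 = 0) * (grad_s_ser m P y 2 = p 1)
  * (grad_s_ser m P y 3 = p 2 - 2 * m * p 1))%type.
Proof.
rewrite /grad_s_ser /one_ser !cauchyE !serE !gss_serE !bdyS.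
move: (p 1) (p 2) (p 3) (p 4) => a b c d; by do !split; field.
Qed.

Lemma dgrad_s_serE : ((dgrad_s_ser m P y 0 = 0) * (dgrad_s_ser m P y 1 = (2 * p 1)%R)
  * (dgrad_s_ser m P y 2 = (3 * p 2 - 6 * m * p 1)%R))%type.
Proof.
rewrite /dgrad_s_ser !cauchyE !serE !gss_serE !dgss_serE !bdyS.
move: (p 1) (p 2) (p 3) (p 4) => a b c d; by do !split; field.
Qed.

Lemma tail_ser0 : tail_ser m P y 0 = 2^-1 * l 1 - l 0 * D 0 + 2^-1 * dLP 0 0.
Proof.
rewrite /tail_ser !cauchyE !serE !grad_s_serE !dgrad_s_serE !bdyS (sum_ser_tder2 C2P).
under eq_bigr do rewrite cauchy0.
rewrite (sum_ser_tder C1L C1P) !factE.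
by move: (D 0) (dLP 0 0) => a b; field.
Qed.

Lemma tail_ser1 : tail_ser m P y 1 = - (2 * l 0 * p 1) + 2^-1 * l 2
  - (l 0 * D 1 + l 1 * D 0) + 2^-1 * (dLP 0 1 + dLP 1 0).
Proof.
rewrite /tail_ser !cauchyE !serE !grad_s_serE !dgrad_s_serE !bdyS.
rewrite (sum_ser_tder2 C2P) (sum_ser_tder2 C3P).
under eq_bigr do rewrite cauchy1.
rewrite big_split /= (sum_ser_tder C1L C2P) (sum_ser_tder C2L C1P) !factE.
by move: (D 0) (D 1) (dLP 0 1) (dLP 1 0) => a b c d; field.
Qed.

Lemma tail_ser2 : tail_ser m P y 2 =
  - (l 0 * (3 * p 2 - 6 * m * p 1) + 2 * l 1 * p 1)
  + 2^-1 * (l 3 / 2 + p 1 * l 1)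
  - (l 0 * D 2 / 2 + l 1 * D 1 + l 2 * D 0 / 2)
  + 2^-1 * (dLP 0 2 / 2 + dLP 1 1 + dLP 2 0 / 2).
Proof.
rewrite /tail_ser !cauchyE !serE !grad_s_serE !dgrad_s_serE !bdyS.
rewrite (sum_ser_tder2 C2P) (sum_ser_tder2 C3P) (sum_ser_tder2 CP).
under eq_bigr do rewrite cauchy2.
rewrite !big_split /= (sum_ser_tder C1L C3P) (sum_ser_tder C2L C2P) (sum_ser_tder CL C1P) !factE.
move: (D 0) (D 1) (D 2) (dLP 0 2) (dLP 1 1) (dLP 2 0) => a b c d e f.
by move: (l 0) (l 1) (l 2) (l 3) (p 1) (p 2) => u v w x z t; field.
Qed.

Lemma curv_serE : ((curv_ser m P y 0 = (3 * l 0)%R)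
  * (curv_ser m P y 1 = (3 * l 1 + tail_ser m P y 0)%R)
  * (curv_ser m P y 2 = (3 * (l 2 / 2 + l 0 * p 1) + tail_ser m P y 1)%R)
  * (curv_ser m P y 3 = (3 * (l 3 / 6 + l 1 * p 1 + l 0 * (p 2 - 2 * m * p 1))
                    + tail_ser m P y 2)%R))%type.
Proof.
rewrite /curv_ser /= !cauchyE !serE !grad_s_serE.
move: (l 0) (l 1) (l 2) (l 3) (p 1) (p 2) (tail_ser m P y 0) (tail_ser m P y 1) (tail_ser m P y 2).
by move=> a b c d e f u v w; do !split; field.
Qed.

Lemma curvature_order0 : l 0 ^+ 2 * (h 0 ^+ 2 * l 0 - 1) = 0.
Proof.
have := curvature_series s00 CP (Ccollar_le (isT : (3 <= 4)%N) CH) PH Sy (isT : (0 <= 3)%N).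
rewrite !cauchyE !serE !curv_serE.
move: (l 0) (h 0) => a b E.
have -> : a ^+ 2 * (b ^+ 2 * a - 1)
  = 9^-1 * (9 * (b * b * (a * (a * a))) - 3 * a * (3 * a)) by field.
by rewrite E subrr mulr0.
Qed.

Hypotheses (h0 : 0 < h 0) (branch : l 0 = h 0 ^- 2).

(** Here and below, the equation is divided by the coefficient of the unknown,
    6 h_0^-2 for l 1 and 3/2 h_0^-2 for l 2. *)
Lemma curvature_order1 : l 1 = - (3 * h 0 ^- 3 * h 1) - h 0 ^- 2 * D 0 + 2^-1 * dLP 0 0.
Proof.
have := curvature_series s00 CP (Ccollar_le (isT : (3 <= 4)%N) CH) PH Sy (isT : (1 <= 3)%N).
rewrite !cauchyE !serE !curv_serE tail_ser0 branch.
have hn : h 0 != 0 by rewrite gt_eqF.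
move: hn; move: (l 1) (h 0) (h 1) (D 0) (dLP 0 0) => a b c d e bn E.
apply/eqP; rewrite -subr_eq0; apply/eqP.
move/eqP: E; rewrite -subr_eq0 => /eqP E.
have := congr1 (fun x => b ^+ 2 / 6 * x) E; rewrite [RHS]mulr0 => <-.
by field.
Qed.

Lemma curvature_order2 : h 1 = 0 -> l 2 = - (6 * h 0 ^- 3 * h 2) - 9 / 2 * h 0 ^+ 2 * l 1 ^+ 2
  - 4 * (l 1 * D 0 + l 0 * D 1) + 2 * dLP 1 0 + 2 * dLP 0 1 + 4 * h 0 ^- 2 * p 1.
Proof.
move=> h1; have E1 := curvature_order1.
have := curvature_series s00 CP (Ccollar_le (isT : (3 <= 4)%N) CH) PH Sy (isT : (2 <= 3)%N).
rewrite !cauchyE !serE !curv_serE tail_ser0 tail_ser1 branch; move: E1; rewrite h1.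
have hn : h 0 != 0 by rewrite gt_eqF.
move: hn; move: (l 1) (l 2) (h 0) (h 2) (p 1) (D 0) (D 1).
move: (dLP 0 0) (dLP 0 1) (dLP 1 0) => x00 x01 x10 l1 l2 b h2 p1 d0 d1 bn E1 E.
have Ex : x00 = 2 * (l1 + b ^- 2 * d0) by rewrite E1; field.
move: E; rewrite {}Ex => E.
apply/eqP; rewrite -subr_eq0; apply/eqP.
move/eqP: E; rewrite -subr_eq0 => /eqP E.
have := congr1 (fun x => b ^+ 2 * 2 / 3 * x) E; rewrite [RHS]mulr0 => <-.
by field.
Qed.

(** The terms in l 3 cancel.  The equations of order 1 and 2 are used to eliminate
    <grad L_0, grad P_0> and <grad L_1, grad P_0>, in which they are linear. *)
Lemma curvature_order3 : h 1 = 0 -> h 2 = 0 ->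
  0 = - 2 * h 0 ^- 3 * h 3 - 9 / 2 * h 0 ^+ 2 * l 1 * l 2
    + 3 / 4 * h 0 ^+ 4 * l 1 ^+ 3 + 6 * l 1 * p 1
    - 2 * l 2 * D 0 - 4 * l 1 * D 1 - 2 * h 0 ^- 2 * D 2
    + dLP 2 0 + 2 * dLP 1 1 + dLP 0 2.
Proof.
move=> h1 h2; have E1 := curvature_order1; have E2 := curvature_order2 h1.
have := curvature_series s00 CP (Ccollar_le (isT : (3 <= 4)%N) CH) PH Sy (isT : (3 <= 3)%N).
rewrite !cauchyE !serE !curv_serE tail_ser0 tail_ser1 tail_ser2.
move: E1 E2; rewrite branch h1 h2.
have hn : h 0 != 0 by rewrite gt_eqF.
move: hn; move: (l 1) (l 2) (l 3) (h 0) (h 3) (p 1) (p 2) (D 0) (D 1) (D 2).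
move: (dLP 0 0) (dLP 0 1) (dLP 1 0) (dLP 0 2) (dLP 1 1) (dLP 2 0).
move=> x00 x01 x10 x02 x11 x20 l1 l2 l3 b h3 p1 p2 d0 d1 d2 bn E1 E2 E.
have Ex : x00 = 2 * (l1 + b ^- 2 * d0) by rewrite E1; field.
have Ey : x10 = 2^-1 * (l2 + 9 / 2 * b ^+ 2 * l1 ^+ 2 + 4 * (l1 * d0 + b ^- 2 * d1)
    - 2 * x01 - 4 * b ^- 2 * p1) by rewrite E2; field.
move: E; rewrite {}Ex {}Ey => E.
move/eqP: E; rewrite -subr_eq0 => /eqP E.
apply/esym; have := congr1 (fun x => - (b ^+ 2 * 2 / 3) * x) E; rewrite [RHS]mulr0 => <-.
by field.
Qed.

End AtPoint.
End LowOrders.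

(** * The boundary values of spacelike graphs *)

Section Surfaces.
Context {R : realType}.
Local Notation V3 := 'rV[R]_3.
Implicit Types (y : V3) (f P H : V3 -> R -> R).
Variables (m s0 : R).
Hypothesis hm : 0 <= m.
Local Notation C k := (Ccollar k s0).
Local Notation L := (Lgraph m).

Lemma surface_collar k P H : surface (Ck k) m s0 P H -> C k P /\ C k H.
Proof.
case=> _ _ _ _ _ _ [U [fe [oU AU cU fE]]] [U' [ge [oU' AU' cU' gE]]].
have sub : collar s0 `<=` [set q : V3 * R | S2 q.1 /\ 0 <= q.2 <= s0].
  by move=> q [Sq /andP[q0 /ltW q1]]; split=> //; rewrite q0 q1.
split; [exists U, fe|exists U', ge]; split => //.
- exact: subset_trans AU.
- by move=> q; rewrite inE => Aq; apply: fE; rewrite inE; exact: sub.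
- exact: subset_trans AU'.
- by move=> q; rewrite inE => Aq; apply: gE; rewrite inE; exact: sub.
Qed.

Lemma surface_Cinfty k P H : surface Cinfty m s0 P H -> surface (Ck k) m s0 P H.
Proof.
case=> h1 h2 h3 h4 h5 h6 [U [fe [oU AU cU fE]]] [U' [ge [oU' AU' cU' gE]]].
by split=> //; [exists U, fe|exists U', ge]; split => //.
Qed.

Lemma surface_prescribed reg P H : surface reg m s0 P H -> C 2 P ->
  prescribed m s0 P H.
Proof.
case=> s00 ms0 _ sp HE _ _ _ CP y s Sy sgt0 slt.
have ss : 0 < s < s0 by rewrite sgt0.
have L0 : 0 < L P y s.
  have Op := in_collar_graph m P Sy sgt0 slt.
  have := Lgraph_gt0 hm ms0 CP Op (sp y s Sy ss).
  rewrite /angle /Defs.radius (xcoord_graph m P y s).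
  by rewrite sph_graph// (enorm_graph Sy sgt0) invrK.
by split=> //; rewrite HE// (mean_curvatureE hm ms0 CP Sy sgt0 slt L0).
Qed.

Lemma bdy_remainder j H y : bdy j.+1 (fun y s => H y s - H y 0) y = bdy j.+1 H y.
Proof.
rewrite -!bdyS; congr (bdy j _ y); apply/funext => z; apply/funext => s.
have E : (fun h => h^-1 * (H z (s + h) - H z 0 - (H z s - H z 0)))
    = (fun h => h^-1 * (H z (s + h) - H z s)).
  by apply/funext => h; rewrite opprB addrA subrK.
by rewrite /ds E.
Qed.

Lemma bigO2P H : bigO_s 2 (fun y s => H y s - H y 0) <->
  (forall y, S2 y -> bdy 1 H y = 0).
Proof.
split=> [h y Sy|h [|[|//]] _ y Sy]; first by rewrite -bdy_remainder; exact: (h 1%N).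
  by rewrite /bdy /= subrr.
by rewrite bdy_remainder h.
Qed.

Lemma bigO3P H : bigO_s 3 (fun y s => H y s - H y 0) <->
  (forall y, S2 y -> bdy 1 H y = 0 /\ bdy 2 H y = 0).
Proof.
split=> [h y Sy|h [|[|[|//]]] _ y Sy].
- by split; rewrite -bdy_remainder; [exact: (h 1%N)|exact: (h 2%N)].
- by rewrite /bdy /= subrr.
- by rewrite bdy_remainder; have [] := h y Sy.
- by rewrite bdy_remainder; have [] := h y Sy.
Qed.

Section Branch.
Variables (P H : V3 -> R -> R).
Hypotheses (s00 : 0 < s0) (CP : C 4 P) (CH : C 4 H).
Hypothesis Hgt0 : forall y, S2 y -> 0 < bdy 0 H y.
Hypothesis branch : forall y, S2 y -> bdy 0 (L P) y = (bdy 0 H y) ^- 2.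

Let ss0 : (0 : R) <= 0 < s0. Proof. by rewrite lexx. Qed.
Let CL : C 3 (L P). Proof. exact: Ccollar_Lgraph. Qed.
Let C1L : C 1 (L P). Proof. exact: Ccollar_le CL. Qed.
Let C1H : C 1 H. Proof. exact: Ccollar_le CH. Qed.
Let C2P : C 2 P. Proof. exact: Ccollar_le CP. Qed.

(** Differentiate L_0 H_0^2 = 1 along the sphere. *)
Lemma sgrad_L0 y i : S2 y ->
  sgrad (bdy 0 (L P)) y 0 i = - 2 * (bdy 0 H y) ^- 3 * sgrad (bdy 0 H) y 0 i.
Proof.
move=> Sy; have h0 := Hgt0 Sy; have hn : bdy 0 H y != 0 by rewrite gt_eqF.
have E : tder i (fun z s => L P z s * (H z s * H z s)) y 0 = 0.
  rewrite -[RHS](tder_cst y 0 i (fun=> 1)); apply: tder_congr => // z Sz.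
  have hz := Hgt0 Sz; have := branch Sz; rewrite /bdy /= => ->.
  by rewrite -expr2 mulVf// expf_neq0// gt_eqF.
rewrite (tderM Sy ss0 i C1L (CcollarM C1H C1H)) (tderM Sy ss0 i C1H C1H) in E.
have Lb : L P y 0 = (bdy 0 H y) ^- 2 by rewrite -(branch Sy).
have -> : sgrad (bdy 0 (L P)) y 0 i = tder i (L P) y 0 by [].
have Hb : H y 0 = bdy 0 H y by [].
have Tb : tder i H y 0 = sgrad (bdy 0 H) y 0 i by [].
rewrite Lb Hb Tb in E.
move: E hn; move: (tder i (L P) y 0) (bdy 0 H y) (sgrad (bdy 0 H) y 0 i) => a b c E bn.
apply/eqP; rewrite -subr_eq0; apply/eqP.
have -> : a - - 2 * b ^- 3 * c = b ^- 2 * (b ^- 2 * (b * c + b * c) + b * b * a) by field.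
by rewrite E mulr0.
Qed.

Lemma sgrad_H0m2 y (v : V3) : S2 y ->
  dot (sgrad (fun z => (bdy 0 H z) ^- 2) y) v = dot (sgrad (bdy 0 (L P)) y) v.
Proof.
move=> Sy; apply: eq_bigr => i _; congr (_ * _).
by apply: sgrad_congr => // z Sz; rewrite branch.
Qed.

Lemma dot_sgrad_L0 y (v : V3) : S2 y ->
  dot (sgrad (bdy 0 (L P)) y) v
  = - 2 * (bdy 0 H y) ^- 3 * dot (sgrad (bdy 0 H) y) v.
Proof.
move=> Sy; rewrite /dot mulr_sumr; apply: eq_bigr => i _.
by rewrite sgrad_L0// mulrA.
Qed.

(** At s = 0 the definition of L reads P_s = - (L + |grad P|^2) / 2. *)
Lemma sgrad_P1 y i : S2 y ->
  sgrad (bdy 1 P) y 0 i = - 2^-1 * (sgrad (bdy 0 (L P)) y 0 i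
    + sgrad (fun z => dot (sgrad (bdy 0 P) z) (sgrad (bdy 0 P) z)) y 0 i).
Proof.
move=> Sy; pose N (z : V3) s := \sum_(j < 3) tder j P z s * tder j P z s.
have CN : C 1 N.
  by apply: Ccollar_sum => j; apply: CcollarM; exact: Ccollar_tder.
have -> : sgrad (bdy 1 P) y 0 i = tder i (fun z s => - 2^-1 * (L P z s + N z s)) y 0.
  apply: sgrad_congr => // z Sz; rewrite /bdy /= /Lgraph /N.
  rewrite -/(dot (sgrad (P^~ 0) z) (sgrad (P^~ 0) z)).
  by rewrite expr0n /=; move: (ds P z 0) (dot _ _) => a b; field.
rewrite (tderM Sy ss0 i (Ccollar_cst _ _ _) (CcollarD C1L CN)).
rewrite (tderD Sy ss0 i C1L CN) (tder_cst y 0 i (fun=> - 2^-1)) mulr0 addr0.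
by [].
Qed.

End Branch.
End Surfaces.

Section BoundaryExpansion.
Context {R : realType}.
Local Notation V3 := 'rV[R]_3.
Variables (m s0 : R) (P H : V3 -> R -> R).
Hypothesis hm : 0 <= m.
Hypothesis S : surface (Ck 4) m s0 P H.
Implicit Types (y z : V3).
Local Notation C k := (Ccollar k s0).
Local Notation L := (Lgraph m P).

Let s00 : 0 < s0. Proof. by case: S. Qed.
Let CP : C 4 P. Proof. by have [] := surface_collar S. Qed.
Let CH : C 4 H. Proof. by have [] := surface_collar S. Qed.
Let PH : prescribed m s0 P H.
Proof. by apply: surface_prescribed S _ => //; exact: Ccollar_le CP. Qed.
Let Hgt0 y : S2 y -> 0 < bdy 0 H y.
Proof. by case: S => _ _ _ _ _ h _ _ Sy; apply: h; rewrite ?lexx. Qed.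

Lemma L0_dichotomy y : S2 y ->
  bdy 0 L y = 0 \/ bdy 0 L y * bdy 0 H y ^+ 2 = 1.
Proof.
move=> Sy; have /eqP := curvature_order0 s00 CP CH PH Sy.
rewrite mulf_eq0 sqrf_eq0 subr_eq0 => /orP[/eqP ->|/eqP E]; [by left|right].
by rewrite mulrC.
Qed.

Lemma continuous_bdy (f : V3 -> R -> R) k (gam : R -> V3) t : C k f ->
  {for t, continuous gam} -> gam t != 0 ->
  {for t, continuous (fun r => f (sph (gam r)) 0)}.
Proof.
move=> [U [fe [oU AU cU fE]]] cg g0.
have A0 z : z != 0 -> collar s0 (sph z, 0).
  by move=> z0; split; [exact: S2_sph|rewrite /= lexx].
have E : \forall r \near t, fe (sph (gam r), 0) = f (sph (gam r)) 0.
  have ng : \forall r \near t, gam r != 0 by exact: (cg _ (near_neq0 g0)).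
  apply: filterS ng => r r0.
  by rewrite -(fE (sph (gam r), 0))// inE; exact: A0.
have c : {for t, continuous (fun r => fe (sph (gam r), 0))}.
  apply: (@continuous_comp _ _ _ gam (fun z => fe (sph z, 0))) => //.
  apply: (@continuous_comp _ _ _ (fun z : V3 => (sph z, 0 : R)) fe).
    apply: differentiable_continuous; apply: differentiable_pair => //.
    exact: differentiable_sph.
  by apply: (Ck_continuous cU); apply: AU; exact: A0.
rewrite /prop_for/continuous_at -(nbhs_singleton E).
by apply: cvg_trans c; exact: near_eq_cvg.
Qed.

(** The arc is the radial projection of the segment from y to z, which avoids the
    origin when z is not the antipode of y; along it, a jump from 0 to 1 would go
    through 1/2. *)
Lemma two_valued_arc f y z : C 0 f ->
  (forall w, S2 w -> f w 0 = 0 \/ f w 0 = 1) ->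
  S2 y -> S2 z -> y + z != 0 -> f y 0 = f z 0.
Proof.
move=> Cf f01 Sy Sz yz.
pose gam (t : R) : V3 := y + t *: (z - y).
have gam0 t : t \in `[0, 1] -> gam t != 0.
  rewrite in_itv /= => /andP[t0 t1]; apply/eqP => g0.
  have E : (1 - t) *: y = - t *: z.
    apply/eqP; rewrite -subr_eq0 scaleNr opprK; apply/eqP.
    by rewrite -g0 /gam; apply/rowP => i; rewrite !mxE; ring.
  have := congr1 (@enorm R) E; rewrite !enormZ Sy Sz !mulr1 normrN.
  rewrite !ger0_norm ?subr_ge0// => tt.
  (* y and z have the same length, so the origin could only be the midpoint *)
  have th : t = 2^-1 by lra.
  move: yz; rewrite -[y + z](scale1r (y + z)) => /negP; apply.
  have -> : (1 : R) *: (y + z) = 2 *: ((1 - t) *: y + t *: z).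
    by rewrite th; apply/rowP => i; rewrite !mxE; field.
  by rewrite E scaleNr addNr scaler0.
have cgam t : {for t, continuous gam}.
  by apply: continuousD; [exact: cst_continuous|exact: scalel_continuous].
pose g (t : R) := f (sph (gam t)) 0.
have cg : {within `[0, 1], continuous g}.
  apply: continuous_in_subspaceT => t; rewrite inE => tt.
  by apply: continuous_bdy Cf _ _ => //; exact: gam0.
have g0E : g 0 = f y 0 by rewrite /g /gam scale0r addr0 sph_S2.
have g1E : g 1 = f z 0 by rewrite /g /gam scale1r addrCA subrr addr0 sph_S2.
have noh t : t \in `[0, 1] -> g t != 2^-1.
  move=> /gam0 t0; apply/eqP => E; have [] := f01 _ (S2_sph t0); rewrite -/(g t) E; lra.
have ivt := IVT (ler01) cg.
have no : ~ (Num.min (g 0) (g 1) <= 2^-1 <= Num.max (g 0) (g 1)).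
  by move=> /ivt[c c01 E]; have := noh c c01; rewrite E eqxx.
rewrite -g0E -g1E; move: no; rewrite g0E g1E.
case: (f01 y Sy) => ->; case: (f01 z Sz) => -> // h; exfalso; apply: h.
  by rewrite minEle maxEle ler01; apply/andP; split; lra.
by rewrite minEle maxEle ler10 ; apply/andP; split; lra.
Qed.

(** Antipodal points are joined through a third point, chosen among the first two
    basis vectors. *)
Lemma two_valued_sphere f y z : C 0 f ->
  (forall w, S2 w -> f w 0 = 0 \/ f w 0 = 1) ->
  S2 y -> S2 z -> f y 0 = f z 0.
Proof.
move=> Cf f01 Sy Sz; have [yz|yz] := eqVneq (y + z) 0; last exact: two_valued_arc yz.
have yE : z = - y by apply/eqP; rewrite -addr_eq0 addrC yz.
have Se i : S2 (delta_mx 0 i : V3).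
  by rewrite /S2 /= /enorm dot_delta mxE !eqxx sqrtr1.
have [w [Sw [wy wz]]] : exists w, S2 w /\ (y + w != 0 /\ w + z != 0).
  pose e (i : 'I_3) : V3 := delta_mx 0 i.
  have dy : dot y y = 1 by exact: S2_dot.
  have [y0|y0] := boolP ((y 0 ord0) ^+ 2 == 1); [exists (e (lift ord0 ord0))|exists (e ord0)].
    have : y 0 (lift ord0 ord0) = 0.
      move: dy; rewrite /dot !big_ord_recl big_ord0 -!expr2 (eqP y0) => E.
      have := sqr_ge0 (y 0 (lift ord0 (lift ord0 ord0))) => h1.
      have := sqr_ge0 (y 0 (lift ord0 ord0)) => h2.
      by apply/eqP; rewrite -sqrf_eq0; apply/eqP; lra.
    move=> y1; split; first exact: Se.
    by split; apply/eqP => /rowP /(_ (lift ord0 ord0)); rewrite ?yE !mxE y1 /=; lra.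
  split; first exact: Se.
  by split; apply/eqP => /rowP /(_ ord0); rewrite ?yE !mxE /= => E;
    move: y0 => /negP; apply; apply/eqP; rewrite expr2; nra.
exact: etrans (two_valued_arc Cf f01 Sy Sw wy) (two_valued_arc Cf f01 Sw Sz wz).
Qed.

Lemma boundary_dichotomy : (forall y, S2 y -> bdy 0 L y = 0) \/
  (forall y, S2 y -> bdy 0 L y = (bdy 0 H y) ^- 2).
Proof.
pose f (y : V3) (s : R) := L y s * (H y s * H y s).
have C0L : C 0 L by apply: (Ccollar_le (leq0n 3)); exact: Ccollar_Lgraph.
have C0H : C 0 H by apply: Ccollar_le CH.
have Cf : C 0 f by apply: CcollarM => //; exact: CcollarM.
have f01 w : S2 w -> f w 0 = 0 \/ f w 0 = 1.
  move=> Sw; have [E|E] := L0_dichotomy Sw; [left|right].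
    by move: E; rewrite /f /bdy /= => ->; rewrite mul0r.
  by move: E; rewrite /f /bdy /= expr2.
have e0 : S2 (delta_mx 0 ord0 : V3).
  by rewrite /S2 /= /enorm dot_delta mxE !eqxx sqrtr1.
have key y : S2 y -> f y 0 = f (delta_mx 0 ord0) 0 by move=> Sy; exact: two_valued_sphere.
have [E|E] := f01 _ e0; [left|right] => y Sy; have := key y Sy; rewrite E.
  have hn : H y 0 != 0 by rewrite gt_eqF// (Hgt0 Sy).
  move/eqP; rewrite /f mulf_eq0 mulf_eq0 (negbTE hn) !orbF => /eqP.
  by [].
have hn : H y 0 != 0 by rewrite gt_eqF// (Hgt0 Sy).
rewrite /f -expr2 /bdy /= => e1.
by rewrite -[RHS]mul1r -e1 mulfK// expf_neq0.
Qed.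

Section Branch.
Hypothesis branch : forall y, S2 y -> bdy 0 L y = (bdy 0 H y) ^- 2.
Local Notation P0 := (bdy 0 P).
Local Notation H0 := (bdy 0 H).

Lemma bdy1_on_branch y : S2 y ->
  bdy 1 P y = - 2^-1 * ((H0 y) ^- 2 + dot (sgrad P0 y) (sgrad P0 y)).
Proof.
move=> Sy; rewrite -(branch Sy) (L_order0 m s00 CP Sy).
by move: (bdy 1 P y) (dot _ _) => a b; field.
Qed.

Lemma Lgraph_bdy1 y : S2 y -> bdy 1 L y =
  - (H0 y) ^- 2 * (slap P0 y + (H0 y)^-1 * dot (sgrad H0 y) (sgrad P0 y))
  - 3 * (H0 y) ^- 3 * bdy 1 H y.
Proof.
move=> Sy; have hn : H0 y != 0 by rewrite gt_eqF// Hgt0.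
rewrite (curvature_order1 s00 CP CH PH Sy (Hgt0 Sy) (branch Sy)).
rewrite (dot_sgrad_L0 s00 CP CH Hgt0 branch _ Sy).
move: hn; move: (H0 y) (bdy 1 H y) (slap P0 y) (dot _ _) => a b c d an.
by field.
Qed.

Lemma bdy2_of_Lgraph y : S2 y -> bdy 2 P y = - 2^-1 * bdy 1 L y
  + 2^-1 * dot (sgrad (fun z => dot (sgrad P0 z) (sgrad P0 z)) y) (sgrad P0 y)
  - (H0 y) ^- 3 * dot (sgrad H0 y) (sgrad P0 y).
Proof.
move=> Sy; rewrite (L_order1 m s00 CP Sy).
have -> : dot (sgrad P0 y) (sgrad (bdy 1 P) y) = - 2^-1 *
    (dot (sgrad (bdy 0 L) y) (sgrad P0 y)
     + dot (sgrad (fun z => dot (sgrad P0 z) (sgrad P0 z)) y) (sgrad P0 y)).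
  rewrite dotC /dot -big_split mulr_sumr; apply: eq_bigr => i _ /=.
  by rewrite (sgrad_P1 m s00 CP i Sy) -mulrDl mulrA.
rewrite (dot_sgrad_L0 s00 CP CH Hgt0 branch _ Sy).
move: (dot (sgrad (fun z => _) y) _) (dot _ _) (bdy 2 P y) (H0 y ^- 3) => a b c d.
by field.
Qed.

Lemma Lgraph_bdy2 y : S2 y -> bdy 1 H y = 0 -> bdy 2 L y =
  - (9 / 2) * (H0 y) ^+ 2 * (bdy 1 L y) ^+ 2
  - 4 * (bdy 1 L y * slap P0 y + bdy 0 L y * slap (bdy 1 P) y)
  + 2 * dot (sgrad (bdy 1 L) y) (sgrad P0 y)
  + 2 * dot (sgrad (fun z => (H0 z) ^- 2) y) (sgrad (bdy 1 P) y)
  + 4 * (H0 y) ^- 2 * bdy 1 P y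
  - 6 * (H0 y) ^- 3 * bdy 2 H y.
Proof.
move=> Sy h1; rewrite (curvature_order2 s00 CP CH PH Sy (Hgt0 Sy) (branch Sy) h1).
rewrite (sgrad_H0m2 branch _ Sy).
move: (bdy 1 L y) (bdy 0 L y) (bdy 2 H y) (bdy 1 P y) (slap P0 y) (slap (bdy 1 P) y).
move: (dot (sgrad (bdy 1 L) y) _) (dot (sgrad (bdy 0 L) y) _) (H0 y) => a b c d e f g h k.
by ring.
Qed.

Lemma bdy3_of_Lgraph y : S2 y -> bdy 3 P y = - 2^-1 * bdy 2 L y - bdy 1 P y ^+ 2
  - dot (sgrad (bdy 2 P) y) (sgrad P0 y)
  - dot (sgrad (bdy 1 P) y) (sgrad (bdy 1 P) y).
Proof.
move=> Sy; rewrite (L_order2 m s00 CP Sy) (dotC (sgrad (bdy 2 P) y)).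
move: (dot (sgrad P0 y) _) (dot (sgrad (bdy 1 P) y) _) (bdy 3 P y) (bdy 1 P y) => a b c d.
by field.
Qed.

Lemma compatibility_condition y : S2 y -> bdy 1 H y = 0 -> bdy 2 H y = 0 ->
  0 = - 2 * (H0 y) ^- 3 * bdy 3 H y
      + 9 / 2 * (H0 y)^-1 * dot (sgrad H0 y) (sgrad P0 y) * bdy 2 L y
      + 5 / 2 * bdy 2 L y * slap P0 y
      + 3 / 4 * (H0 y) ^+ 4 * (bdy 1 L y) ^+ 3
      - 4 * bdy 1 L y * slap (bdy 1 P) y
      - 2 * (H0 y) ^- 2 * slap (bdy 2 P) y
      + 6 * bdy 1 L y * bdy 1 P y
      + dot (sgrad (bdy 2 L) y) (sgrad P0 y)
      + 2 * dot (sgrad (bdy 1 L) y) (sgrad (bdy 1 P) y)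
      + dot (sgrad (fun z => (H0 z) ^- 2) y) (sgrad (bdy 2 P) y).
Proof.
move=> Sy h1 h2; rewrite (sgrad_H0m2 branch _ Sy).
have hn : H0 y != 0 by rewrite gt_eqF// Hgt0.
have E1 := Lgraph_bdy1 Sy; rewrite h1 mulr0 subr0 in E1.
rewrite [LHS](curvature_order3 s00 CP CH PH Sy (Hgt0 Sy) (branch Sy) h1 h2).
move: E1 hn; move: (dot (sgrad (bdy 2 L) y) _) (dot (sgrad (bdy 1 L) y) _).
move: (dot (sgrad (bdy 0 L) y) _) (dot (sgrad H0 y) _) => x0 t x2 x1.
move: (bdy 1 L y) (bdy 2 L y) (bdy 3 H y) (bdy 1 P y) (H0 y).
move: (slap P0 y) (slap (bdy 1 P) y) (slap (bdy 2 P) y) => d0 d1 d2 l1 l2 h3 p1 b E1 bn.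
have -> : d0 = - b ^+ 2 * l1 - b^-1 * t by rewrite E1; field.
by field.
Qed.

End Branch.
End BoundaryExpansion.

(** * Functionals expressible by boundary data *)

Section Expressible.
Context {R : realType}.
Local Notation V3 := 'rV[R]_3.
Local Notation fld := (V3 -> R -> R).
Variables (okP okH : pred nat) (hyp : R -> fld -> fld -> Prop).
Implicit Types (q r : fld -> fld -> V3 -> R).
Local Notation Ex := (expressible okP okH hyp).

Lemma Ex_eq q r : Ex q -> (forall s0 P H, hyp s0 P H -> forall y, S2 y -> q P H y = r P H y) ->
  Ex r.
Proof.
by move=> [e [ok eE]] qr; exists e; split=> // s0 P H h y Sy; rewrite -(qr s0)// (eE s0).
Qed.

Lemma Ex_cst c : Ex (fun _ _ _ => c).
Proof. by exists (dconst c). Qed.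

Lemma Ex_P j : okP j -> Ex (fun P _ => bdy j P).
Proof. by move=> ok; exists (dP j). Qed.

Lemma Ex_H j : okH j -> Ex (fun _ H => bdy j H).
Proof. by move=> ok; exists (dH j). Qed.

Lemma Ex_H0V : okH 0 -> Ex (fun _ H y => (bdy 0 H y)^-1).
Proof. by move=> ok; exists dH0inv. Qed.

Lemma ExD q r : Ex q -> Ex r -> Ex (fun P H y => q P H y + r P H y).
Proof.
move=> [e [ok eE]] [f [ok' fE]]; exists (Defs.dadd e f); split; first by rewrite /= ok.
by move=> s0 P H h y Sy; rewrite /= (eE s0)// (fE s0).
Qed.

Lemma ExM q r : Ex q -> Ex r -> Ex (fun P H y => q P H y * r P H y).
Proof.
move=> [e [ok eE]] [f [ok' fE]]; exists (dmul e f); split; first by rewrite /= ok.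
by move=> s0 P H h y Sy; rewrite /= (eE s0)// (fE s0).
Qed.

Lemma ExZ c q : Ex q -> Ex (fun P H y => c * q P H y).
Proof. by move=> h; apply: ExM => //; exact: Ex_cst. Qed.

Lemma ExN q : Ex q -> Ex (fun P H y => - q P H y).
Proof. by move=> /(ExZ (-1)) h; apply: (Ex_eq h) => s0 P H _ y _; rewrite mulN1r. Qed.

Lemma ExB q r : Ex q -> Ex r -> Ex (fun P H y => q P H y - r P H y).
Proof. by move=> hq hr; exact: ExD hq (ExN hr). Qed.

Lemma ExX n q : Ex q -> Ex (fun P H y => q P H y ^+ n).
Proof.
move=> h; elim: n => [|n IH]; first exact: Ex_cst.
by apply: (Ex_eq (ExM h IH)) => s0 P H _ y _; rewrite exprS.
Qed.

Lemma Ex_H0Vn n : okH 0 -> Ex (fun _ H y => (bdy 0 H y) ^- n).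
Proof.
move=> ok; apply: (Ex_eq (ExX n (Ex_H0V ok))) => s0 P H _ y _.
by rewrite exprVn.
Qed.

Lemma Ex_sgrad q i : Ex q -> Ex (fun P H y => sgrad (q P H) y 0 i).
Proof.
move=> [e [ok eE]]; exists (dtan i e); split=> // s0 P H h y Sy /=.
by apply: sgrad_congr => // z Sz; exact: eE h z Sz.
Qed.

Lemma Ex_sum n (q : 'I_n -> fld -> fld -> V3 -> R) : (forall i, Ex (q i)) ->
  Ex (fun P H y => \sum_i q i P H y).
Proof.
elim: n q => [|n IH] q h.
  by apply: (Ex_eq (Ex_cst 0)) => s0 P H _ y _; rewrite big_ord0.
apply: (Ex_eq (ExD (h ord0) (IH (fun i => q (lift ord0 i)) (fun i => h _)))).
by move=> s0 P H _ y _; rewrite big_ord_recl.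
Qed.

Lemma Ex_dot_sgrad q r : Ex q -> Ex r ->
  Ex (fun P H y => dot (sgrad (q P H) y) (sgrad (r P H) y)).
Proof.
move=> hq hr; apply: (Ex_sum (q := fun i P H y =>
  sgrad (q P H) y 0 i * sgrad (r P H) y 0 i)) => i.
by apply: ExM; exact: Ex_sgrad.
Qed.

Lemma Ex_slap q : Ex q -> Ex (fun P H y => slap (q P H) y).
Proof.
move=> hq; apply: (Ex_eq (Ex_sum (q := fun i P H y =>
  sgrad (fun z => sgrad (q P H) z 0 i) y 0 i) (fun i => Ex_sgrad _ (Ex_sgrad _ hq)))).
move=> s0 P H _ y _; rewrite /slap /sdiv; apply: eq_bigr => i _.
by rewrite mxE.
Qed.

End Expressible.

Lemma expressible_mono {R : realType} (okP okH okH' : pred nat)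
    (hyp : R -> ('rV[R]_3 -> R -> R) -> ('rV[R]_3 -> R -> R) -> Prop) q :
  (forall j, okH j -> okH' j) ->
  expressible okP okH hyp q -> expressible okP okH' hyp q.
Proof.
move=> sub [e [ok eE]]; exists e; split=> //; move: ok {eE}.
elim: e => [c|j|j||e1 h1 e2 h2|e1 h1 e2 h2|i e1 h1] //=.
- exact: sub.
- exact: sub.
- by move=> /andP[/h1 -> /h2 ->].
- by move=> /andP[/h1 -> /h2 ->].
Qed.

Section BoundaryValues.
Context {R : realType}.
Local Notation V3 := 'rV[R]_3.
Local Notation fld := (V3 -> R -> R).
Variables (m : R) (hm : 0 <= m).
Local Notation L := (Lgraph m).

Definition on_branch (P H : fld) :=
  forall y, S2 y -> bdy 0 (L P) y = (bdy 0 H y) ^- 2.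

Let hyp3 (s0 : R) (P H : fld) := [/\ surface (Ck 4) m s0 P H, on_branch P H &
  bigO_s 3 (fun y s => H y s - H y 0)].
Local Notation Ex3 := (expressible (pred1 0%N) (pred1 0%N) hyp3).

Lemma Ex_P1 (okP okH : pred nat) (hyp : R -> fld -> fld -> Prop) : okP 0%N -> okH 0%N ->
  (forall s0 P H, hyp s0 P H -> surface (Ck 4) m s0 P H /\ on_branch P H) ->
  expressible okP okH hyp (fun P _ => bdy 1 P).
Proof.
move=> o1 o2 sub; have EP : expressible okP okH hyp (fun P _ => bdy 0 P) by exact: Ex_P.
apply: (Ex_eq (ExZ (- 2^-1) (ExD (Ex_H0Vn okP hyp 2 o2) (Ex_dot_sgrad EP EP)))).
by move=> s0 P H /sub[S B] y Sy; rewrite (bdy1_on_branch S B Sy).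
Qed.

Lemma Ex_L1 (okP okH : pred nat) (hyp : R -> fld -> fld -> Prop) : okP 0%N -> okH 0%N ->
  (forall s0 P H, hyp s0 P H -> [/\ surface (Ck 4) m s0 P H, on_branch P H &
     bigO_s 2 (fun y s => H y s - H y 0)]) ->
  expressible okP okH hyp (fun P _ => bdy 1 (L P)).
Proof.
move=> o1 o2 sub; have EP : expressible okP okH hyp (fun P _ => bdy 0 P) by exact: Ex_P.
have EH : expressible okP okH hyp (fun _ H => bdy 0 H) by exact: Ex_H.
apply: (Ex_eq (ExM (ExN (Ex_H0Vn okP hyp 2 o2))
  (ExD (Ex_slap EP) (ExM (Ex_H0V okP hyp o2) (Ex_dot_sgrad EH EP))))).
move=> s0 P H /sub[S B /bigO2P O] y Sy.
by rewrite (Lgraph_bdy1 hm S B Sy) O// mulr0 subr0.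
Qed.

Lemma Ex_P2 (okP okH : pred nat) (hyp : R -> fld -> fld -> Prop) : okP 0%N -> okH 0%N ->
  (forall s0 P H, hyp s0 P H -> [/\ surface (Ck 4) m s0 P H, on_branch P H &
     bigO_s 2 (fun y s => H y s - H y 0)]) ->
  expressible okP okH hyp (fun P _ => bdy 2 P).
Proof.
move=> o1 o2 sub; have EP : expressible okP okH hyp (fun P _ => bdy 0 P) by exact: Ex_P.
have EH : expressible okP okH hyp (fun _ H => bdy 0 H) by exact: Ex_H.
have EL := Ex_L1 o1 o2 sub.
apply: (Ex_eq (ExB (ExD (ExZ (- 2^-1) EL)
    (ExZ 2^-1 (Ex_dot_sgrad (Ex_dot_sgrad EP EP) EP)))
  (ExM (Ex_H0Vn okP hyp 3 o2) (Ex_dot_sgrad EH EP)))).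
by move=> s0 P H /sub[S B _] y Sy; rewrite (bdy2_of_Lgraph S B Sy).
Qed.

Lemma Ex_L2 : Ex3 (fun P _ => bdy 2 (L P)).
Proof.
have sub s0 P H : hyp3 s0 P H -> [/\ surface (Ck 4) m s0 P H, on_branch P H &
     bigO_s 2 (fun y s => H y s - H y 0)].
  by case=> S B O; split=> // j j2; apply: O; exact: leq_trans j2 _.
have o : pred1 0%N 0%N by [].
have E0 : Ex3 (fun P _ => bdy 0 P) by exact: Ex_P.
have E1 : Ex3 (fun P _ => bdy 1 P) by apply: Ex_P1 => // s0 P H [].
have EL : Ex3 (fun P _ => bdy 1 (L P)) by exact: Ex_L1.
have EL0 : Ex3 (fun P _ => bdy 0 (L P)).
  by apply: (Ex_eq (Ex_H0Vn (pred1 0%N) hyp3 2 o)) => s0 P H [_ B _] y Sy; rewrite B.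
have EH : Ex3 (fun _ H => bdy 0 H) by exact: Ex_H.
have EHm := Ex_H0Vn (pred1 0%N) hyp3 2 o.
apply: (Ex_eq (ExD (ExD (ExD (ExB
    (ExM (ExZ (- (9 / 2)) (ExX 2 EH)) (ExX 2 EL))
    (ExZ 4 (ExD (ExM EL (Ex_slap E0)) (ExM EL0 (Ex_slap E1)))))
    (ExZ 2 (Ex_dot_sgrad EL E0))) (ExZ 2 (Ex_dot_sgrad EHm E1)))
    (ExM (ExZ 4 EHm) E1))).
move=> s0 P H [S B /bigO3P O] y Sy; have [h1 h2] := O y Sy.
by rewrite (Lgraph_bdy2 hm S B Sy h1) h2 mulr0 subr0.
Qed.

Lemma Ex_P3 : Ex3 (fun P _ => bdy 3 P).
Proof.
have sub s0 P H : hyp3 s0 P H -> [/\ surface (Ck 4) m s0 P H, on_branch P H &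
     bigO_s 2 (fun y s => H y s - H y 0)].
  by case=> S B O; split=> // j j2; apply: O; exact: leq_trans j2 _.
have E0 : Ex3 (fun P _ => bdy 0 P) by exact: Ex_P.
have E1 : Ex3 (fun P _ => bdy 1 P) by apply: Ex_P1 => // s0 P H [].
have E2 : Ex3 (fun P _ => bdy 2 P) by exact: Ex_P2.
apply: (Ex_eq (ExB (ExB (ExB (ExZ (- 2^-1) Ex_L2) (ExX 2 E1))
  (Ex_dot_sgrad E2 E0)) (Ex_dot_sgrad E1 E1))).
by move=> s0 P H [S B _] y Sy; rewrite (bdy3_of_Lgraph S Sy).
Qed.

End BoundaryValues.

Section HigherOrders.
Context {R : realType}.
Local Notation V3 := 'rV[R]_3.
Local Notation fld := (V3 -> R -> R).
Variables (m : R) (hm : 0 <= m).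
Local Notation L := (Lgraph m).
Local Notation sq := (fld -> fld -> V3 -> nat -> R).

Definition smooth_branch (s0 : R) (P H : fld) :=
  surface Cinfty m s0 P H /\ on_branch m P H.

Section Step.
Variable j' : nat.
Let j := j'.+1.
Local Notation E := (expressible (pred2 0%N 4%N) (fun i => (i < j.+1)%N) smooth_branch).
Implicit Types (c d : sq) (al be : fld -> fld -> V3 -> R).

Hypothesis EP : forall i, (i <= j)%N -> E (fun P _ => bdy i P).

Let l : sq := fun P _ y => ser (L P) y.
Let h : sq := fun _ H y => ser H y.
Let p1 : sq := fun P _ y => ser (ds P) y.

Lemma Ex_cauchy c d n : (forall i, (i <= n)%N -> E (fun P H y => c P H y i)) ->
  (forall i, (i <= n)%N -> E (fun P H y => d P H y i)) ->
  E (fun P H y => cauchy_mul (c P H y) (d P H y) n).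
Proof.
move=> hc hd; apply: (Ex_sum (q := fun (i : 'I_n.+1) P H y => c P H y i * d P H y (n - i)%N)) => i.
by apply: ExM; [apply: hc; rewrite -ltnS|apply: hd; exact: leq_subr].
Qed.

(** The first two coefficients of s^2 (1 - 2 m s) vanish. *)
Lemma Ex_cauchy_gss c n : (forall i, (i.+2 <= n)%N -> E (fun P H y => c P H y i)) ->
  E (fun P H y => cauchy_mul (gss_ser m) (c P H y) n).
Proof.
move=> hc; apply: (Ex_sum (q := fun (i : 'I_n.+1) P H y => gss_ser m i * c P H y (n - i)%N)) => -[[|[|i]] /= ni].
- by apply: (Ex_eq (Ex_cst _ _ _ 0)) => s0 P H _ y _; rewrite gss_serE mul0r.
- by apply: (Ex_eq (Ex_cst _ _ _ 0)) => s0 P H _ y _; rewrite gss_serE mul0r.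
- by apply: ExZ; apply: hc; rewrite ltnS in ni; lia.
Qed.

(** The unknown of the induction step is the coefficient of order j of L; the
    factor al with which it enters c at order j is all that has to be tracked. *)
Definition known_up_to c al :=
  (forall i, (i < j)%N -> E (fun P H y => c P H y i)) /\
  E (fun P H y => c P H y j - al P H y * l P H y j).

(** In a product, only the two extreme terms of order j involve the coefficient of
    order j of a factor. *)
Lemma known_cauchy c d al be : known_up_to c al -> known_up_to d be ->
  known_up_to (fun P H y => cauchy_mul (c P H y) (d P H y))
    (fun P H y => al P H y * d P H y 0%N + be P H y * c P H y 0%N).
Proof.
move=> [c1 c2] [d1 d2]; split=> [i ij|].
  by apply: Ex_cauchy => k ki; [apply: c1|apply: d1]; exact: leq_ltn_trans ki ij.
have mid : E (fun P H y => \sum_(i < j') c P H y i.+1 * d P H y (j' - i)%N).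
  apply: (Ex_sum (q := fun (i : 'I_j') P H y => c P H y i.+1 * d P H y (j' - i)%N)) => i.
  apply: ExM; first by apply: c1; rewrite /j ltnS.
  by apply: d1; rewrite /j ltnS leq_subr.
apply: (Ex_eq (ExD (ExD (ExM c2 (d1 0%N isT)) (ExM (c1 0%N isT) d2)) mid)).
move=> s0 P H _ y _.
rewrite /cauchy_mul big_ord_recl big_ord_recr /= subnn /bump /=.
under [in RHS]eq_bigr do rewrite add1n subSS.
rewrite subn0 /=.
move: (\sum_(i < j') _) => M.
by move: (c P H y _) (c P H y _) (d P H y _) (d P H y _) (al P H y) (be P H y) (l P H y _)
  => u v w x a b z; ring.
Qed.

Lemma known_eq c al be : (forall s0 P H, smooth_branch s0 P H ->
    forall y, S2 y -> al P H y = be P H y) ->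
  known_up_to c al -> known_up_to c be.
Proof.
move=> e [c1 c2]; split=> //; apply: (Ex_eq c2) => s0 P H h0 y Sy.
by rewrite (e _ _ _ h0 y Sy).
Qed.

Lemma knownD c d al be : known_up_to c al -> known_up_to d be ->
  known_up_to (fun P H y i => c P H y i + d P H y i) (fun P H y => al P H y + be P H y).
Proof.
move=> [c1 c2] [d1 d2]; split=> [i ij|]; first by apply: ExD; [exact: c1|exact: d1].
apply: (Ex_eq (ExD c2 d2)) => s0 P H _ y _.
by move: (c P H y _) (d P H y _) (al P H y) (be P H y) (l P H y _) => u v a b z; ring.
Qed.

Lemma knownZ (x : R) c al : known_up_to c al ->
  known_up_to (fun P H y i => x * c P H y i) (fun P H y => x * al P H y).
Proof.
move=> [c1 c2]; split=> [i ij|]; first by apply: ExZ; exact: c1.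
apply: (Ex_eq (ExZ x c2)) => s0 P H _ y _.
by move: (c P H y _) (al P H y) (l P H y _) => u a z; ring.
Qed.

Lemma known0 c : (forall i, (i <= j)%N -> E (fun P H y => c P H y i)) ->
  known_up_to c (fun _ _ _ => 0).
Proof.
move=> h0; split=> [i ij|]; first by apply: h0; exact: ltnW.
by apply: (Ex_eq (h0 j (leqnn j))) => s0 P H _ y _; rewrite mul0r subr0.
Qed.

Lemma smooth_collar s0 P H : smooth_branch s0 P H ->
  [/\ 0 < s0, forall n, Ccollar n s0 P & forall n, Ccollar n s0 H].
Proof.
case=> S _; split=> [|n|n]; first by case: S.
  by have [] := surface_collar (surface_Cinfty n S).
by have [] := surface_collar (surface_Cinfty n S).
Qed.

Lemma E_h i : (i <= j)%N -> E (fun P H y => h P H y i).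
Proof.
move=> ij; have EH : E (fun _ H => bdy i H) by apply: Ex_H; rewrite ltnS.
by apply: (Ex_eq (ExZ (i`!%:R^-1) EH)) => s0 P H _ y _; rewrite mulrC.
Qed.

Lemma E_p1 i : (i < j)%N -> E (fun P H y => p1 P H y i).
Proof.
move=> ij; apply: (Ex_eq (ExZ (i`!%:R^-1) (EP ij))) => s0 P H _ y _.
by rewrite mulrC /p1 /ser bdyS.
Qed.

Lemma E_p2 i : (i.+2 <= j)%N -> E (fun P H y => ser (ds (ds P)) y i).
Proof.
move=> ij; apply: (Ex_eq (ExZ (i`!%:R^-1) (EP ij))) => s0 P H _ y _.
by rewrite mulrC /ser !bdyS.
Qed.

Lemma E_t k i : (i <= j)%N -> E (fun P H y => ser (tder k P) y i).
Proof.
move=> ij; apply: (Ex_eq (ExZ (i`!%:R^-1) (Ex_sgrad k (EP ij)))) => s0 P H hs y Sy.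
have [s00 CP _] := smooth_collar hs.
by rewrite mulrC (ser_tder s00 Sy k (CP _)).
Qed.

Lemma E_q i : (i <= j)%N ->
  E (fun P H y => \sum_(k < 3) ser (tder k (tder k P)) y i).
Proof.
move=> ij; apply: (Ex_eq (ExZ (i`!%:R^-1) (Ex_slap (EP ij)))) => s0 P H hs y Sy.
have [s00 CP _] := smooth_collar hs.
by rewrite mulrC (sum_ser_tder2 s00 Sy (CP _)).
Qed.

(** In L = - (2 P_s + gss P_s^2 + |grad P|^2) the second term delays P_s by two
    orders, so that at order i only 2 P_s involves more than i derivatives in s of P. *)
Lemma E_L_rest i : (i <= j)%N -> E (fun P H y => l P H y i + 2 * p1 P H y i).
Proof.
move=> ij.
have A1 : E (fun P H y => cauchy_mul (gss_ser m) (cauchy_mul (p1 P H y) (p1 P H y)) i).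
  apply: (Ex_cauchy_gss (c := fun P H y => cauchy_mul (p1 P H y) (p1 P H y))) => k ki.
  by apply: Ex_cauchy => n nk; apply: E_p1; lia.
have A2 : E (fun P H y => \sum_(k < 3) cauchy_mul (ser (tder k P) y) (ser (tder k P) y) i).
  apply: (Ex_sum (q := fun (k : 'I_3) P H y =>
    cauchy_mul (ser (tder k P) y) (ser (tder k P) y) i)) => k.
  by apply: (Ex_cauchy (c := fun P H y => ser (tder k P) y)
     (d := fun P H y => ser (tder k P) y)) => n ni; apply: E_t; lia.
apply: (Ex_eq (ExN (ExD A1 A2))) => s0 P H hs y Sy.
have [s00 CP _] := smooth_collar hs.
rewrite /l (ser_Lgraph m s00 (CP i.+1) Sy (leqnn i)) /L_ser -/(p1 P H y).
by move: (p1 P H y i) (cauchy_mul _ _ i) (\sum_(k < 3) _) => a b c; ring.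
Qed.

Lemma E_l i : (i < j)%N -> E (fun P H y => l P H y i).
Proof.
move=> ij; apply: (Ex_eq (ExB (E_L_rest (ltnW ij)) (ExZ 2 (E_p1 ij)))).
by move=> s0 P H _ y _; rewrite addrK.
Qed.

Lemma known_l : known_up_to l (fun _ _ _ => 1).
Proof.
split; first exact: E_l.
by apply: (Ex_eq (Ex_cst _ _ _ 0)) => s0 P H _ y _; rewrite mul1r subrr.
Qed.

Lemma E_g i : (i <= j)%N -> E (fun P H y => grad_s_ser m P y i).
Proof.
move=> ij; apply: ExD; first exact: Ex_cst.
by apply: (Ex_cauchy_gss (c := p1)) => k ki; apply: E_p1; lia.
Qed.

Lemma E_e i : (i < j)%N -> E (fun P H y => dgrad_s_ser m P y i).
Proof.
move=> ij; apply: ExD.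
  apply: (Ex_cauchy (c := fun _ _ _ => dgss_ser m) (d := p1)) => k ki; first exact: Ex_cst.
  by apply: E_p1; lia.
apply: (Ex_cauchy_gss (c := fun P _ y => ser (ds (ds P)) y)) => k ki.
by apply: E_p2; lia.
Qed.

Lemma ser_dsE f (y : V3) i : ser (ds f) y i = i.+1%:R * ser f y i.+1.
Proof.
rewrite /ser bdyS factS natrM.
have : (i.+1%:R : R) != 0 by rewrite pnatr_eq0.
have : (i`!%:R : R) != 0 by rewrite pnatr_eq0 -lt0n fact_gt0.
move: (bdy _ _ _) (i.+1%:R : R) (i`!%:R : R) => x b a a0 b0.
by field; rewrite a0 b0.
Qed.

Lemma E_tl k i : (i < j)%N -> E (fun P H y => ser (tder k (L P)) y i).
Proof.
move=> ij; have EL : E (fun P _ => bdy i (L P)).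
  apply: (Ex_eq (ExZ (i`!%:R) (E_l ij))) => s0 P H _ y _.
  by rewrite /l /ser mulrC divfK// pnatr_eq0 -lt0n fact_gt0.
apply: (Ex_eq (ExZ (i`!%:R^-1) (Ex_sgrad k EL))) => s0 P H hs y Sy.
have [s00 CP _] := smooth_collar hs.
by rewrite mulrC (ser_tder s00 Sy k (Ccollar_Lgraph m (CP i.+2))).
Qed.

(** The product with L_s is set apart, as its coefficient of order i involves that
    of order i + 1 of L. *)
Lemma E_b_rest i : (i < j)%N ->
  E (fun P H y => tail_ser m P y i
     - 2^-1 * cauchy_mul (grad_s_ser m P y) (ser (ds (L P)) y) i).
Proof.
move=> ij; have sm k : (k <= i)%N -> (k < j)%N by move=> ki; exact: leq_ltn_trans ki ij.
have B1 : E (fun P H y => cauchy_mul (ser (L P) y) (dgrad_s_ser m P y) i).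
  apply: (Ex_cauchy (c := l) (d := fun P _ y => dgrad_s_ser m P y)) => k /sm kj.
    exact: E_l.
  exact: E_e.
have B2 : E (fun P H y => cauchy_mul (ser (L P) y)
    (fun n => \sum_(k < 3) ser (tder k (tder k P)) y n) i).
  apply: (Ex_cauchy (c := l)
    (d := fun P _ y n => \sum_(k < 3) ser (tder k (tder k P)) y n)) => k /sm kj.
    exact: E_l.
  exact: E_q (ltnW kj).
have B3 : E (fun P H y => \sum_(k < 3)
    cauchy_mul (ser (tder k (L P)) y) (ser (tder k P) y) i).
  apply: (Ex_sum (q := fun (k : 'I_3) P H y =>
    cauchy_mul (ser (tder k (L P)) y) (ser (tder k P) y) i)) => k.
  apply: (Ex_cauchy (c := fun P _ y => ser (tder k (L P)) y)
    (d := fun P _ y => ser (tder k P) y)) => n /sm nj.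
    exact: E_tl.
  exact: E_t (ltnW nj).
apply: (Ex_eq (ExD (ExB (ExN B1) B2) (ExZ 2^-1 B3))) => s0 P H _ y _.
rewrite /tail_ser; move: (cauchy_mul _ _ i) (cauchy_mul _ _ i) (cauchy_mul _ _ i) (\sum_(k < 3) _).
by move=> a b c d; ring.
Qed.

Lemma E_b i : (i < j')%N -> E (fun P H y => tail_ser m P y i).
Proof.
move=> ij; have G : E (fun P H y => cauchy_mul (grad_s_ser m P y) (ser (ds (L P)) y) i).
  apply: (Ex_cauchy (c := fun P _ y => grad_s_ser m P y) (d := fun P _ y => ser (ds (L P)) y)) => k ki.
    by apply: E_g; lia.
  have kj : (k.+1 < j)%N by lia.
  by apply: (Ex_eq (ExZ k.+1%:R (E_l kj))) => s0 P H _ y _; rewrite ser_dsE.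
have ij' : (i < j)%N by lia.
apply: (Ex_eq (ExD (E_b_rest ij') (ExZ 2^-1 G))) => s0 P H _ y _.
by rewrite subrK.
Qed.

(** The coefficient of order j - 1 of L_s is j times that of order j of L. *)
Lemma E_b_top : E (fun P H y => tail_ser m P y j' - j%:R / 2 * l P H y j).
Proof.
have G : E (fun P H y => \sum_(i < j') grad_s_ser m P y i.+1 * ser (ds (L P)) y (j' - i.+1)%N).
  apply: (Ex_sum (q := fun (i : 'I_j') P H y =>
    grad_s_ser m P y i.+1 * ser (ds (L P)) y (j' - i.+1)%N)) => i.
  have ij := ltn_ord i.
  apply: ExM; first by apply: E_g; rewrite /j; lia.
  have kj : ((j' - i.+1).+1 < j)%N by rewrite /j; lia.
  by apply: (Ex_eq (ExZ (j' - i.+1).+1%:R (E_l kj))) => s0 P H _ y _; rewrite ser_dsE.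
apply: (Ex_eq (ExD (E_b_rest (ltnSn j')) (ExZ 2^-1 G))) => s0 P H _ y _.
rewrite /cauchy_mul big_ord_recl /= subn0 /bump /=.
under [in X in 2^-1 * (_ + X)]eq_bigr do rewrite add1n.
rewrite (ser_dsE (L P) y j') -/(l P H y) -/j.
have -> : grad_s_ser m P y 0 = 1 by rewrite /grad_s_ser /one_ser cauchy0 gss_serE mul0r addr0.
move: (tail_ser m P y j') (\sum_(i < j') _) (l P H y j) (j%:R) => a b c d.
by field.
Qed.

Lemma known_r : known_up_to (fun P _ y => curv_ser m P y) (fun _ _ _ => 3 + j%:R / 2).
Proof.
have kg : known_up_to (fun P _ y => grad_s_ser m P y) (fun _ _ _ => 0) by apply: known0; exact: E_g.
have g0 P y : grad_s_ser m P y 0 = 1 by rewrite /grad_s_ser /one_ser cauchy0 gss_serE mul0r addr0.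
have kb : known_up_to (fun P _ y => shift1 (tail_ser m P y)) (fun _ _ _ => j%:R / 2).
  split; last exact: E_b_top.
  by move=> [|i] ij; [exact: Ex_cst|apply: E_b].
apply: known_eq (knownD (knownZ 3 (known_cauchy known_l kg)) kb) => s0 P H _ y _.
by rewrite g0 mul0r addr0 !mulr1.
Qed.

(** The two sides of the squared equation contain the unknown with the factors
    27 H_0^-2 and (18 + 3 j) H_0^-2; they differ unless j = 3. *)
Lemma Ex_next_bdy : j != 3 -> E (fun P _ => bdy j.+1 P).
Proof.
move=> j3.
have kh : known_up_to h (fun _ _ _ => 0) by apply: known0; exact: E_h.
have [_ k1] := knownZ 9 (known_cauchy (known_cauchy kh kh)
  (known_cauchy known_l (known_cauchy known_l known_l))).
have [_ k2] := known_cauchy known_r known_r.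
have jn : (9 - 3 * j%:R : R) != 0.
  rewrite subr_eq0 -natrM eqr_nat; apply: contra j3 => /eqP e; apply/eqP; lia.
have EH0 := E_h (leq0n j).
have El : E (fun P H y => l P H y j).
  apply: (Ex_eq (ExZ (9 - 3 * j%:R)^-1 (ExM (ExX 2 EH0) (ExB k2 k1)))).
  move=> s0 P H hs y Sy; have [s00 CP CH] := smooth_collar hs.
  have [S B] := hs; have PH : prescribed m s0 P H by exact: surface_prescribed S (CP 2%N).
  have := curvature_series s00 (CP j.+2) (CH j.+1) PH Sy (leqnSn j).
  rewrite -/(h P H y) -/(l P H y) => ->.
  have h0 : h P H y 0 != 0.
    rewrite /h ser0 gt_eqF//; case: S => _ _ _ _ _ pos _ _; apply: pos => //.
    by rewrite lexx.
  have l0 : l P H y 0 = h P H y 0 ^- 2 by rewrite /l /h !ser0 B.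
  have r0 : curv_ser m P y 0 = 3 * l P H y 0.
    by rewrite /curv_ser /= !cauchy0 /grad_s_ser /one_ser cauchy0 gss_serE mul0r !addr0 mulr1.
  rewrite !cauchy0 r0 l0.
  move: h0 jn; move: (h P H y 0) (l P H y j) (cauchy_mul _ _ j) (j%:R) => a b c d an dn.
  by field; rewrite an dn.
apply: (Ex_eq (ExZ j`!%:R (ExZ 2^-1 (ExB (E_L_rest (leqnn j)) El)))).
move=> s0 P H _ y _; rewrite /p1 /ser bdyS.
have : (j`!%:R : R) != 0 by rewrite pnatr_eq0 -lt0n fact_gt0.
move: (bdy j.+1 P y) (l P H y j) (j`!%:R) => a b c cn.
by field.
Qed.

End Step.

(** The derivative of order 4, which the equation of order 3 does not determine,
    is among the data. *)
Lemma Ex_bdy k : expressible (pred2 0%N 4%N) (fun i => (i < k)%N) smooth_branch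
  (fun P _ => bdy k P).
Proof.
elim/ltn_ind: k => -[_|[_|k IH]].
- exact: Ex_P.
- apply: (Ex_P1 (m := m)) => // s0 P H [S B]; split=> //; exact: surface_Cinfty.
have [k3|k3] := eqVneq k.+1 3; first by rewrite k3; exact: Ex_P.
apply: Ex_next_bdy => // i ik; apply: (expressible_mono _ (IH i ik)) => j /= ji.
by apply: leq_trans ji _; exact: ltnW.
Qed.

End HigherOrders.

Theorem theorem3p1 (R : realType) (m : R) (hm : 0 <= m) :
  let branch (P H : 'rV[R]_3 -> R -> R) :=
    forall y, S2 y -> bdy 0 (Lgraph m P) y = (bdy 0 H y) ^- 2 in
  let remainder (H : 'rV[R]_3 -> R -> R) := fun y s => H y s - H y 0 in
  (forall (s0 : R) (P H : 'rV[R]_3 -> R -> R), surface (Ck 4) m s0 P H ->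
    let P0 := bdy 0 P in let P1 := bdy 1 P in
    let P2 := bdy 2 P in let P3 := bdy 3 P in
    let L0 := bdy 0 (Lgraph m P) in let L1 := bdy 1 (Lgraph m P) in
    let L2 := bdy 2 (Lgraph m P) in
    let H0 := bdy 0 H in let H3 := bdy 3 H in
    let H0m2 := fun y => (H0 y) ^- 2 in
    (* (a) *)
    ((forall y, S2 y -> L0 y = 0) \/
     (forall y, S2 y -> L0 y = (H0 y) ^- 2)) /\
    (* (b) *)
    (branch P H ->
      (* (i) *)
      (forall y, S2 y ->
        P1 y = - 2^-1 * ((H0 y) ^- 2 + dot (sgrad P0 y) (sgrad P0 y))) /\
      (* (ii) *)
      ((bigO_s 2 (remainder H) <->
          (forall y, S2 y ->
            L1 y = - (H0 y) ^- 2 *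
              (slap P0 y + (H0 y)^-1 * dot (sgrad H0 y) (sgrad P0 y)))) /\
       ((forall y, S2 y ->
            L1 y = - (H0 y) ^- 2 *
              (slap P0 y + (H0 y)^-1 * dot (sgrad H0 y) (sgrad P0 y))) <->
        (forall y, S2 y ->
            P2 y = 2^-1 * (H0 y) ^- 2 * slap P0 y
              + 2^-1 * dot (sgrad (fun z => dot (sgrad P0 z) (sgrad P0 z)) y)
                           (sgrad P0 y)
              - 2^-1 * (H0 y) ^- 3 * dot (sgrad H0 y) (sgrad P0 y)))) /\
      (* (iii) *)
      (bigO_s 2 (remainder H) ->
        (bigO_s 3 (remainder H) <->
          (forall y, S2 y ->
            L2 y = - (9 / 2) * (H0 y) ^+ 2 * (L1 y) ^+ 2
              - 4 * (L1 y * slap P0 y + L0 y * slap P1 y)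
              + 2 * dot (sgrad L1 y) (sgrad P0 y)
              + 2 * dot (sgrad H0m2 y) (sgrad P1 y)
              + 4 * (H0 y) ^- 2 * P1 y)) /\
        ((forall y, S2 y ->
            L2 y = - (9 / 2) * (H0 y) ^+ 2 * (L1 y) ^+ 2
              - 4 * (L1 y * slap P0 y + L0 y * slap P1 y)
              + 2 * dot (sgrad L1 y) (sgrad P0 y)
              + 2 * dot (sgrad H0m2 y) (sgrad P1 y)
              + 4 * (H0 y) ^- 2 * P1 y) <->
         (forall y, S2 y ->
            P3 y = 9 / 4 * (H0 y) ^+ 2 * (L1 y) ^+ 2
              + 2 * (L1 y * slap P0 y + (H0 y) ^- 2 * slap P1 y)
              - dot (sgrad L1 y) (sgrad P0 y)
              - dot (sgrad H0m2 y) (sgrad P1 y)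
              - 2 * (H0 y) ^- 2 * P1 y
              - dot (sgrad P2 y) (sgrad P0 y)
              - dot (sgrad P1 y) (sgrad P1 y)
              - (P1 y) ^+ 2)))) /\
    (* (c) *)
    (branch P H -> bigO_s 3 (remainder H) ->
      forall y, S2 y ->
        0 = - 2 * (H0 y) ^- 3 * H3 y
            + 9 / 2 * (H0 y)^-1 * dot (sgrad H0 y) (sgrad P0 y) * L2 y
            + 5 / 2 * L2 y * slap P0 y
            + 3 / 4 * (H0 y) ^+ 4 * (L1 y) ^+ 3
            - 4 * L1 y * slap P1 y
            - 2 * (H0 y) ^- 2 * slap P2 y
            + 6 * L1 y * P1 y
            + dot (sgrad L2 y) (sgrad P0 y)
            + 2 * dot (sgrad L1 y) (sgrad P1 y)
            + dot (sgrad H0m2 y) (sgrad P2 y))) /\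
  (* (b)(iii) and (c): dependence on H and P at s = 0 only *)
  (let hyp2 := fun s0 P H =>
     [/\ surface (Ck 4) m s0 P H, branch P H & bigO_s 2 (remainder H)] in
   let hyp3 := fun s0 P H =>
     [/\ surface (Ck 4) m s0 P H, branch P H & bigO_s 3 (remainder H)] in
   let expr := fun hyp q => expressible (pred1 0%N) (pred1 0%N) hyp q in
   [/\ expr hyp2 (fun P _ => bdy 1 P),
       expr hyp2 (fun P _ => bdy 1 (Lgraph m P)) &
       expr hyp2 (fun P _ => bdy 2 P)] /\
   (expr hyp3 (fun P _ => bdy 2 (Lgraph m P)) /\
    expr hyp3 (fun P _ => bdy 3 P))) /\
  (* (d) *)
  (forall k : nat,
     expressible (pred2 0%N 4%N) (fun j => (j < k)%N)
       (fun s0 P H => surface Cinfty m s0 P H /\ branch P H)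
       (fun P _ => bdy k P)).
Proof.
move=> branch remainder.
have cancel (a b c : R) n : c != 0 -> a - n.+1%:R * c ^- 3 * b = a -> b = 0.
  move=> c0 e; have : n.+1%:R * c ^- 3 * b = 0 by rewrite -(subKr a (_ * b)) e subrr.
  move=> /eqP; rewrite mulf_eq0 mulf_eq0 invr_eq0 expf_eq0 (negbTE c0).
  by rewrite pnatr_eq0 /= => /eqP.
split; last split.
- move=> s0 P H S P0 P1 P2 P3 L0 L1 L2 H0 H3 H0m2.
  split; first exact: (boundary_dichotomy hm S).
  split; last first.
    move=> B /bigO3P O y Sy; have [h1 h2] := O y Sy.
    exact: (compatibility_condition hm S B Sy h1 h2).
  move=> B.
  have hn y : S2 y -> H0 y != 0.
    move=> Sy; rewrite gt_eqF//; case: S => s00 _ _ _ _ pos _ _; apply: pos => //.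
    by rewrite lexx s00.
  split; first by move=> y Sy; exact: (bdy1_on_branch S B Sy).
  split; first split.
  + split=> [/bigO2P O y Sy|E].
      by rewrite [LHS](Lgraph_bdy1 hm S B Sy) O// mulr0 subr0.
    apply/bigO2P => y Sy; have := E y Sy; rewrite /L1 (Lgraph_bdy1 hm S B Sy).
    exact: (cancel _ _ _ 2 (hn y Sy)).
  + split=> E y Sy; have := E y Sy; have := bdy2_of_Lgraph S B Sy;
      rewrite -/P0 -/H0 -/P2 -/L1.
      move=> -> ->; have := hn y Sy.
      move: (slap P0 y) (dot _ _) (dot (sgrad H0 y) _) (H0 y) => a b c d dn.
      by field.
    move: (hn y Sy); move: (slap P0 y) (dot _ _) (dot (sgrad H0 y) _) (H0 y) (P2 y) (L1 y).
    move=> a b c d p l dn E1 E2.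
    have -> : l = - 2 * (p - 2^-1 * b + d ^- 3 * c) by rewrite E1; field.
    by rewrite E2; field.
  move=> /bigO2P O1; split.
  + split=> [/bigO3P O y Sy|E].
      have [h1 h2] := O y Sy.
      by rewrite [LHS](Lgraph_bdy2 hm S B Sy h1) h2 mulr0 subr0.
    apply/bigO3P => y Sy; split; first exact: O1.
    have := E y Sy; rewrite /L2 (Lgraph_bdy2 hm S B Sy (O1 y Sy)).
    exact: (cancel _ _ _ 5 (hn y Sy)).
  + have BL y : S2 y -> L0 y = H0 y ^- 2 by exact: B.
    split=> E y Sy; have := E y Sy; have := bdy3_of_Lgraph S Sy; rewrite -/P0 -/P1 -/P2 -/P3 -/L2.
      move=> -> ->; rewrite BL//.
      move: (dot (sgrad L1 y) _) (dot (sgrad H0m2 y) _) (dot (sgrad P2 y) _).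
      move: (dot (sgrad P1 y) _) (slap P0 y) (slap P1 y) (L1 y) (P1 y) (H0 y) (hn y Sy).
      by move=> a b c d e f fn u v w; field.
    rewrite BL//; move: (hn y Sy).
    move: (dot (sgrad L1 y) _) (dot (sgrad H0m2 y) _) (dot (sgrad P2 y) _).
    move: (dot (sgrad P1 y) _) (slap P0 y) (slap P1 y) (L1 y) (P1 y) (H0 y) (L2 y) (P3 y).
    move=> a b c d e f l p u v w fn E1 E2.
    have -> : l = - 2 * (p + e ^+ 2 + w + a) by rewrite E1; field.
    by rewrite E2; field.
- move=> hyp2 hyp3 expr; split.
    split; first by apply: (Ex_P1 (m := m)) => // s0 P H [].
      by apply: (Ex_L1 hm).
    by apply: (Ex_P2 hm).
  split; first exact: (Ex_L2 hm).
  exact: (Ex_P3 hm).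
- exact: (Ex_bdy hm).
Qed.
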